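(* Let $\rho$ be a function norm over a finite measure space $(\Omega,\Sigma,\mu)$. Suppose that $L_\rho\subseteq L_2(\mu)$ and that $L_\rho$ has Rademacher type $2$. Let $\Psi=(\psi_n)_{n=1}^\infty$ be a semi-normalized unconditional basic sequence in $L_\rho$. (i) If $\inf_n \|\psi_n\|_2>0$, then $\Psi$ is equivalent to the unit vector system of $\ell_2$. (ii) If $\inf_n \|\psi_n\|_2=0$, then $\Psi$ has a subsequence congruent to a pairwise disjointly supported sequence $\Phi$ in $L_\rho$ consisting of simple functions escaping to infinity.
   Context: Let $(\Omega,\Sigma,\mu)$ be a $\sigma$-finite measure space, $\mathbb F$ the real or complex field, $L_0(\mu)$ the space of $\mathbb F$-valued measurable functions and $L_0^+(\mu)$ the cone of measurable functions with values in $[0,\infty]$ (functions equal a.e. are identified). A function norm over $(\Omega,\Sigma,\mu)$ is a map $\rho\colon L_0^+(\mu)\to[0,\infty]$ such that: (a) $\rho(f)=0$ iff $f=0$ a.e.; (b) $\rho(f+g)\le\rho(f)+\rho(g)$; (c) $\rho(tf)=t\rho(f)$ for $t\ge 0$; (d) $\rho(f)\le\rho(g)$ if $f\le g$ a.e.; (e) $\rho(\chi_E)<\infty$ if $\mu(E)<\infty$; (f) $\rho(\lim_n f_n)=\lim_n\rho(f_n)$ for every non-decreasing sequence $(f_n)$ in $L_0^+(\mu)$; (g) for every $E$ with $\mu(E)<\infty$ there is a constant $C_E$ with $\int_E f\,d\mu\le C_E\rho(f)$ for all $f\in L_0^+(\mu)$. Put $L_\rho=\{f\in L_0(\mu):\rho(|f|)<\infty\}$,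 a Banach lattice with norm $\|f\|_\rho=\rho(|f|)$. $\|\cdot\|_2$ is the norm of $L_2(\mu)$. A basic sequence is a sequence that is a Schauder basis of its closed linear span; it is unconditional if every rearrangement of it is a basic sequence; it is semi-normalized if its norms are bounded above and bounded away from $0$. Two sequences $(x_n)$, $(y_n)$ in Banach spaces are equivalent if there is a linear isomorphism between their closed linear spans with $x_n\mapsto y_n$ for all $n$; two sequences in the same space $U$ are congruent if there is an automorphism $S$ of $U$ (bounded linear bijection with bounded inverse) with $S(x_n)=y_n$ for all $n$. Let $\operatorname{supp}(f)=\Omega\setminus f^{-1}(0)$. A sequence $(f_n)$ in $L_0(\mu)$ escapes to infinity if $\lim_n \operatorname{ess\,inf}\{|f_n(\omega)|:\omega\in\operatorname{supp}(f_n)\}=\infty$. *)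

(* Defs.v *)
From HB Require Import structures.
From mathcomp Require Import all_boot all_order all_algebra.
From mathcomp Require Import generic_quotient ring_quotient complex.
From mathcomp Require Import all_classical all_reals all_analysis.
From mathcomp Require Import measurable_realfun ess_sup_inf.

Set Implicit Arguments.
Unset Strict Implicit.
Unset Printing Implicit Defensive.

Import Order.TTheory GRing.Theory Num.Theory.
Import numFieldNormedType.Exports.

Local Open Scope classical_set_scope.
Local Open Scope ring_scope.

Section Scalars.
Variable R : realType.

Inductive scalar_kind := RealScalars | ComplexScalars.

Definition scalar (k : scalar_kind) : numFieldType :=
  match k with RealScalars => R | ComplexScalars => R[i] end.

(* In R[i] the canonical norm is R[i]-valued; modulus is its R-valued version,
   and real_scalar embeds R back into the scalar field. *)
Definition modulus (k : scalar_kind) : scalar k -> R :=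
  match k return scalar k -> R with
  | RealScalars => fun x : R => `|x|
  | ComplexScalars => fun z : R[i] => Normc.normc z
  end.

Definition real_scalar (k : scalar_kind) : R -> scalar k :=
  match k return R -> scalar k with
  | RealScalars => fun x : R => x
  | ComplexScalars => fun x : R => x%:C%C
  end.

Definition scalar_measurable d (T : measurableType d) (k : scalar_kind) :
    (T -> scalar k) -> Prop :=
  match k return (T -> scalar k) -> Prop with
  | RealScalars => fun f : T -> R => measurable_fun [set: T] f
  | ComplexScalars => fun f : T -> R[i] =>
      measurable_fun [set: T] (fun w => complex.Re (f w)) /\
      measurable_fun [set: T] (fun w => complex.Im (f w))
  end.

Lemma real_scalar_modulus k (x : scalar k) : real_scalar k (modulus x) = `|x|.
Proof. by case: k x => //= -[a b]; rewrite normc_def. Qed.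

Lemma real_scalar_inj k : injective (real_scalar k).
Proof. by case: k => // x y []. Qed.

Lemma real_scalarD k x y :
  real_scalar k (x + y) = real_scalar k x + real_scalar k y.
Proof. by case: k => //=; rewrite rmorphD. Qed.

Lemma real_scalarM k x y :
  real_scalar k (x * y) = real_scalar k x * real_scalar k y.
Proof. by case: k => //=; rewrite rmorphM. Qed.

Lemma real_scalar0 k : real_scalar k 0 = 0.
Proof. by case: k. Qed.

Lemma ler_real_scalar k x y : (real_scalar k x <= real_scalar k y) = (x <= y).
Proof. by case: k => //=; rewrite lecR. Qed.

Lemma modulus_ge0 k (x : scalar k) : 0 <= modulus x.
Proof.
by rewrite -(ler_real_scalar k) real_scalar0 real_scalar_modulus normr_ge0.
Qed.

Lemma modulusD k (x y : scalar k) : modulus (x + y) <= modulus x + modulus y.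
Proof.
by rewrite -(ler_real_scalar k) real_scalarD !real_scalar_modulus ler_normD.
Qed.

Lemma modulusM k (x y : scalar k) : modulus (x * y) = modulus x * modulus y.
Proof.
by apply: (@real_scalar_inj k); rewrite real_scalarM !real_scalar_modulus normrM.
Qed.

Lemma modulus_eq0 k (x : scalar k) : (modulus x == 0) = (x == 0).
Proof.
by rewrite -(inj_eq (@real_scalar_inj k)) real_scalar_modulus real_scalar0 normr_eq0.
Qed.

Lemma modulus0 k : modulus (0 : scalar k) = 0.
Proof. by apply/eqP; rewrite modulus_eq0. Qed.

Lemma modulus1 k : modulus (1 : scalar k) = 1.
Proof.
apply: (@real_scalar_inj k); rewrite real_scalar_modulus normr1.
by case: k.
Qed.

End Scalars.

Section FiniteNormSpace.
Variables (R : realType) (k : scalar_kind).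
Local Notation F := (scalar R k).

Record extended_norm (V : lmodType F) := ExtendedNorm {
  enorm :> V -> \bar R;
  enorm_ge0 : forall x, (0 <= enorm x)%E;
  enormD : forall x y, (enorm (x + y) <= enorm x + enorm y)%E;
  enormZ : forall a x, enorm (a *: x) = ((modulus a)%:E * enorm x)%E;
  enorm_eq0 : forall x, enorm x = 0%E -> x = 0
}.

Variables (V : lmodType F) (N : extended_norm V).

Definition enorm_finite : {pred V} := [pred x | (N x < +oo)%E].

Lemma enorm_finite_closed : submod_closed enorm_finite.
Proof.
split=> [|a x y].
  by rewrite inE -(scale0r (0 : V)) enormZ modulus0 mul0e.
rewrite !inE => xoo yoo; apply: le_lt_trans (enormD _ _ _) _.
apply: lte_add_pinfty => //; rewrite enormZ.
by apply: lte_mul_pinfty => //; rewrite lee_fin modulus_ge0.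
Qed.

HB.instance Definition _ :=
  GRing.isSubmodClosed.Build F V enorm_finite enorm_finite_closed.

(* {x in V | N x < +oo}, normed by N *)
Record finite_norm_space :=
  FiniteNorm { fns_val :> V; fns_valP : fns_val \in enorm_finite }.

HB.instance Definition _ := [isSub for fns_val].
HB.instance Definition _ := [Choice of finite_norm_space by <:].
HB.instance Definition _ :=
  [SubChoice_isSubLmodule of finite_norm_space by <:].

Definition fns_norm (x : finite_norm_space) : F := real_scalar k (fine (N x)).

Lemma fns_fin_num (x : finite_norm_space) : N x \is a fin_num.
Proof. by rewrite ge0_fin_numE ?enorm_ge0//; exact: fns_valP. Qed.

Lemma fns_normD (x y : finite_norm_space) :
  fns_norm (x + y) <= fns_norm x + fns_norm y.
Proof.
rewrite /fns_norm -real_scalarD ler_real_scalar -lee_fin EFinD.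
by rewrite !fineK ?fns_fin_num//; exact: enormD.
Qed.

Lemma fns_normZ (a : F) (x : finite_norm_space) :
  fns_norm (a *: x) = `|a| * fns_norm x.
Proof.
rewrite /fns_norm -real_scalar_modulus -real_scalarM; congr real_scalar.
by apply: EFin_inj; rewrite EFinM !fineK ?fns_fin_num//; exact: enormZ.
Qed.

Lemma fns_norm_eq0 (x : finite_norm_space) : fns_norm x = 0 -> x = 0.
Proof.
rewrite /fns_norm -(real_scalar0 R k) => /real_scalar_inj x0.
by apply: val_inj => /=; apply: (@enorm_eq0 _ N); rewrite -[N _]fineK ?fns_fin_num// x0.
Qed.

HB.instance Definition _ := @Lmodule_isNormed.Build F finite_norm_space
  fns_norm fns_normD fns_normZ fns_norm_eq0.

End FiniteNormSpace.

Section MeasurableFunctions.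
Context d (T : measurableType d) (R : realType) (k : scalar_kind).
Local Notation F := (scalar R k).

Lemma scalar_measurable0 : scalar_measurable (fun _ : T => 0 : F).
Proof.
by case: k => [|/=]; [exact: (measurable_cst (0 : R))|
                      split; exact: (measurable_cst (0 : R))].
Qed.

Lemma scalar_measurable_lin (a : F) (f g : T -> F) :
  scalar_measurable f -> scalar_measurable g ->
  scalar_measurable (fun w => a * f w + g w).
Proof.
case: k a f g => /= a f g.
  by move=> mf mg; apply: measurable_funD => //; exact: measurable_funM.
move=> [mf mf'] [mg mg']; split.
- rewrite [X in measurable_fun _ X](_ : _ = (fun w =>
    (complex.Re a * complex.Re (f w) - complex.Im a * complex.Im (f w))
    + complex.Re (g w))); last first.
    by apply/funext => w; case: (a) (f w) (g w) => [? ?] [? ?] [? ?].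
  apply: measurable_funD => //; apply: measurable_funB;
    by apply: measurable_funM.
- rewrite [X in measurable_fun _ X](_ : _ = (fun w =>
    (complex.Re a * complex.Im (f w) + complex.Im a * complex.Re (f w))
    + complex.Im (g w))); last first.
    by apply/funext => w; case: (a) (f w) (g w) => [? ?] [? ?] [? ?].
  apply: measurable_funD => //; apply: measurable_funD;
    by apply: measurable_funM.
Qed.

Definition scalar_mfun_pred : {pred T -> F^o} :=
  [pred f | `[< scalar_measurable (f : T -> F) >]].

Lemma scalar_mfun_closed : submod_closed scalar_mfun_pred.
Proof.
split=> [|a f g]; rewrite !inE; first exact: scalar_measurable0.
by move=> mf mg; exact: scalar_measurable_lin.
Qed.

HB.instance Definition _ :=
  GRing.isSubmodClosed.Build F (T -> F^o) scalar_mfun_pred scalar_mfun_closed.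

Record scalar_mfun :=
  ScalarMfun { smf_fun :> T -> F^o; smf_funP : smf_fun \in scalar_mfun_pred }.

HB.instance Definition _ := [isSub for smf_fun].
HB.instance Definition _ := [Choice of scalar_mfun by <:].
HB.instance Definition _ := [SubChoice_isSubLmodule of scalar_mfun by <:].

Lemma smf_measurable (f : scalar_mfun) : scalar_measurable f.
Proof. by apply/asboolP; exact: smf_funP. Qed.

Lemma measurable_modulus (f : T -> F) :
  scalar_measurable f -> measurable_fun [set: T] (fun w => modulus (f w)).
Proof.
case: k f => /= [f mf|f [mf mf']]; first exact: measurableT_comp.
rewrite [X in measurable_fun _ X](_ : _ = (fun w =>
  Num.sqrt (complex.Re (f w) ^+ 2 + complex.Im (f w) ^+ 2))); last first.
  by apply/funext => w; case: (f w).
apply: measurableT_comp.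
  by apply: continuous_measurable_fun; exact: sqrt_continuous.
by apply: measurable_funD; apply: measurable_funX.
Qed.

End MeasurableFunctions.

Section L0.
Context d (T : measurableType d) (R : realType).
Variables (k : scalar_kind) (mu : {measure set T -> \bar R}).
Local Notation F := (scalar R k).
Local Notation M := (scalar_mfun T R k).

Definition null_mfun : {pred M} := [pred f : M | `[< {ae mu, forall w, f w = 0} >]].

Lemma null_mfun_closed : submod_closed null_mfun.
Proof.
split=> [|a f g]; rewrite !inE; first exact/aeW.
move=> f0 g0; apply: filterS2 f0 g0 => w fw gw.
by rewrite [LHS](_ : _ = a * f w + g w)// fw gw mulr0 addr0.
Qed.

HB.instance Definition _ :=
  GRing.isSubmodClosed.Build F M null_mfun null_mfun_closed.

(* measurable functions modulo equality a.e. *)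
Definition L0 := Quotient.quot null_mfun.
HB.instance Definition _ := GRing.Zmodule.on L0.
HB.instance Definition _ := EqQuotient.on L0.

Local Open Scope quotient_scope.

Definition L0_class (f : M) : L0 := \pi_L0 f.

Definition L0_mfun (f : L0) : M := repr f.

Definition L0_fun (f : L0) : T -> F := L0_mfun f.

Lemma L0_mfunK : cancel L0_mfun L0_class.
Proof. exact: reprK. Qed.

Lemma L0_classP (f g : M) :
  (L0_class f = L0_class g) <-> {ae mu, forall w, f w = g w}.
Proof.
have E : (L0_class f == L0_class g) = (f - g \in null_mfun).
  by rewrite (@Quotient.idealrBE M null_mfun).
rewrite (rwP eqP) E inE; split; apply: filterS => w.
  by rewrite [X in X = 0 -> _](_ : _ = f w - g w)// => /eqP; rewrite subr_eq0 => /eqP.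
by move=> fgw; rewrite [LHS](_ : _ = f w - g w)// fgw subrr.
Qed.

Lemma L0_mfun_class (f : M) : {ae mu, forall w, L0_mfun (L0_class f) w = f w}.
Proof. by apply/L0_classP; rewrite L0_mfunK. Qed.

Lemma L0_classD (f g : M) : L0_class (f + g) = L0_class f + L0_class g.
Proof. exact: pi_addr. Qed.

Definition L0_scale (a : F) (f : L0) : L0 := L0_class (a *: L0_mfun f).

Lemma L0_scale_class a f : L0_scale a (L0_class f) = L0_class (a *: f).
Proof.
apply/L0_classP; apply: filterS (L0_mfun_class f) => w fw.
by rewrite [LHS](_ : _ = a *: (L0_mfun (L0_class f) w)) // fw.
Qed.

Lemma L0_scaleA a b f : L0_scale a (L0_scale b f) = L0_scale (a * b) f.
Proof. by rewrite -[f]L0_mfunK !L0_scale_class scalerA. Qed.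

Lemma L0_scale1 : left_id 1 L0_scale.
Proof. by move=> f; rewrite -[f]L0_mfunK L0_scale_class scale1r. Qed.

Lemma L0_scaleDr : right_distributive L0_scale +%R.
Proof.
move=> a f g; rewrite -[f]L0_mfunK -[g]L0_mfunK -L0_classD !L0_scale_class.
by rewrite scalerDr L0_classD.
Qed.

Lemma L0_scaleDl f : {morph L0_scale^~ f : a b / a + b}.
Proof.
move=> a b; rewrite -[f]L0_mfunK !L0_scale_class.
by rewrite scalerDl L0_classD.
Qed.

HB.instance Definition _ := GRing.Zmodule_isLmodule.Build F L0
  L0_scaleA L0_scale1 L0_scaleDr L0_scaleDl.

Lemma L0_funD (f g : L0) :
  {ae mu, forall w, L0_fun (f + g) w = L0_fun f w + L0_fun g w}.
Proof.
apply: filterS (L0_mfun_class (L0_mfun f + L0_mfun g)) => w.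
by rewrite L0_classD !L0_mfunK.
Qed.

Lemma L0_funZ a (f : L0) :
  {ae mu, forall w, L0_fun (a *: f) w = a * L0_fun f w}.
Proof. exact: L0_mfun_class. Qed.

Lemma L0_fun_eq0 (f : L0) : {ae mu, forall w, L0_fun f w = 0} -> f = 0.
Proof.
move=> f0; rewrite -[f]L0_mfunK -[0]L0_mfunK; apply/L0_classP.
have z0 : {ae mu, forall w, L0_mfun 0 w = 0}.
  apply: filterS (L0_mfun_class 0) => w.
  by rewrite (_ : L0_class 0 = 0)//; exact: pi_zeror.
by apply: filterS2 f0 z0 => w fw ->; exact: fw.
Qed.

Definition L0_abs (f : L0) : T -> \bar R := fun w => (modulus (L0_fun f w))%:E.

Definition L0_supp (f : L0) : set T := [set w | L0_fun f w <> 0].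

Definition L2_norm (f : L0) : \bar R := 'N[mu]_2%:E[L0_abs f].

(* Since the patched value is +oo off supp f, this is the essential
   infimum of |f| over supp f. *)
Definition ess_inf_on_supp (f : L0) : \bar R :=
  ess_inf mu (patch (cst +oo%E) (L0_supp f) (L0_abs f)).

Definition simple_class (f : L0) : Prop :=
  exists2 s : M, finite_set (range s) & f = L0_class s.

Definition escapes_to_infinity (f : nat -> L0) : Prop :=
  (fun n => ess_inf_on_supp (f n)) @ \oo --> +oo%E.

Definition pairwise_disjointly_supported (f : nat -> L0) : Prop :=
  forall m n, m <> n -> mu.-negligible (L0_supp (f m) `&` L0_supp (f n)).

End L0.

Section FunctionNorm.
Context d (T : measurableType d) (R : realType).
Variable mu : {measure set T -> \bar R}.
Local Open Scope ereal_scope.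

Definition L0plus (f : T -> \bar R) : Prop :=
  measurable_fun [set: T] f /\ forall w, 0 <= f w.

(* Identification of functions equal a.e. need not be imposed separately: it
   follows from fn_le, applied in both directions. *)
Record function_norm := FunctionNorm {
  fn_rho :> (T -> \bar R) -> \bar R;
  fn_ge0 : forall f, L0plus f -> 0 <= fn_rho f;
  fn_eq0 : forall f, L0plus f ->
    fn_rho f = 0 <-> {ae mu, forall w, f w = 0};
  fn_add : forall f g, L0plus f -> L0plus g ->
    fn_rho (f \+ g) <= fn_rho f + fn_rho g;
  fn_scale : forall (t : R) f, (0 <= t)%R -> L0plus f ->
    fn_rho (fun w => t%:E * f w) = t%:E * fn_rho f;
  fn_le : forall f g, L0plus f -> L0plus g ->
    {ae mu, forall w, f w <= g w} -> fn_rho f <= fn_rho g;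
  fn_indic : forall E, measurable E -> mu E < +oo ->
    fn_rho (EFin \o \1_E) < +oo;
  fn_monotone : forall (f_ : nat -> T -> \bar R) f,
    (forall n, L0plus (f_ n)) -> L0plus f ->
    (forall n, {ae mu, forall w, f_ n w <= f_ n.+1 w}) ->
    {ae mu, forall w, f_ ^~ w @ \oo --> f w} ->
    (fun n => fn_rho (f_ n)) @ \oo --> fn_rho f;
  fn_integral : forall E, measurable E -> mu E < +oo ->
    exists C : R, forall f, L0plus f ->
      \int[mu]_(w in E) f w <= C%:E * fn_rho f
}.

Variables (k : scalar_kind) (rho : function_norm).
Local Notation F := (scalar R k).

Lemma L0_abs_plus (f : L0 k mu) : L0plus (L0_abs f).
Proof.
split=> [|w]; last by rewrite lee_fin modulus_ge0.
by apply/measurable_EFinP; apply: measurable_modulus; exact: smf_measurable.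
Qed.

Definition rho_norm (f : L0 k mu) : \bar R := rho (L0_abs f).

Lemma rho_norm_ge0 f : 0 <= rho_norm f.
Proof. exact: fn_ge0 (L0_abs_plus f). Qed.

Lemma rho_normD f g : rho_norm (f + g)%R <= rho_norm f + rho_norm g.
Proof.
have pD : L0plus (L0_abs f \+ L0_abs g).
  have [mf f0] := L0_abs_plus f; have [mg g0] := L0_abs_plus g.
  by split=> [|w]; [exact: emeasurable_funD|exact: adde_ge0].
apply: le_trans (fn_add rho (L0_abs_plus f) (L0_abs_plus g)).
apply: fn_le => //; first exact: L0_abs_plus.
apply: filterS (L0_funD f g) => w fgw.
by rewrite /L0_abs fgw /= -EFinD lee_fin modulusD.
Qed.

Lemma rho_normZ a f : rho_norm (a *: f)%R = (modulus a)%:E * rho_norm f.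
Proof.
have pZ : L0plus (fun w => (modulus a)%:E * L0_abs f w).
  have [mf f0] := L0_abs_plus f; split=> [|w]; last first.
    by rewrite mule_ge0 ?lee_fin ?modulus_ge0.
  by apply: emeasurable_funM => //; exact: measurable_cst.
rewrite -fn_scale ?modulus_ge0//; last exact: L0_abs_plus.
apply/eqP; rewrite eq_le; apply/andP; split; apply: fn_le => //;
  try exact: L0_abs_plus.
- by apply: filterS (L0_funZ a f) => w afw; rewrite /L0_abs afw modulusM EFinM.
- by apply: filterS (L0_funZ a f) => w afw; rewrite /L0_abs afw modulusM EFinM.
Qed.

Lemma rho_norm_eq0 f : rho_norm f = 0 -> f = 0%R.
Proof.
move=> /(fn_eq0 rho (L0_abs_plus f)) f0; apply: L0_fun_eq0.
apply: filterS f0 => w [/eqP]; rewrite modulus_eq0 => /eqP.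
exact.
Qed.

Definition rho_extended_norm : extended_norm (L0 k mu) :=
  ExtendedNorm rho_norm_ge0 rho_normD rho_normZ rho_norm_eq0.

Definition Lrho : normedModType F := finite_norm_space rho_extended_norm.

Definition Lrho_val (f : Lrho) : L0 k mu := fns_val f.

Lemma Lrho_normE (f : Lrho) :
  `|f|%R = real_scalar k (fine (rho_norm (Lrho_val f))).
Proof. by []. Qed.

End FunctionNorm.
Arguments Lrho {d T R mu} k rho.

Section ell2.
Variables (R : realType) (k : scalar_kind).
Local Notation F := (scalar R k).
Local Open Scope ereal_scope.

Definition ell2_norm (a : nat -> F^o) : \bar R :=
  (\sum_(0 <= n <oo) (modulus (a n : F) ^+ 2)%:E) `^ 2^-1.

Lemma ell2_normE a :
  ell2_norm a = 'N[counting]_2%:E[EFin \o (fun n => modulus (a n : F))].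
Proof.
rewrite Lnorm_counting//; congr (_ `^ _); apply: eq_eseriesr => n _.
by rewrite /= ger0_norm ?modulus_ge0// powR_mulrn ?modulus_ge0.
Qed.

Lemma ell2_norm_ge0 a : 0 <= ell2_norm a.
Proof. exact: poweR_ge0. Qed.

Lemma ell2_normD a b : ell2_norm (a + b)%R <= ell2_norm a + ell2_norm b.
Proof.
rewrite [X in _ <= X + _]ell2_normE [X in _ <= _ + X]ell2_normE.
apply: le_trans; last by apply: minkowski_EFin => //; rewrite ler1n.
rewrite Lnorm_counting//; apply: gt0_ler_poweR; rewrite ?invr_ge0//.
- rewrite in_itv/= leey andbT; apply: nneseries_ge0 => n _ _.
  by rewrite lee_fin sqr_ge0.
- rewrite in_itv/= leey andbT; apply: nneseries_ge0 => n _ _.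
  by rewrite lee_fin powR_ge0.
- apply: lee_nneseries => n _; first by rewrite lee_fin sqr_ge0.
  have mab_ge0 : (0 <= modulus (a n : F) + modulus (b n : F))%R.
    by rewrite addr_ge0 ?modulus_ge0.
  rewrite /= ger0_norm// lee_fin powR_mulrn//.
  by rewrite ler_pXn2r ?nnegrE ?modulus_ge0//; exact: modulusD.
Qed.

Lemma ell2_normZ c a : ell2_norm (c *: a)%R = (modulus c)%:E * ell2_norm a.
Proof.
have sum_ge0 : 0 <= \sum_(0 <= n <oo) (modulus (a n : F) ^+ 2)%:E.
  by apply: nneseries_ge0 => n _ _; rewrite lee_fin sqr_ge0.
rewrite /ell2_norm (eq_eseriesr (g := fun n =>
    (modulus c ^+ 2)%:E * (modulus (a n : F) ^+ 2)%:E)); last first.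
  by move=> n _; rewrite -EFinM -exprMn -modulusM.
rewrite nneseriesZl; last by move=> n _; rewrite lee_fin sqr_ge0.
rewrite poweRM ?lee_fin ?sqr_ge0//; congr (_ * _).
rewrite poweR_EFin -powR_mulrn ?modulus_ge0// -powRrM mulfV ?pnatr_eq0//.
by rewrite powRr1 ?modulus_ge0.
Qed.

Lemma ell2_norm_eq0 a : ell2_norm a = 0 -> a = 0%R.
Proof.
have sq_ge0 n : 0 <= (modulus (a n : F) ^+ 2)%:E by rewrite lee_fin sqr_ge0.
move=> /poweR_eq0_eq0 => /(_ (nneseries_ge0 (fun n _ _ => sq_ge0 n))) a0.
apply/funext => n; apply/eqP; rewrite -modulus_eq0 -sqrf_eq0 eq_le sqr_ge0 andbT.
have : (modulus (a n : F) ^+ 2)%:E <= 0.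
  rewrite -[leRHS]a0 (nneseriesD1 (n := n))//.
  by rewrite leeDl//; apply: nneseries_ge0.
by rewrite lee_fin.
Qed.

Definition ell2_extended_norm : extended_norm (nat -> F^o) :=
  ExtendedNorm ell2_norm_ge0 ell2_normD ell2_normZ ell2_norm_eq0.

Definition ell2 : normedModType F := finite_norm_space ell2_extended_norm.

Lemma ell2_unit_finite (n : nat) :
  (fun m => (m == n)%:R : F^o) \in enorm_finite ell2_extended_norm.
Proof.
rewrite inE/= poweR_lty// (nneseriesD1 (n := n))//; last first.
  by move=> m _; rewrite lee_fin sqr_ge0.
rewrite eseries0 ?adde0 ?ltry// => m _ /= /negPf ->.
by rewrite modulus0 expr0n.
Qed.

Definition ell2_unit (n : nat) : ell2 := FiniteNorm (ell2_unit_finite n).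

End ell2.

Section BanachSequences.
Variable K : numFieldType.

Definition closed_span (V : normedModType K) (x : nat -> V) : set V :=
  closure [set v | exists n (a : nat -> K), v = \sum_(0 <= i < n) a i *: x i].

Definition basic_sequence (V : normedModType K) (x : nat -> V) : Prop :=
  forall v, closed_span x v ->
    exists! a : nat -> K, series (fun i => a i *: x i) @ \oo --> v.

Definition unconditional_basic_sequence (V : normedModType K)
    (x : nat -> V) : Prop :=
  forall p : nat -> nat, bijective p -> basic_sequence (x \o p).

Definition semi_normalized (V : normedModType K) (x : nat -> V) : Prop :=
  exists c C : K, 0 < c /\ forall n, c <= `|x n| <= C.

(* S is a total function, but only its restriction to closed_span x matters:
   that restriction is a linear homeomorphism onto closed_span y. *)
Definition equivalent_sequences (V W : normedModType K)
    (x : nat -> V) (y : nat -> W) : Prop :=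
  exists S : V -> W,
    [/\ forall (a : K) u v, closed_span x u -> closed_span x v ->
          S (a *: u + v) = a *: S u + S v,
        set_bij (closed_span x) (closed_span y) S,
        exists c C : K, 0 < c /\
          forall u, closed_span x u -> c * `|u| <= `|S u| <= C * `|u|
      & forall n, S (x n) = y n].

Definition congruent_sequences (V : normedModType K) (x y : nat -> V) : Prop :=
  exists S S' : {linear V -> V},
    [/\ cancel S S', cancel S' S, continuous S, continuous S'
      & forall n, S (x n) = y n].

(* E |sum_i eps_i x_i|^2 <= C^2 sum_i |x_i|^2, the expectation being over all
   2^n choices of signs eps_i = (-1)^(e i) *)
Definition rademacher_type2 (V : normedModType K) : Prop :=
  exists2 C : K, 0 <= C & forall n (x : 'I_n -> V),
    (2 ^+ n)^-1 * (\sum_(e : {ffun 'I_n -> bool})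
      `|\sum_(i < n) (-1) ^+ e i *: x i| ^+ 2)
    <= C ^+ 2 * \sum_(i < n) `|x i| ^+ 2.

End BanachSequences.

(* Main.v *)
Require Import Defs.
From HB Require Import structures.
From mathcomp Require Import all_boot all_order all_algebra.
From mathcomp Require Import complex.
From mathcomp Require Import all_classical all_reals all_analysis.
From mathcomp Require Import measurable_realfun ess_sup_inf.
From mathcomp Require Import zify ring lra.

Set Implicit Arguments.
Unset Strict Implicit.
Unset Printing Implicit Defensive.

Import Order.TTheory GRing.Theory Num.Theory.
Import numFieldNormedType.Exports.

Local Open Scope classical_set_scope.
Local Open Scope ring_scope.

(** Part (i). L_rho is complete ([Lrho_complete]), so an unconditional basic
    sequence tolerates arbitrary sign changes of its coefficients up to a
    constant K ([unconditional_sign_constant]). The embedding of L_rho in L_2 is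
    automatically continuous ([sqint_bounded]). By type 2 some signs make the
    norm of the sum of a_i psi_i at most a constant times the l_2 norm of (a_i);
    by the parallelogram identity some signs make its L_2 norm, hence its norm in
    L_rho, at least a constant times the l_2 norm of (a_i) ([sqnorm_signs]).
    Removing the signs costs a factor K, and the resulting two-sided estimate
    extends from finite sums to the closed span ([equivalent_ell2_unit]).

    The constant K rests on the continuity of the coefficients of a basic
    sequence ([basis_constant]), obtained from Zabreiko's lemma
    ([countably_subadditive_bounded]), and on a gliding hump: if projections on
    subsets of the basis were unbounded, a rearrangement would turn them into
    unbounded partial sum projections ([subset_projection_constant]).

    Part (ii) is the method of Kadec and Pelczynski. Type 2 excludes large
    disjoint pieces of one function, since 2^N of them carry N Rademacher-like
    functions ([no_large_disjoint_pieces]); so the norm is absolutely continuous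
    ([absolutely_continuous_nrm]). Hence a function with small L_2 norm is close
    in L_rho to its restriction to the small set where it exceeds a prescribed
    height ([peak_decomposition]). A subsequence chosen inductively is close to
    disjointly supported simple functions of growing height
    ([almost_disjoint_subsequence], [simple_approximation]). Norming functionals
    ([norming_functional]) restricted to the disjoint supports are biorthogonal
    to these simple functions and uniformly bounded, and the principle of small
    perturbations ([congruent_perturbation]) provides the automorphism. *)

(** * Real-valued norms over real or complex scalars *)

Section RealNorm.
Variables (R : realType) (k : scalar_kind).
Local Notation F := (Defs.scalar R k).

(** Over R[i] the norm of a normed module takes values in R[i]; all estimates
    are made with its real value. *)
Definition nrm (V : normedModType F) (x : V) : R := modulus (`|x| : F).

Section Basic.
Variable V : normedModType F.
Implicit Types x y : V.

Lemma nrmE x : real_scalar k (nrm x) = `|x|.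
Proof. by rewrite real_scalar_modulus normr_id. Qed.

Lemma nrm_ge0 x : 0 <= nrm x.
Proof. exact: modulus_ge0. Qed.

Lemma nrmD x y : nrm (x + y) <= nrm x + nrm y.
Proof. by rewrite -(ler_real_scalar k) real_scalarD !nrmE ler_normD. Qed.

Lemma nrmZ (a : F) x : nrm (a *: x) = modulus a * nrm x.
Proof.
by apply: (@real_scalar_inj R k); rewrite real_scalarM !nrmE real_scalar_modulus normrZ.
Qed.

Lemma nrmN x : nrm (- x) = nrm x.
Proof. by apply: (@real_scalar_inj R k); rewrite !nrmE normrN. Qed.

Lemma nrm_distC x y : nrm (x - y) = nrm (y - x).
Proof. by rewrite -nrmN opprB. Qed.

Lemma nrm0 : nrm (0 : V) = 0.
Proof. by rewrite /nrm normr0 modulus0. Qed.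

Lemma nrm_eq0 x : (nrm x == 0) = (x == 0).
Proof. by rewrite /nrm modulus_eq0 normr_eq0. Qed.

Lemma nrmB x y : nrm (x - y) <= nrm x + nrm y.
Proof. by rewrite -(nrmN y) nrmD. Qed.

Lemma nrm_triangle z x y : nrm (x - y) <= nrm (x - z) + nrm (z - y).
Proof. by have := nrmD (x - z) (z - y); rewrite subrKA. Qed.

Lemma nrm_le_dist x y : nrm x <= nrm y + nrm (x - y).
Proof. by have := nrmD y (x - y); rewrite addrC subrK. Qed.

Lemma nrm_sum (I : Type) (r : seq I) (P : pred I) (f : I -> V) :
  nrm (\sum_(i <- r | P i) f i) <= \sum_(i <- r | P i) nrm (f i).
Proof.
elim/big_ind2 : _ => [|x a y b xa yb|//]; first by rewrite nrm0.
exact: le_trans (nrmD _ _) (lerD xa yb).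
Qed.

End Basic.

Lemma lt0_real_scalar (e : F) : 0 < e -> exists2 r : R, 0 < r & e = real_scalar k r.
Proof.
move=> e0; exists (modulus e); last by rewrite real_scalar_modulus gtr0_norm.
by rewrite lt_neqAle modulus_ge0 andbT eq_sym modulus_eq0 gt_eqF.
Qed.

Lemma ltr_real_scalar (x y : R) : (real_scalar k x < real_scalar k y) = (x < y).
Proof. by rewrite !lt_neqAle ler_real_scalar (inj_eq (@real_scalar_inj R k)). Qed.

Lemma modulus_real_scalar (t : R) : 0 <= t -> modulus (real_scalar k t : F) = t.
Proof.
move=> t0; apply: (@real_scalar_inj R k); rewrite real_scalar_modulus ger0_norm//.
by rewrite -(real_scalar0 R k) ler_real_scalar.
Qed.

Lemma real_scalar1 : real_scalar k 1 = 1 :> F.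
Proof. by rewrite /real_scalar; case: (k). Qed.

Lemma real_scalarVK (t : R) : t != 0 -> real_scalar k t^-1 * real_scalar k t = 1 :> F.
Proof. by move=> t0; rewrite -real_scalarM mulVf// real_scalar1. Qed.

Lemma cvg_nrmP (V : normedModType F) (u : nat -> V) (l : V) :
  (u @ \oo --> l) <->
  (forall e : R, 0 < e -> exists N, forall n, (N <= n)%N -> nrm (u n - l) < e).
Proof.
split=> [/cvgrPdist_lt ul e e0|ul].
  have /ul[N _ uN] : (0 : F) < real_scalar k e.
    by rewrite -(real_scalar0 R k) ltr_real_scalar.
  by exists N => n /uN; rewrite /= nrm_distC -nrmE ltr_real_scalar.
apply/cvgrPdist_lt => _ /lt0_real_scalar[e e0 ->].
have [N uN] := ul _ e0; exists N => // n /uN.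
by rewrite /= nrm_distC -nrmE ltr_real_scalar.
Qed.

Lemma nrm_cvg_unique (V : normedModType F) (u : nat -> V) (l l' : V) :
  u @ \oo --> l -> u @ \oo --> l' -> l = l'.
Proof.
move=> /cvg_nrmP ul /cvg_nrmP ul'; apply/eqP; rewrite -subr_eq0 -nrm_eq0.
apply: contraT => ne0.
have e0 : 0 < nrm (l - l') / 2 by rewrite divr_gt0// lt_neqAle nrm_ge0 eq_sym ne0.
have [N /(_ (maxn N _)) uN] := ul _ e0; have [N' /(_ (maxn _ N')) uN'] := ul' _ e0.
have := nrm_triangle (u (maxn N N')) l l'.
rewrite (nrm_distC l (u _)) => H.
have := uN N' (leq_maxl _ _); have := uN' N (leq_maxr _ _); lra.
Qed.

Lemma closed_spanP (V : normedModType F) (x : nat -> V) (v : V) :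
  closed_span x v <->
  (forall e : R, 0 < e -> exists n (a : nat -> F),
      nrm (v - \sum_(0 <= i < n) a i *: x i) < e).
Proof.
split=> [xv e e0|xv].
  have e0' : (0 : F) < real_scalar k e.
    by rewrite -(real_scalar0 R k) ltr_real_scalar.
  have /xv[_ [[n [a ->]]]] := nbhsx_ballx v _ e0'.
  rewrite -ball_normE /= => H; exists n, a.
  by rewrite -ltr_real_scalar nrmE.
move=> B /nbhs_ballP[_ /= /lt0_real_scalar[e e0 ->]] vB.
have [n [a H]] := xv _ e0; exists (\sum_(0 <= i < n) a i *: x i); split.
  by exists n, a.
by apply: vB; rewrite -ball_normE /= -nrmE ltr_real_scalar.
Qed.

Lemma linear_bounded_continuous_nrm (V W : normedModType F) (S : {linear V -> W}) (C : R) :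
  (forall x, nrm (S x) <= C * nrm x) -> continuous S.
Proof.
move=> SC x; apply/cvgrPdist_lt => _ /lt0_real_scalar[e e0 ->].
have C1 : 0 < `|C| + 1 by rewrite ltr_pwDr.
have e1 : (0 : F) < real_scalar k (e / (`|C| + 1)).
  by rewrite -(real_scalar0 R k) ltr_real_scalar divr_gt0.
apply: filterS (nbhsx_ballx x _ e1) => y; rewrite -ball_normE /= => H.
rewrite -linearB -nrmE ltr_real_scalar.
apply: le_lt_trans (SC _) _.
move: H; rewrite -nrmE ltr_real_scalar ltr_pdivlMr// => H; apply: le_lt_trans H.
rewrite mulrC ler_wpM2l ?nrm_ge0//.
by apply: le_trans (ler_norm _) _; rewrite lerDl.
Qed.

End RealNorm.

(** * Geometric convergence and completeness *)

Section Complete.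
Variables (R : realType) (k : scalar_kind).
Local Notation F := (Defs.scalar R k).

(** Completeness for geometrically fast sequences is what the Riesz--Fischer
    argument delivers, and it comes with an explicit rate. *)
Definition complete_nrm (V : normedModType F) : Prop :=
  forall (c : R) (u : nat -> V),
    (forall n, nrm (u n.+1 - u n) <= c * (1/2) ^+ n) ->
    exists l, forall n, nrm (u n - l) <= 2 * c * (1/2) ^+ n.

End Complete.

Section Geometric.
Variable R : realType.

Lemma geometric_small (C e : R) : 0 < e ->
  exists N, forall n, (N <= n)%N -> C * (1/2) ^+ n < e.
Proof.
move=> e0; have h : `|1/2 : R| < 1 by rewrite ger0_norm; lra.
have /cvgrPdist_lt /(_ (e / (`|C| + 1))) := @cvg_expr R _ h.
have C1 : 0 < `|C| + 1 by rewrite ltr_pwDr.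
rewrite divr_gt0// => /(_ isT)[N _ H]; exists N => n /H /=.
rewrite sub0r normrN ltr_pdivlMr// => /(le_lt_trans _); apply.
have p0 : 0 <= (1/2 : R) ^+ n by apply: exprn_ge0; lra.
rewrite ger0_norm// mulrC ler_wpM2l//.
by apply: le_trans (ler_norm _) _; rewrite lerDl.
Qed.

(** The limit is squeezed between the increasing sequence z n - 2 c / 2^n and
    the decreasing sequence z n + 2 c / 2^n. *)
Lemma real_geometric_complete (c : R) (z : nat -> R) :
  (forall n, `|z n.+1 - z n| <= c * (1/2) ^+ n) ->
  exists l, forall n, `|z n - l| <= 2 * c * (1/2) ^+ n.
Proof.
move=> zc.
have c0 : 0 <= c by have := zc 0; rewrite expr0 mulr1; exact: le_trans.
have step n j : `|z (n + j)%N - z n| <= 2 * c * (1/2) ^+ n.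
  suff : `|z (n + j)%N - z n| <= 2 * c * (1/2) ^+ n * (1 - (1/2) ^+ j).
    have pn : 0 <= 2 * c * (1/2 : R) ^+ n by rewrite mulr_ge0 ?exprn_ge0//; lra.
    have pj : 0 <= (1/2 : R) ^+ j by apply: exprn_ge0; lra.
    by move=> /le_trans; apply; rewrite -[leRHS]mulr1 ler_wpM2l//; lra.
  elim: j => [|j IH]; first by rewrite addn0 subrr normr0 expr0 subrr mulr0.
  rewrite addnS -(subrKA (z (n + j)%N)).
  apply: le_trans (ler_normD _ _) _.
  apply: le_trans (lerD (zc _) IH) _.
  rewrite exprD exprS; lra.
have h0 n : 0 <= (1/2 : R) ^+ n by apply: exprn_ge0; lra.
have ab m n : z m - 2 * c * (1/2) ^+ m <= z n + 2 * c * (1/2) ^+ n.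
  have pm : 0 <= 2 * c * (1/2 : R) ^+ m by rewrite mulr_ge0 ?mulr_ge0.
  have pn : 0 <= 2 * c * (1/2 : R) ^+ n by rewrite mulr_ge0 ?mulr_ge0.
  case: (leqP n m) => [nm|/ltnW mn].
    have := step n (m - n)%N; rewrite subnKC// ler_norml => /andP[]; lra.
  have := step m (n - m)%N; rewrite subnKC// ler_norml => /andP[]; lra.
pose A := [set z m - 2 * c * (1/2) ^+ m | m in [set: nat]].
exists (sup A) => n; rewrite ler_distlC; apply/andP; split.
  apply: ub_le_sup; last by exists n.
  by exists (z n + 2 * c * (1/2) ^+ n) => _ [m _ <-]; exact: ab.
by apply: ge_sup => [|_ [m _ <-]]; [exists (z n - 2 * c * (1/2) ^+ n), n|exact: ab].
Qed.

End Geometric.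

Section GeometricNrm.
Variables (R : realType) (k : scalar_kind).
Local Notation F := (Defs.scalar R k).

Lemma geometric_tail (V : normedModType F) (c : R) (u : nat -> V) :
  (forall n, nrm (u n.+1 - u n) <= c * (1/2) ^+ n) ->
  forall n j, nrm (u (n + j)%N - u n) <= 2 * c * (1/2) ^+ n.
Proof.
move=> uc n j.
have c0 : 0 <= c by have := uc 0; rewrite expr0 mulr1; exact: le_trans (nrm_ge0 _).
suff : nrm (u (n + j)%N - u n) <= 2 * c * (1/2) ^+ n * (1 - (1/2) ^+ j).
  have pn : 0 <= 2 * c * (1/2 : R) ^+ n by rewrite mulr_ge0 ?exprn_ge0//; lra.
  have pj : 0 <= (1/2 : R) ^+ j by apply: exprn_ge0; lra.
  by move=> /le_trans; apply; rewrite -[leRHS]mulr1 ler_wpM2l//; lra.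
elim: j => [|j IH]; first by rewrite addn0 subrr nrm0 expr0 subrr mulr0.
rewrite addnS; apply: le_trans (nrm_triangle (u (n + j)%N) _ _) _.
apply: le_trans (lerD (uc _) IH) _.
rewrite exprD exprS; lra.
Qed.

Lemma nrm_cvg_le (V : normedModType F) (u : nat -> V) (l x : V) (e : R) N :
  u @ \oo --> l -> (forall n, (N <= n)%N -> nrm (u n - x) <= e) -> nrm (l - x) <= e.
Proof.
move=> /cvg_nrmP ul ue; apply/ler_addgt0Pr => d d0.
have [M /(_ (maxn N M))] := ul _ d0; rewrite leq_maxr => /(_ isT) H.
have := ue (maxn N M) (leq_maxl _ _).
have := nrm_triangle (u (maxn N M)) l x; rewrite (nrm_distC l (u _)); lra.
Qed.

Lemma geometric_limit (V : normedModType F) (c : R) (u : nat -> V) (l : V) :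
  (forall n, nrm (u n.+1 - u n) <= c * (1/2) ^+ n) -> u @ \oo --> l ->
  forall n, nrm (u n - l) <= 2 * c * (1/2) ^+ n.
Proof.
move=> uc ul n; rewrite nrm_distC; apply: (nrm_cvg_le (N := n) ul) => m nm.
by have := geometric_tail uc n (m - n)%N; rewrite subnKC.
Qed.

Lemma geometric_cvg (V : normedModType F) (c : R) (u : nat -> V) (l : V) :
  (forall n, nrm (u n - l) <= c * (1/2) ^+ n) -> u @ \oo --> l.
Proof.
move=> ul; apply/cvg_nrmP => e e0; have [N HN] := geometric_small c e0.
by exists N => n /HN; apply: le_lt_trans.
Qed.

(** Real and imaginary parts converge separately, which doubles the constant. *)
Lemma scalar_geometric_complete (c : R) (z : nat -> F) :
  (forall n, modulus (z n.+1 - z n) <= c * (1/2) ^+ n) ->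
  exists l, forall n, modulus (z n - l) <= 4 * c * (1/2) ^+ n.
Proof.
case: k z => z zc.
  have [l Hl] := real_geometric_complete zc; exists l => n; apply: le_trans (Hl n) _.
  have c0 : 0 <= c by have := zc 0; rewrite expr0 mulr1; exact: le_trans (modulus_ge0 _).
  by rewrite ler_wpM2r ?exprn_ge0//; lra.
have ReIm (w : R[i]) : `|complex.Re w| <= Normc.normc w /\ `|complex.Im w| <= Normc.normc w
    /\ Normc.normc w <= `|complex.Re w| + `|complex.Im w|.
  case: w => a b /=; rewrite -!sqrtr_sqr; split; [|split].
  - by rewrite ler_wsqrtr// lerDl sqr_ge0.
  - by rewrite ler_wsqrtr// lerDr sqr_ge0.
  - rewrite -[leRHS]ger0_norm ?addr_ge0 ?sqrtr_ge0// -[leRHS]sqrtr_sqr ler_wsqrtr//.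
    rewrite sqrrD !sqr_sqrtr ?sqr_ge0// lerD2r lerDl mulrn_wge0// mulr_ge0 ?sqrtr_ge0//.
have [n|a Ha] := @real_geometric_complete R c (fun n => complex.Re (z n)).
  apply: le_trans (zc n); have [+ _] := ReIm (z n.+1 - z n).
  by case: (z n.+1) (z n) => [? ?] [? ?].
have [n|b Hb] := @real_geometric_complete R c (fun n => complex.Im (z n)).
  apply: le_trans (zc n); have [_ [+ _]] := ReIm (z n.+1 - z n).
  by case: (z n.+1) (z n) => [? ?] [? ?].
exists (Complex a b) => n; have [_ [_ /le_trans]] := ReIm (z n - Complex a b); apply.
have := Ha n; have := Hb n; case: (z n) => x y /=; lra.
Qed.

(** A Cauchy sequence has a geometrically fast subsequence, indexed by L. *)
Lemma complete_nrm_cauchy (V : normedModType F) (u : nat -> V) :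
  complete_nrm V ->
  (forall e : R, 0 < e -> exists N, forall m n, (N <= m)%N -> (N <= n)%N ->
     nrm (u m - u n) < e) ->
  exists l : V, u @ \oo --> l.
Proof.
move=> Vc uC.
have /choice[M HM] n : exists N, forall p q, (N <= p)%N -> (N <= q)%N ->
    nrm (u p - u q) < (1/2) ^+ n.
  by apply: uC; rewrite exprn_gt0//; lra.
pose L n := (\sum_(i < n.+1) M i)%N.
have LM n : (M n <= L n)%N by rewrite /L big_ord_recr leq_addl.
have LS n : (M n <= L n.+1)%N.
  by apply: leq_trans (LM n) _; rewrite /L [leqRHS]big_ord_recr leq_addr.
have [n|l Hl] := Vc 1 (fun n => u (L n)).
  by rewrite mul1r; apply/ltW/HM; [exact: LS|exact: LM].
exists l; apply/cvg_nrmP => e e0.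
have [N HN] := geometric_small 3 e0.
exists (L N) => n Nn; apply: le_lt_trans (HN N (leqnn _)).
apply: le_trans (nrm_triangle (u (L N)) _ _) _.
have := ltW (HM N n (L N) (leq_trans (LM N) Nn) (LM N)); have := Hl N; lra.
Qed.

End GeometricNrm.

(** * Zabreiko's lemma *)

Section Zabreiko.
Variables (R : realType) (k : scalar_kind).
Local Notation F := (Defs.scalar R k).
Variables (V : normedModType F) (X : set V) (q : V -> R).
Hypothesis Vcomplete : complete_nrm V.
Hypothesis X0 : X 0.
Hypothesis XB : forall x y, X x -> X y -> X (x - y).
Hypothesis XZ : forall a x, X x -> X (a *: x).
Hypothesis Xcl : forall (u : nat -> V) l, (forall n, X (u n)) -> u @ \oo --> l -> X l.
Hypothesis qB : forall x y, X x -> X y -> q (x - y) <= q x + q y.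
Hypothesis qZ : forall a x, X x -> q (a *: x) <= modulus a * q x.
Hypothesis q_csub : forall c (u : nat -> V) v, (forall j, X (u j)) ->
  (forall j, q (u j) <= c * (1/2) ^+ j) -> series u @ \oo --> v -> q v <= 2 * c.

Let h1 n : 0 < (1/2 : R) ^+ n. Proof. by apply: exprn_gt0; lra. Qed.

(** Baire's argument. If every sublevel set {q <= m} were nowhere dense in X,
    nested balls could be chosen, the m-th avoiding {q <= m}, and q would exceed
    every integer at their common point. *)
Lemma sublevel_somewhere_dense : exists (m : nat) v r, [/\ X v, 0 < r &
  forall w, X w -> nrm (w - v) < r -> forall e, 0 < e ->
  exists u, [/\ X u, q u <= m%:R & nrm (u - w) < e]].
Proof.
apply: contrapT => H.
have {}H (s : nat * V * R) : exists t : V * R, X s.1.2 -> 0 < s.2 ->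
    [/\ X t.1, nrm (t.1 - s.1.2) < s.2, 0 < t.2 &
        forall u, X u -> q u <= s.1.1%:R -> t.2 <= nrm (u - t.1)].
  case: s => [[m v] r] /=; case: (pselect (X v)) => [Xv|nXv]; last by exists (0, 0).
  case: (ltP 0 r) => [r0|_]; last by exists (0, 0).
  apply: contrapT => H'; apply: H; exists m, v, r; split => // w Xw wv e e0.
  apply: contrapT => H; apply: H'; exists (w, e) => _ _ /=; split => // u Xu qu.
  by rewrite leNgt; apply/negP => ue; apply: H; exists u.
have {H}[f Hf] := choice H.
pose step n (s : V * R) := ((f (n, s.1, s.2)).1, Num.min ((f (n, s.1, s.2)).2 / 4) (s.2 / 2)).
pose s := fix s n := if n is n'.+1 then step n' (s n') else (0, 1).
have s_inv n : X (s n).1 /\ 0 < (s n).2.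
  elim: n => [|n [Xn rn]] /=; first by rewrite ltr01.
  have [? _ t0 _] := Hf (n, (s n).1, (s n).2) Xn rn; split => //.
  by rewrite lt_min !divr_gt0.
have s_step n : nrm ((s n.+1).1 - (s n).1) < (s n).2.
  by have [Xn rn] := s_inv n; have [] := Hf (n, (s n).1, (s n).2) Xn rn.
have s_half n j : (s (n + j)%N).2 <= (s n).2 * (1/2) ^+ j.
  elim: j => [|j IH]; first by rewrite addn0 expr0 mulr1.
  rewrite addnS /= ge_min; apply/orP; right.
  by rewrite exprSr; move: IH; lra.
have s_geo m n : nrm ((s (m + n.+1)%N).1 - (s (m + n)%N).1) <= (s m).2 * (1/2) ^+ n.
  by rewrite addnS; apply: le_trans (ltW (s_step _)) _.
have [l Hl] := Vcomplete (s_geo 0).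
have sl : (fun n => (s n).1) @ \oo --> l by apply: geometric_cvg Hl.
have Xl : X l by apply: Xcl sl => n; have [] := s_inv n.
have far (m : nat) : m%:R < q l.
  rewrite ltNge; apply/negP => qm.
  have [Xm rm] := s_inv m; have [_ _ d0 /(_ l Xl qm)] := Hf (m, (s m).1, (s m).2) Xm rm.
  have slm : (fun n => (s (m.+1 + n)%N).1) @ \oo --> l.
    apply/cvg_nrmP => e e0; move/cvg_nrmP : sl => /(_ e e0)[N HN].
    by exists N => n Nn; apply: HN; rewrite (leq_trans Nn)// leq_addl.
  have := geometric_limit (s_geo m.+1) slm 0; rewrite expr0 addn0 mulr1 nrm_distC.
  have : (s m.+1).2 <= (f (m, (s m).1, (s m).2)).2 / 4 by rewrite /= ge_min lexx.
  rewrite /=; lra.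
have := far (Num.truncn (q l)).+1; apply/negP; rewrite -leNgt.
by apply/ltW/truncnS_gt.
Qed.

(** Zabreiko's lemma. Differences and scaling turn one sublevel set that is
    dense in some ball into approximations of every small w by vectors with
    controlled q; correcting the remainder again and again writes w as a series
    of vectors u n with q (u n) decreasing geometrically. *)
Lemma countably_subadditive_bounded :
  exists2 K, 0 <= K & forall x, X x -> q x <= K * nrm x.
Proof.
have [m [v [r [Xv r0 dense]]]] := sublevel_somewhere_dense.
have XN x : X x -> X (- x) by move=> Xx; rewrite -sub0r; exact: XB.
have dense0 w e : X w -> nrm w < r -> 0 < e ->
    exists u, [/\ X u, q u <= 2 * m%:R & nrm (u - w) < e].
  move=> Xw wr e0; have e20 : 0 < e / 2 by rewrite divr_gt0.
  have [||u1 [Xu1 qu1 u1w]] := dense (w + v) _ _ _ e20.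
  - by rewrite -(opprK v); apply: XB => //; exact: XN.
  - by rewrite addrK.
  have [||u2 [Xu2 qu2 u2v]] := dense v _ _ _ e20 => //; first by rewrite subrr nrm0.
  exists (u1 - u2); split; first exact: XB.
    by apply: le_trans (qB _ _) _ => //; lra.
  have -> : u1 - u2 - w = (u1 - (w + v)) - (u2 - v).
    by rewrite !opprD opprK addrACA -!addrA; congr (_ + _); rewrite [in RHS]addrCA addNr addr0 addrC.
  by apply: le_lt_trans (nrmB _ _) _; lra.
have denseZ t w e : 0 < t -> X w -> nrm w < r * t -> 0 < e ->
    exists u, [/\ X u, q u <= 2 * m%:R * t & nrm (w - u) < e].
  move=> t0 Xw wr e0.
  have [|||u [Xu qu uw]] := dense0 (real_scalar k t^-1 *: w) (e / t).
  - exact: XZ.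
  - by rewrite nrmZ modulus_real_scalar ?invr_ge0 ?(ltW t0)// mulrC ltr_pdivrMr.
  - by rewrite divr_gt0.
  exists (real_scalar k t *: u); split; first exact: XZ.
    by apply: le_trans (qZ _ Xu) _; rewrite modulus_real_scalar ?(ltW t0)// [leRHS]mulrC ler_wpM2l// ltW.
  have -> : w - real_scalar k t *: u = real_scalar k t *: (real_scalar k t^-1 *: w - u).
    by rewrite scalerBr scalerA mulrC real_scalarVK ?gt_eqF// scale1r.
  by rewrite nrmZ modulus_real_scalar ?(ltW t0)// nrm_distC mulrC -ltr_pdivlMr.
have bounded w : X w -> nrm w < r -> q w <= 4 * m%:R.
  move=> Xw wr.
  have /choice[f Hf] (s : V * nat) : exists u, X s.1 -> nrm s.1 < r * (1/2) ^+ s.2 ->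
      [/\ X u, q u <= 2 * m%:R * (1/2) ^+ s.2 & nrm (s.1 - u) < r * (1/2) ^+ s.2.+1].
    case: (pselect (X s.1)) => [X1|?]; last by exists 0.
    case: (pselect (nrm s.1 < r * (1/2) ^+ s.2)) => [n1|?]; last by exists 0.
    have [u Hu] := denseZ ((1/2) ^+ s.2) s.1 (r * (1/2) ^+ s.2.+1) (h1 _) X1 n1 (mulr_gt0 r0 (h1 _)).
    by exists u.
  pose rem := fix rem n := if n is n'.+1 then rem n' - f (rem n', n') else w.
  have rem_inv n : X (rem n) /\ nrm (rem n) < r * (1/2) ^+ n.
    elim: n => [|n [Xn rn]]; first by rewrite expr0 mulr1.
    by have [Xf _ H] := Hf (rem n, n) Xn rn; split => //=; exact: XB.
  pose u n := f (rem n, n).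
  have Hu n : X (u n) /\ q (u n) <= 2 * m%:R * (1/2) ^+ n.
    by have [Xn rn] := rem_inv n; have [] := Hf (rem n, n) Xn rn.
  have uw : series u @ \oo --> w.
    apply: (@geometric_cvg _ _ _ r) => n.
    have -> : series u n - w = - rem n.
      rewrite seriesEnat/=; elim: n => [|n IH] /=; first by rewrite big_geq// sub0r.
      by rewrite big_nat_recr//= addrAC IH opprB addrC.
    by rewrite nrmN; apply/ltW; have [] := rem_inv n.
  have := q_csub (fun j => (Hu j).1) (fun j => (Hu j).2) uw; lra.
exists (8 * m%:R / r); first by rewrite divr_ge0// ?mulr_ge0// ltW.
move=> x Xx; have [/eqP|x0] := eqVneq (nrm x) 0.
  rewrite nrm_eq0 => /eqP ->; rewrite nrm0 mulr0.
  by rewrite -(scale0r (0 : V)); apply: le_trans (qZ _ X0) _; rewrite modulus0 mul0r.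
have {x0}x0 : 0 < nrm x by rewrite lt_neqAle eq_sym x0 nrm_ge0.
pose t := r / (2 * nrm x).
have t0 : 0 < t by rewrite divr_gt0// mulr_gt0.
have -> : x = real_scalar k t^-1 *: (real_scalar k t *: x).
  by rewrite scalerA real_scalarVK ?gt_eqF// scale1r.
apply: le_trans (qZ _ _) _; first exact: XZ.
rewrite modulus_real_scalar ?invr_ge0 ?(ltW t0)// scalerA real_scalarVK ?gt_eqF// scale1r.
have xt : nrm (real_scalar k t *: x) < r.
  by rewrite nrmZ modulus_real_scalar ?(ltW t0)// /t invfM mulrA mulfVK ?gt_eqF//; lra.
apply: le_trans (ler_wpM2l _ (bounded _ (XZ _ Xx) xt)) _; first by rewrite invr_ge0 ltW.
suff -> : t^-1 * (4 * m%:R) = 8 * m%:R / r * nrm x by [].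
by rewrite /t; field; rewrite !gt_eqF.
Qed.

End Zabreiko.

(** * Basic sequences and the basis constant *)

Section BasisConstant.
Variables (R : realType) (k : scalar_kind).
Local Notation F := (Defs.scalar R k).
Variables (V : normedModType F) (x : nat -> V).

Definition expands (a : nat -> F) (v : V) := series (fun i => a i *: x i) @ \oo --> v.

Lemma expands_closed_span a v : expands a v -> closed_span x v.
Proof.
move=> /cvg_nrmP av; apply/closed_spanP => e /av[N /(_ N (leqnn _)) H].
by exists N, a; rewrite nrm_distC.
Qed.

Lemma expandsB a b v w : expands a v -> expands b w -> expands (fun i => a i - b i) (v - w).
Proof.
move=> av bw; rewrite /expands.
have -> : series (fun i => (a i - b i) *: x i) =
    series (fun i => a i *: x i) - series (fun i => b i *: x i).
  by apply/funext => n; rewrite !seriesEnat/= fctE -sumrB; apply: eq_bigr => i _; rewrite scalerBl.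
exact: cvgB.
Qed.

Lemma expandsZ c a v : expands a v -> expands (fun i => c * a i) (c *: v).
Proof.
move=> av; rewrite /expands.
have -> : series (fun i => (c * a i) *: x i) = c *: series (fun i => a i *: x i).
  apply/funext => n; transitivity (c *: \sum_(0 <= i < n) a i *: x i) => //.
  by rewrite seriesEnat/= scaler_sumr; apply: eq_bigr => i _; rewrite scalerA.
exact: cvgZr.
Qed.

Lemma expandsD a b v w : expands a v -> expands b w -> expands (fun i => a i + b i) (v + w).
Proof.
move=> av bw; have := expandsB av (expandsZ (c := -1) bw); rewrite scaleN1r opprK.
by congr expands; apply/funext => i; rewrite mulN1r opprK.
Qed.

Lemma expands_finite a n :
  expands (fun i => if (i < n)%N then a i else 0) (\sum_(0 <= i < n) a i *: x i).
Proof.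
apply/cvg_nrmP => e e0; exists n => m nm.
rewrite seriesEnat/= (big_cat_nat (n := n))//= [X in _ + X - _]big1_seq ?addr0; last first.
  by move=> i /=; rewrite mem_index_iota => /andP[ni _]; rewrite ltnNge ni scale0r.
rewrite (eq_big_nat _ _ (F2 := fun i => a i *: x i)) ?subrr ?nrm0//.
by move=> i /andP[_ ->].
Qed.

Lemma closed_span_lim (u : nat -> V) l :
  (forall n, closed_span x (u n)) -> u @ \oo --> l -> closed_span x l.
Proof.
move=> xu /cvg_nrmP ul; apply/closed_spanP => e e0.
have e20 : 0 < e / 2 by rewrite divr_gt0.
have [N /(_ N (leqnn _)) uN] := ul _ e20.
have [n [a H]] := (closed_spanP x (u N)).1 (xu N) _ e20.
exists n, a; apply: le_lt_trans (nrm_triangle (u N) _ _) _.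
by rewrite (nrm_distC l); lra.
Qed.

Hypothesis Vcomplete : complete_nrm V.
Hypothesis xbasic : basic_sequence x.

Lemma expandsP v : closed_span x v -> exists a, expands a v.
Proof. by move=> /xbasic[a [? _]]; exists a. Qed.

Lemma expands_unique a b v : expands a v -> expands b v -> a = b.
Proof.
move=> av bv; have [c [_ cu]] := xbasic (expands_closed_span av).
by rewrite -(cu a)// -(cu b).
Qed.

Lemma closed_span0 : closed_span x 0.
Proof.
by apply/closed_spanP => e e0; exists 0, (fun=> 0); rewrite big_geq// subrr nrm0.
Qed.

Lemma closed_spanB v w : closed_span x v -> closed_span x w -> closed_span x (v - w).
Proof.
move=> /expandsP[a av] /expandsP[b bw].
exact: expands_closed_span (expandsB av bw).
Qed.

Lemma closed_spanZ c v : closed_span x v -> closed_span x (c *: v).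
Proof. by move=> /expandsP[a av]; exact: expands_closed_span (expandsZ (c := c) av). Qed.

Lemma basic_neq0 n : 0 < nrm (x n).
Proof.
rewrite lt_neqAle nrm_ge0 andbT eq_sym nrm_eq0; apply/negP => /eqP xn0.
have z0 : expands (fun=> 0) 0.
  by rewrite /expands; apply/cvg_nrmP => e e0; exists 0%N => m _;
  rewrite seriesEnat/= big1 ?subrr ?nrm0// => i _; rewrite scale0r.
have : expands (fun i => (i == n)%:R) 0.
  move: z0; rewrite /expands.
  suff -> : (fun i => (i == n)%:R *: x i) = (fun i => (0 : F) *: x i) by [].
  apply/funext => i; rewrite scale0r.
  by case: eqVneq => [->|_]; rewrite ?xn0 ?scaler0 ?scale0r.
move=> /(expands_unique z0) /(congr1 (fun f => f n)); rewrite eqxx => /esym/eqP.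
by rewrite oner_eq0.
Qed.

Lemma expands_bounded a v : expands a v ->
  exists M, forall n, nrm (\sum_(0 <= i < n) a i *: x i) <= M.
Proof.
move=> /cvg_nrmP /(_ _ ltr01)[N HN].
pose f n := nrm (\sum_(0 <= i < n) a i *: x i).
exists (\sum_(i < N) f i + (nrm v + 1)) => n; rewrite -/(f n).
have s0 : 0 <= \sum_(i < N) f i by apply: sumr_ge0 => i _; exact: nrm_ge0.
have [nN|Nn] := ltnP n N.
  rewrite (bigD1 (Ordinal nN))//=.
  have : 0 <= \sum_(i < N | i != Ordinal nN) f i by apply: sumr_ge0 => i _; exact: nrm_ge0.
  by have := nrm_ge0 v; lra.
have := HN _ Nn; rewrite seriesEnat /=.
by have := nrm_le_dist (\sum_(0 <= i < n) a i *: x i) v; rewrite -/(f n); lra.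
Qed.

(** Banach: coefficients depend continuously on the vector. Let q v be the
    supremum of the norms of the partial sums of the expansion of v. If v is the
    sum of vectors u j with q (u j) <= c / 2^j, then the coefficients of the u j
    add up to coefficients al whose partial sums B n differ from those of the
    first J vectors by at most 2 c / 2^J, uniformly in n. Hence al expands v, and
    by uniqueness q v <= 2 c. So q is countably subadditive and Zabreiko's lemma
    applies. *)
Lemma basis_constant : exists2 K, 0 <= K & forall a m n, (m <= n)%N ->
  nrm (\sum_(0 <= i < m) a i *: x i) <= K * nrm (\sum_(0 <= i < n) a i *: x i).
Proof.
have /choice[coef Hcoef] v : exists a, closed_span x v -> expands a v.
  by case: (pselect (closed_span x v)) => [/expandsP[a av]|nv]; [exists a|exists (fun=> 0)].
pose T a n := nrm (\sum_(0 <= i < n) a i *: x i).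
pose q v := sup (range (T (coef v))).
have q_ub v : closed_span x v -> has_ubound (range (T (coef v))).
  move=> /Hcoef /expands_bounded[M HM]; exists M => _ [n _ <-]; exact: HM.
have q_ge v n : closed_span x v -> T (coef v) n <= q v.
  by move=> xv; apply: ub_le_sup; [exact: q_ub|exists n].
have q_le v a M : expands a v -> (forall n, T a n <= M) -> q v <= M.
  move=> av aM; have xv := expands_closed_span av.
  rewrite /q; have -> : coef v = a by apply: expands_unique av; exact: Hcoef.
  by apply: ge_sup => [|_ [n _ <-]//]; exists (T a 0), 0.
have T_sub a b n : T (fun i => a i - b i) n <= T a n + T b n.
  rewrite /T -(nrmN (\sum_(_ <= _ < _) b _ *: _)); apply: le_trans _ (nrmD _ _).
  rewrite -sumrB (eq_bigr (fun i => a i *: x i - b i *: x i))// => i _.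
  by rewrite scalerBl.
have qB v w : closed_span x v -> closed_span x w -> q (v - w) <= q v + q w.
  move=> xv xw; apply: q_le (expandsB (Hcoef _ xv) (Hcoef _ xw)) _ => n.
  by apply: le_trans (T_sub _ _ _) _; rewrite lerD// q_ge.
have qZ c v : closed_span x v -> q (c *: v) <= modulus c * q v.
  move=> xv; apply: q_le (expandsZ (c := c) (Hcoef _ xv)) _ => n.
  rewrite /T (eq_bigr (fun i => c *: (coef v i *: x i))); last first.
    by move=> i _; rewrite scalerA.
  by rewrite -scaler_sumr nrmZ ler_wpM2l ?modulus_ge0//; exact: q_ge.
have q_csub c (u : nat -> V) v : (forall j, closed_span x (u j)) ->
    (forall j, q (u j) <= c * (1/2) ^+ j) -> series u @ \oo --> v -> q v <= 2 * c.
  move=> xu qu uv.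
  pose A J i : F := \sum_(0 <= j < J) coef (u j) i.
  have AS J i : A J.+1 i = A J i + coef (u J) i by rewrite /A big_nat_recr.
  have coord j i : modulus (coef (u j) i) <= (2 * c / nrm (x i)) * (1/2) ^+ j.
    rewrite mulrAC ler_pdivlMr ?basic_neq0// -nrmZ.
    have -> : coef (u j) i *: x i = \sum_(0 <= l < i.+1) coef (u j) l *: x l
        - \sum_(0 <= l < i) coef (u j) l *: x l.
      by rewrite big_nat_recr//= [X in X - _]addrC addrK.
    apply: le_trans (nrmB _ _) _.
    by have := q_ge (u j) i (xu j); have := q_ge (u j) i.+1 (xu j); have := qu j; rewrite /T; lra.
  have /choice[al Hal] i : exists l : F, forall J,
      modulus (A J i - l) <= 4 * (2 * c / nrm (x i)) * (1/2) ^+ J.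
    apply: scalar_geometric_complete => J; rewrite AS [X in X - _]addrC addrK.
    exact: coord.
  pose P n J := \sum_(0 <= i < n) A J i *: x i.
  pose B n := \sum_(0 <= i < n) al i *: x i.
  have PB n J : nrm (P n J - B n) <= 2 * c * (1/2) ^+ J.
    move: J; apply: geometric_limit => [J|].
      have -> : P n J.+1 - P n J = \sum_(0 <= i < n) coef (u J) i *: x i.
        by rewrite /P -sumrB; apply: eq_bigr => i _; rewrite AS scalerDl [X in X - _]addrC addrK.
      exact: le_trans (q_ge (u J) n (xu J)) (qu J).
    apply: (@geometric_cvg _ _ _ (\sum_(0 <= i < n) 4 * (2 * c / nrm (x i)) * nrm (x i))) => J.
    rewrite /P /B -sumrB mulr_suml; apply: le_trans (nrm_sum _ _ _) _.
    apply: ler_sum => i _; rewrite -scalerBl nrmZ mulrAC.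
    by rewrite ler_wpM2r ?nrm_ge0.
  have Pexp J : expands (A J) (series u J).
    elim: J => [|J IH].
      rewrite /A seriesEnat /= big_geq//; have := expandsZ (c := 0) (Hcoef _ closed_span0).
      rewrite scaler0; congr expands; apply/funext => i.
      by rewrite mul0r big_geq.
    have := expandsD IH (Hcoef _ (xu J)); rewrite seriesEnat/= big_nat_recr//=.
    by congr expands; apply/funext => i; rewrite AS.
  have alv : expands al v.
    apply/cvg_nrmP => e e0; have e30 : 0 < e / 3 by rewrite divr_gt0.
    have [N1 HN1] := geometric_small (2 * c) e30.
    move/cvg_nrmP : uv => /(_ _ e30)[N2 HN2].
    pose J := maxn N1 N2.
    have /cvg_nrmP /(_ _ e30)[N HN] := Pexp J.
    exists N => n /HN; rewrite !seriesEnat /= -/(P n J) -/(B n) => H1.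
    have H2 := PB n J; have H3 := HN1 J (leq_maxl _ _).
    have := HN2 J (leq_maxr _ _); rewrite seriesEnat/= => H4.
    have H5 := nrm_triangle (P n J) (B n) v; rewrite (nrm_distC (B n) (P n J)) in H5.
    have := nrm_triangle (\sum_(0 <= j < J) u j) (P n J) v; lra.
  apply: q_le alv _ => n; have := PB n 0; rewrite /P big1_seq ?sub0r ?nrmN ?expr0 ?mulr1//.
  by move=> i _; rewrite /A big_geq// scale0r.
have [K K0 HK] := @countably_subadditive_bounded R k V (closed_span x) q Vcomplete
  closed_span0 closed_spanB closed_spanZ closed_span_lim qB qZ q_csub.
exists K => // a m n mn.
have xa := @expands_finite a n; have xs := expands_closed_span xa.
apply: le_trans (HK _ xs); apply: le_trans (q_ge _ m xs).
rewrite /T (expands_unique (Hcoef _ xs) xa) [leRHS](_ : _ = nrm (\sum_(0 <= i < m) a i *: x i))//.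
by congr nrm; apply: eq_big_nat => i /andP[_ im]; rewrite (leq_trans im mn).
Qed.

End BasisConstant.

(** * Unconditional basic sequences *)

Section BlockPermutation.
Variables (M : nat -> nat) (P : nat -> pred nat).
Hypotheses (M0 : M 0 = 0%N) (M_lt : forall j, (M j < M j.+1)%N).

Let block j := iota (M j) (M j.+1 - M j).

Let prefix_list := fix s j := if j is j'.+1 then
  s j' ++ ([seq i <- block j' | P j' i] ++ [seq i <- block j' | ~~ P j' i]) else [::].

Let permE j : perm_eq (prefix_list j) (iota 0 (M j)).
Proof.
elim: j => [|j IH]; first by rewrite M0.
rewrite /= -(subnKC (ltnW (M_lt j))) iotaD add0n.
by apply: perm_cat => //; rewrite perm_filterC.
Qed.

Let sizeE j : size (prefix_list j) = M j.
Proof. by rewrite (perm_size (permE j)) size_iota. Qed.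

Let uniqE j : uniq (prefix_list j).
Proof. by rewrite (perm_uniq (permE j)) iota_uniq. Qed.

Let memE j y : (y \in prefix_list j) = (y < M j)%N.
Proof. by rewrite (perm_mem (permE j)) mem_iota add0n. Qed.

Let M_ge j : (j <= M j)%N.
Proof. by elim: j => // j IH; exact: leq_ltn_trans IH (M_lt j). Qed.

Let M_le i j : (i <= j)%N -> (M i <= M j)%N.
Proof. by move=> /subnKC <-; elim: (_ - _)%N => [|n IH]; rewrite ?addn0// addnS (leq_trans IH)// ltnW. Qed.

Let nth_mono j n i : (i < M j)%N -> nth 0%N (prefix_list (j + n)) i = nth 0%N (prefix_list j) i.
Proof.
move=> ij; elim: n => [|n <-]; rewrite ?addn0// addnS /= nth_cat sizeE.
by rewrite (leq_trans ij)// M_le// leq_addr.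
Qed.

(** Enumerates nat one block [M j, M j.+1) after the other, the elements of P j
    coming first in their block. An initial segment of the enumeration can thus
    isolate P j inside the block. *)
Definition block_perm i := nth 0%N (prefix_list i.+1) i.

Let permEnth j i : (i < M j)%N -> block_perm i = nth 0%N (prefix_list j) i.
Proof.
move=> ij; rewrite /block_perm; case: (leqP j i.+1) => [ji|/ltnW ij'].
  by rewrite -(subnKC ji) nth_mono.
by rewrite -[in RHS](subnKC ij') nth_mono// M_ge.
Qed.

Lemma block_perm_bij : bijective block_perm.
Proof.
have inj i i' : block_perm i = block_perm i' -> i = i'.
  move=> e; pose J := maxn i.+1 i'.+1.
  have iJ : (i < M J)%N by apply: leq_trans (M_ge _); exact: leq_maxl.
  have iJ' : (i' < M J)%N by apply: leq_trans (M_ge _); exact: leq_maxr.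
  apply/eqP; rewrite -(nth_uniq 0%N _ _ (uniqE J)) ?sizeE//.
  by rewrite -!permEnth// e.
have gK y : block_perm (index y (prefix_list y.+1)) = y.
  have yM : y \in prefix_list y.+1 by rewrite memE M_ge.
  by rewrite (@permEnth y.+1) ?nth_index// -sizeE index_mem.
by exists (fun y => index y (prefix_list y.+1)) => // i; apply: inj; rewrite gK.
Qed.

Lemma sum_block_perm (V : nmodType) (G : nat -> V) j :
  \sum_(0 <= i < M j.+1) G (block_perm i) = \sum_(0 <= i < M j.+1) G i.
Proof.
rewrite -(big_map block_perm xpredT) /index_iota subn0.
rewrite [X in \sum_(_ <- X) _ = _](_ : _ = prefix_list j.+1).
  by rewrite (perm_big _ (permE j.+1)).
apply: (@eq_from_nth _ 0%N) => [|i]; rewrite size_map size_iota ?sizeE// => iM.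
by rewrite (nth_map 0%N) ?size_iota// nth_iota// add0n; exact: permEnth.
Qed.

Lemma sum_block_perm_partial (V : nmodType) (G : nat -> V) j :
  exists2 m, (m <= M j.+1)%N & \sum_(0 <= i < m) G (block_perm i) =
    \sum_(0 <= i < M j) G i + \sum_(M j <= i < M j.+1 | P j i) G i.
Proof.
pose l := prefix_list j ++ [seq i <- block j | P j i].
have lE : prefix_list j.+1 = l ++ [seq i <- block j | ~~ P j i] by rewrite /= catA.
have lM : (size l <= M j.+1)%N by rewrite -sizeE lE size_cat leq_addr.
exists (size l) => //.
rewrite -(big_map block_perm xpredT) /index_iota subn0.
rewrite [X in \sum_(_ <- X) _ = _](_ : _ = l).
  by rewrite big_cat/= big_filter (perm_big _ (permE j)) subn0.
apply: (@eq_from_nth _ 0%N) => [|i]; rewrite size_map size_iota// => il.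
rewrite (nth_map 0%N) ?size_iota// nth_iota// add0n (@permEnth j.+1) ?(leq_trans il)//.
by rewrite lE nth_cat il.
Qed.

End BlockPermutation.

Section UnconditionalConstant.
Variables (R : realType) (k : scalar_kind).
Local Notation F := (Defs.scalar R k).
Variables (V : normedModType F) (x : nat -> V).
Hypothesis Vcomplete : complete_nrm V.
Hypothesis xunc : unconditional_basic_sequence x.

(** Gliding hump. If projections on subsets were unbounded, then, coordinates
    being continuous, they would be unbounded already on vectors supported beyond
    any given N. Successive blocks would then carry vectors whose projection on
    some P j is j times larger. For the rearrangement [block_perm] this projection
    is a partial sum, against the basis constant of the rearranged sequence. *)
Lemma subset_projection_constant : exists2 K, 0 <= K & forall a (P : pred nat) n,
  nrm (\sum_(0 <= i < n | P i) a i *: x i) <= K * nrm (\sum_(0 <= i < n) a i *: x i).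
Proof.
have xb : basic_sequence x by apply: (xunc (p := id)); exists id.
have [K K0 HK] := basis_constant Vcomplete xb.
apply: contrapT => noK.
(* A coordinate is a difference of two partial sums. *)
have coord a n i : (i < n)%N -> nrm (a i *: x i) <= 2 * K * nrm (\sum_(0 <= i < n) a i *: x i).
  move=> ni; have -> : a i *: x i = \sum_(0 <= l < i.+1) a l *: x l
        - \sum_(0 <= l < i) a l *: x l.
    by rewrite big_nat_recr//= [X in X - _]addrC addrK.
  apply: le_trans (nrmB _ _) _.
  by have := HK a i.+1 n ni; have := HK a i n (ltnW ni); lra.
have head a (P : pred nat) N n : (N <= n)%N -> nrm (\sum_(0 <= i < N | P i) a i *: x i)
    <= 2 * K * N%:R * nrm (\sum_(0 <= i < n) a i *: x i).
  move=> Nn; apply: le_trans (nrm_sum _ _ _) _; rewrite big_mkcond/=.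
  apply: le_trans (ler_sum_nat (G := fun=> 2 * K * nrm (\sum_(0 <= i < n) a i *: x i)) _) _.
    move=> i /andP[_ iN]; case: ifP => _; first by apply: coord; exact: leq_trans iN Nn.
    by rewrite mulr_ge0 ?nrm_ge0// mulr_ge0.
  by rewrite sumr_const_nat subn0 -[leLHS]mulr_natr mulrAC.
have tail_bad (s : nat * nat) : exists t : pred nat * (nat -> F) * nat, (s.1 <= t.2)%N /\
    s.2%:R * nrm (\sum_(s.1 <= i < t.2) t.1.2 i *: x i) <
      nrm (\sum_(s.1 <= i < t.2 | t.1.1 i) t.1.2 i *: x i).
  case: s => N j /=; apply: contrapT => H; apply: noK.
  exists (2 * K * N%:R + j%:R * (1 + K)) => [|a P n].
    by rewrite addr_ge0// mulr_ge0// ?addr_ge0// mulr_ge0.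
  have jK : 0 <= j%:R * (1 + K) by rewrite mulr_ge0// addr_ge0.
  have n0 := nrm_ge0 (\sum_(0 <= i < n) a i *: x i).
  have [Nn|/ltnW nN] := leqP N n; last first.
    apply: le_trans (head a P n n (leqnn _)) _; rewrite ler_wpM2r//.
    rewrite -[leLHS]addr0 lerD// ler_wpM2l ?ler_nat//; lra.
  rewrite (big_cat_nat (n := N))//=; apply: le_trans (nrmD _ _) _.
  rewrite mulrDl; apply: lerD; first exact: head.
  have : nrm (\sum_(N <= i < n | P i) a i *: x i) <= j%:R * nrm (\sum_(N <= i < n) a i *: x i).
    by rewrite leNgt; apply/negP => H'; apply: H; exists (P, a, n).
  move=> /le_trans; apply; rewrite -mulrA ler_wpM2l//.
  have -> : \sum_(N <= i < n) a i *: x i = \sum_(0 <= i < n) a i *: x i - \sum_(0 <= i < N) a i *: x i.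
    by rewrite [in RHS](big_cat_nat (n := N))//= [X in X - _]addrC addrK.
  by apply: le_trans (nrmB _ _) _; have := HK a N n Nn; lra.
have {tail_bad}[f Hf] := choice tail_bad.
pose M := fix M j := if j is j'.+1 then (f (M j', j')).2 else 0%N.
pose P j := (f (M j, j)).1.1.
have M_lt j : (M j < M j.+1)%N.
  have [] := Hf (M j, j); rewrite /= leq_eqVlt => /predU1P[<-|//].
  by rewrite !big_geq// nrm0 mulr0 ltxx.
have [Kp Kp0 HKp] := basis_constant Vcomplete (xunc (block_perm_bij P (erefl : M 0 = 0%N) M_lt)).
have [j jK] : exists j : nat, Kp <= j%:R.
  by exists (Num.truncn Kp).+1; apply/ltW/truncnS_gt.
pose a := (f (M j, j)).1.2.
pose b i := if (M j <= i)%N then a i else 0.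
have [_] := Hf (M j, j); rewrite /= -/a -/(P j) -/(M j.+1) ltNge => /negP; apply.
(* Only block j contributes, so the full sum and the partial sum after P j are
   the two sides of the failing estimate. *)
have b0 : \sum_(0 <= i < M j) b i *: x i = 0.
  rewrite big1_seq// => i; rewrite mem_index_iota /= /b => iM.
  by rewrite leqNgt iM scale0r.
have bE (Q : pred nat) : \sum_(M j <= i < M j.+1 | Q i) b i *: x i = \sum_(M j <= i < M j.+1 | Q i) a i *: x i.
  rewrite big_mkcond [RHS]big_mkcond; apply: eq_big_nat => i /andP[Mi _].
  by rewrite /b Mi.
have [m mM Hm] := sum_block_perm_partial P (erefl : M 0 = 0%N) M_lt (fun i => b i *: x i) j.
have := HKp (b \o block_perm M P) m (M j.+1) mM.
rewrite /= Hm (sum_block_perm P (erefl : M 0 = 0%N) M_lt (fun i => b i *: x i) j).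
rewrite [\sum_(0 <= i < M j.+1) _](big_cat_nat (n := M j))//; last exact/ltnW/M_lt.
rewrite b0 !add0r !bE => /le_trans; apply.
by rewrite /= add0r ler_wpM2r// nrm_ge0.
Qed.

(** A sign change is the difference of two complementary projections. *)
Lemma unconditional_sign_constant : exists2 K, 0 <= K & forall a (e : nat -> bool) n,
  nrm (\sum_(0 <= i < n) (-1) ^+ e i *: (a i *: x i)) <= K * nrm (\sum_(0 <= i < n) a i *: x i).
Proof.
have [K K0 HK] := subset_projection_constant.
exists (2 * K) => [|a e n]; first by rewrite mulr_ge0.
have -> : \sum_(0 <= i < n) (-1) ^+ e i *: (a i *: x i) =
  \sum_(0 <= i < n | ~~ e i) a i *: x i - \sum_(0 <= i < n | e i) a i *: x i.
  rewrite (bigID e) /= addrC -sumrN; congr (_ + _); apply: eq_bigr => i.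
    by move=> /negbTE ->; rewrite expr0 scale1r.
  by move=> ->; rewrite expr1 scaleN1r.
apply: le_trans (nrmB _ _) _.
by have := HK a e n; have := HK a (fun i => ~~ e i) n; lra.
Qed.

End UnconditionalConstant.

(** * Equivalence with the unit vectors of l_2 *)

Section Ell2.
Variables (R : realType) (k : scalar_kind).
Local Notation F := (Defs.scalar R k).

Definition l2sum (b : nat -> F) n : R := \sum_(0 <= i < n) modulus (b i) ^+ 2.

Lemma l2sum_ge0 b n : 0 <= l2sum b n.
Proof. by apply: sumr_ge0 => i _; exact: sqr_ge0. Qed.

Lemma l2sum_mono b m n : (m <= n)%N -> l2sum b m <= l2sum b n.
Proof.
move=> mn; rewrite /l2sum [leRHS](big_cat_nat (n := m))//= lerDl.
by apply: sumr_ge0 => i _; exact: sqr_ge0.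
Qed.

Let term_ge0 (b : nat -> F^o) n : (0 <= (modulus (b n : F) ^+ 2)%:E)%E.
Proof. by rewrite lee_fin sqr_ge0. Qed.

Let l2sumE (b : nat -> F^o) n :
  (\sum_(0 <= i < n) (modulus (b i : F) ^+ 2)%:E)%E = (l2sum b n)%:E.
Proof. by rewrite sumEFin. Qed.

Lemma ell2_norm_le (b : nat -> F^o) M : 0 <= M ->
  (forall n, l2sum b n <= M ^+ 2) -> (ell2_norm b <= M%:E)%E.
Proof.
move=> M0 bM; rewrite /ell2_norm poweR12_sqrt ?nneseries_ge0//.
have -> : M = Num.sqrt (M ^+ 2) by rewrite sqrtr_sqr ger0_norm.
have : (\sum_(0 <= n <oo) (modulus (b n : F) ^+ 2)%:E <= (M ^+ 2)%:E)%E.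
  apply: lime_le; first exact: is_cvg_nneseries.
  by apply: nearW => n; rewrite l2sumE lee_fin.
case: (\sum_(0 <= n <oo) (modulus (b n : F) ^+ 2)%:E)%E => [r||]//=.
by rewrite !lee_fin; exact: ler_wsqrtr.
Qed.

Lemma l2sum_le (b : ell2 R k) n : l2sum (fns_val b) n <= nrm b ^+ 2.
Proof.
have -> : nrm b = fine (ell2_norm (fns_val b)).
  rewrite -[LHS](@modulus_real_scalar R k) ?nrm_ge0//.
  rewrite -[RHS](@modulus_real_scalar R k) ?fine_ge0 ?ell2_norm_ge0//.
  by congr modulus; rewrite nrmE.
have : (ell2_norm (fns_val b) < +oo)%E by exact: (fns_valP b).
rewrite /ell2_norm poweR12_sqrt ?nneseries_ge0//.
have := @nneseries_lim_ge R _ xpredT 0 n (fun n _ _ => term_ge0 (fns_val b) n).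
rewrite l2sumE.
have := nneseries_ge0 (fun n _ _ => term_ge0 (fns_val b) n) (P := xpredT) (N := 0).
case: (\sum_(0 <= n <oo) (modulus (fns_val b n : F) ^+ 2)%:E)%E => [r||]//=.
by rewrite !lee_fin => r0 + _; rewrite sqr_sqrtr.
Qed.

Lemma ell2_nrm_le (b : ell2 R k) M : 0 <= M ->
  (forall n, l2sum (fns_val b) n <= M ^+ 2) -> nrm b <= M.
Proof.
move=> M0 /ell2_norm_le -/(_ M0) bM.
rewrite -(ler_real_scalar k) nrmE ler_real_scalar -lee_fin fineK//.
exact: fns_fin_num.
Qed.

Lemma l2_tail_small (b : nat -> F) M e : (forall n, l2sum b n <= M) -> 0 < e ->
  exists N, forall n, l2sum (fun i => if (N <= i)%N then b i else 0) n < e.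
Proof.
move=> bM e0; have ub : has_sup (range (l2sum b)).
  by split; [exists (l2sum b 0), 0|exists M => _ [n _ <-]].
have [_ [N _ <-] HN] := sup_adherent e0 ub.
exists N => n.
have -> : l2sum (fun i => if (N <= i)%N then b i else 0) n = \sum_(N <= i < n) modulus (b i) ^+ 2.
  case: (leqP N n) => [Nn|nN]; last first.
    rewrite [RHS]big_geq ?(ltnW nN)// /l2sum big1_seq// => i /=.
    rewrite mem_index_iota /= => ni.
    by rewrite leqNgt (ltn_trans ni nN) modulus0 expr0n.
  rewrite /l2sum (big_cat_nat (n := N))//= big1_seq ?add0r; last first.
    move=> i /=; rewrite mem_index_iota /= => iN.
    by rewrite leqNgt iN modulus0 expr0n.
  by apply: eq_big_nat => i /andP[-> _].
have [nN|/ltnW Nn] := leqP n N; first by rewrite big_geq.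
have := ub_le_sup ub.2 (ex_intro2 _ _ n I erefl); rewrite /l2sum (big_cat_nat (n := N))//=.
by move: HN; rewrite /l2sum /=; lra.
Qed.

Lemma ell2_sum_unit (a : nat -> F) n m :
  fns_val (\sum_(0 <= i < n) a i *: ell2_unit R k i) m = if (m < n)%N then a m else 0.
Proof.
elim: n => [|n IH]; first by rewrite big_geq.
rewrite big_nat_recr//= [LHS](_ : _ = fns_val (\sum_(0 <= i < n) a i *: ell2_unit R k i) m
  + a n * (m == n)%:R)// IH ltnS.
case: (ltngtP m n) => [mn|nm|->]; rewrite ?mulr0 ?addr0 ?mulr1 ?add0r//.
Qed.

Lemma ell2_expands (b : ell2 R k) :
  expands (@ell2_unit R k) (fns_val b) b.
Proof.
apply/cvg_nrmP => e e0.
have e20 : 0 < (e / 2) ^+ 2 by rewrite exprn_gt0// divr_gt0.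
have [N HN] := l2_tail_small (l2sum_le b) e20.
exists N => n Nn; rewrite nrm_distC; apply: (@le_lt_trans _ _ (e / 2)); last by lra.
apply: ell2_nrm_le => [|m]; first by rewrite divr_ge0// ltW.
apply: le_trans (ltW (HN m)); apply: ler_sum => i _.
rewrite [X in modulus X](_ : _ = fns_val b i -
   fns_val (\sum_(0 <= i < n) (fns_val b i : F) *: ell2_unit R k i) i)//.
rewrite ell2_sum_unit; case: ifPn => [_|].
  by rewrite subrr modulus0 expr0n sqr_ge0.
by rewrite -leqNgt => /(leq_trans Nn) ->; rewrite subr0.
Qed.

Lemma ell2_closed_span (b : ell2 R k) : closed_span (@ell2_unit R k) b.
Proof. by apply: expands_closed_span; exact: ell2_expands. Qed.

(** The isomorphism sends a vector to its sequence of coefficients. Estimates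
    on partial sums pass to the limit, and completeness turns a square summable
    sequence of coefficients into a convergent series. *)
Lemma equivalent_ell2_unit (V : normedModType F) (x : nat -> V) (c C : R) :
  complete_nrm V -> basic_sequence x -> 0 < c -> 0 < C ->
  (forall a n, c ^+ 2 * l2sum a n <= nrm (\sum_(0 <= i < n) a i *: x i) ^+ 2) ->
  (forall a n, nrm (\sum_(0 <= i < n) a i *: x i) ^+ 2 <= C ^+ 2 * l2sum a n) ->
  equivalent_sequences x (@ell2_unit R k).
Proof.
move=> Vc xb c0 C0 lo up.
have lo' a n m : (n <= m)%N -> Num.sqrt (l2sum a n) <= nrm (\sum_(0 <= i < m) a i *: x i) / c.
  move=> nm; rewrite ler_pdivlMr// -[leRHS]ger0_norm ?nrm_ge0// -[leRHS]sqrtr_sqr.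
  rewrite -[X in _ * X](ger0_norm (ltW c0)) -(sqrtr_sqr c) -sqrtrM ?l2sum_ge0//.
  rewrite ler_wsqrtr// mulrC; apply: le_trans (lo a m).
  by rewrite ler_wpM2l ?sqr_ge0// l2sum_mono.
have lower a v n : expands x a v -> l2sum a n <= (nrm v / c) ^+ 2.
  move=> /cvg_nrmP av.
  have v0 : 0 <= nrm v / c by rewrite divr_ge0 ?nrm_ge0 ?ltW.
  rewrite -[leLHS]sqr_sqrtr ?l2sum_ge0// ler_sqr ?nnegrE ?sqrtr_ge0//.
  apply/ler_addgt0Pr => e e0; have [N HN] := av (e * c) (mulr_gt0 e0 c0).
  apply: le_trans (lo' a n (maxn n N) (leq_maxl _ _)) _.
  rewrite ler_pdivrMr// mulrDl divfK ?gt_eqF//.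
  have := HN _ (leq_maxr n N); rewrite seriesEnat/=.
  by have := nrm_le_dist (\sum_(0 <= i < maxn n N) a i *: x i) v; lra.
have up' a M n : 0 <= M -> l2sum a n <= M ^+ 2 -> nrm (\sum_(0 <= i < n) a i *: x i) <= C * M.
  move=> M0 aM; rewrite -ler_sqr ?nnegrE ?nrm_ge0 ?mulr_ge0 ?(ltW C0)//.
  by apply: le_trans (up a n) _; rewrite exprMn ler_wpM2l// sqr_ge0.
have upper (b : ell2 R k) v : expands x (fns_val b) v -> nrm v <= C * nrm b.
  move=> bv; rewrite -[v]subr0; apply: (nrm_cvg_le (N := 0%N) bv) => n _.
  by rewrite subr0 seriesEnat/=; apply: up'; [exact: nrm_ge0|exact: l2sum_le].
have /choice[S HS] v : exists b : ell2 R k, closed_span x v -> expands x (fns_val b) v.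
  case: (pselect (closed_span x v)) => [/(expandsP xb)[a av]|nv]; last by exists 0.
  have v0 : 0 <= nrm v / c by rewrite divr_ge0 ?nrm_ge0 ?ltW.
  have afin : (a : nat -> F^o) \in enorm_finite (ell2_extended_norm R k).
    by rewrite inE/=; apply: le_lt_trans (ell2_norm_le v0 (fun n => lower _ _ n av)) (ltry _).
  by exists (FiniteNorm afin).
have Suniq v (b : ell2 R k) : expands x (fns_val b) v -> S v = b.
  move=> bv; apply: val_inj => /=; apply: (expands_unique xb _ bv).
  exact: HS (expands_closed_span bv).
exists S; split.
- move=> a u v xu xv; apply: Suniq.
  have := expandsD (expandsZ (c := a) (HS _ xu)) (HS _ xv).
  by congr expands.
- split=> [v _|u v /set_mem xu /set_mem xv Suv|b _]; first exact: ell2_closed_span.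
    by have := HS _ xu; rewrite Suv => uv; exact: nrm_cvg_unique uv (HS _ xv).
  have [|v bv] := @complete_nrm_cauchy R k V (series (fun i => (fns_val b i : F) *: x i)) Vc.
    move=> e e0; have e40 : 0 < e / (4 * C) by rewrite divr_gt0// mulr_gt0.
    have [N HN] := l2_tail_small (l2sum_le b) (exprn_gt0 2 e40).
    have tail n : (N <= n)%N -> nrm (\sum_(N <= i < n) (fns_val b i : F) *: x i) <= e / 4.
      move=> Nn; have := up' _ _ n (ltW e40) (ltW (HN n)).
      rewrite (big_cat_nat (n := N))//= big1_seq ?add0r; last first.
        by move=> i; rewrite mem_index_iota /= => iN; rewrite leqNgt iN scale0r.
      rewrite (_ : C * (e / (4 * C)) = e / 4); last by field; rewrite gt_eqF.
      congr (nrm _ <= _); apply: eq_big_nat => i /andP[-> _]//.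
    exists N => m n Nm Nn; rewrite !seriesEnat/=.
    rewrite [X in X - _](big_cat_nat (n := N))//= [X in _ - X](big_cat_nat (n := N))//=.
    rewrite opprD addrACA subrr add0r; apply: le_lt_trans (nrmB _ _) _.
    by have := tail m Nm; have := tail n Nn; lra.
  by exists v; [exact: expands_closed_span bv|exact: Suniq].
- exists (real_scalar k C^-1), (real_scalar k c^-1); split.
    by rewrite -(real_scalar0 R k) ltr_real_scalar invr_gt0.
  move=> u xu; rewrite -!nrmE -!real_scalarM !ler_real_scalar; apply/andP; split.
    by rewrite ler_pdivrMl//; apply: upper; exact: HS.
  apply: ell2_nrm_le => [|n]; first by rewrite mulr_ge0 ?nrm_ge0// invr_ge0 ltW.
  by rewrite mulrC; apply: lower; exact: HS.
- move=> n; apply: Suniq; have := @expands_finite R k V x (fun i => (i == n)%:R) n.+1.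
  rewrite big_nat_recr//= eqxx scale1r big1_seq ?add0r; last first.
    by move=> i; rewrite mem_index_iota /= => ni; rewrite ltn_eqF// scale0r.
  congr expands; apply/funext => i /=; rewrite ltnS.
  by case: (ltngtP i n) => // ni.
Qed.

End Ell2.

(** * Norming functionals *)

Section HahnBanach.
Variables (R : realType) (k : scalar_kind).
Local Notation F := (Defs.scalar R k).
Variable V : normedModType F.
Implicit Types (p : V -> R) (x y : V).

Definition sublinear p := (forall x y, p (x + y) <= p x + p y) /\
  (forall r x, 0 < r -> p (real_scalar k r *: x) <= r * p x).

Lemma sublinear0 p : sublinear p -> p 0 = 0.
Proof.
move=> [_ pZ]; have := pZ 2 0; have := pZ (1/2) 0; rewrite !scaler0 divr_gt0//.
by move=> /(_ isT) + /(_ (ltr0n _ 2)); lra.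
Qed.

Lemma sublinear_ge p x : sublinear p -> - p (- x) <= p x.
Proof.
by move=> ps; have := sublinear0 ps; have := ps.1 x (- x); rewrite subrr; lra.
Qed.

Lemma sublinearZ p r x : sublinear p -> 0 <= r -> p (real_scalar k r *: x) = r * p x.
Proof.
move=> ps; rewrite le_eqVlt => /predU1P[<-|r0].
  by rewrite real_scalar0 scale0r mul0r sublinear0.
apply/le_anti/andP; split; first exact: ps.2.
rewrite mulrC -ler_pdivlMr// mulrC.
have := ps.2 r^-1 (real_scalar k r *: x); rewrite invr_gt0 => /(_ r0).
by rewrite scalerA real_scalarVK ?gt_eqF// scale1r.
Qed.

(** The largest sublinear minorant of p with value - p y at - y. *)
Definition slope p y x :=
  inf [set p (x + real_scalar k t *: y) - t * p y | t in [set t : R | 0 <= t]].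

Lemma slope_lb p y x : sublinear p ->
  has_lbound [set p (x + real_scalar k t *: y) - t * p y | t in [set t : R | 0 <= t]].
Proof.
move=> ps; exists (- p (- x)) => _ [t t0 <-].
have := ps.1 (x + real_scalar k t *: y) (- x); rewrite addrAC subrr add0r.
by rewrite sublinearZ//; lra.
Qed.

Lemma slope_le p y x t : sublinear p -> 0 <= t ->
  slope p y x <= p (x + real_scalar k t *: y) - t * p y.
Proof. by move=> ps t0; apply: ge_inf; [exact: slope_lb|exists t]. Qed.

Lemma slope_ge p y x m : (forall t, 0 <= t -> m <= p (x + real_scalar k t *: y) - t * p y) ->
  m <= slope p y x.
Proof.
move=> H; apply: lb_le_inf => [|_ [t t0 <-]]; last exact: H.
by exists (p (x + real_scalar k 0 *: y) - 0 * p y), 0 => //=.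
Qed.

Lemma slope_sublinear p y : sublinear p -> sublinear (slope p y).
Proof.
move=> ps; split=> [x1 x2|r x r0].
  rewrite -lerBlDl; apply: slope_ge => t2 t20.
  rewrite lerBlDl -lerBlDr; apply: slope_ge => t1 t10; rewrite lerBlDr.
  apply: le_trans (slope_le y _ ps (addr_ge0 t10 t20)) _.
  rewrite real_scalarD scalerDl addrACA.
  by have := ps.1 (x1 + real_scalar k t1 *: y) (x2 + real_scalar k t2 *: y); lra.
rewrite mulrC -ler_pdivrMr//; apply: slope_ge => t t0; rewrite ler_pdivrMr//.
apply: le_trans (slope_le y _ ps (mulr_ge0 (ltW r0) t0)) _.
rewrite real_scalarM -scalerA -scalerDr sublinearZ ?(ltW r0)//; lra.
Qed.

Lemma slope_minorant p y x : sublinear p -> slope p y x <= p x.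
Proof.
by move=> ps; have := slope_le y x ps (lexx 0); rewrite real_scalar0 scale0r addr0 mul0r subr0.
Qed.

Lemma slope_opp p y : sublinear p -> slope p y (- y) <= - p y.
Proof.
move=> ps; have := slope_le y (- y) ps ler01.
by rewrite real_scalar1 scale1r addNr sublinear0// mul1r sub0r.
Qed.

(** Hahn--Banach without partially defined functionals. Zorn's lemma, applied
    with pointwise infima of chains, gives a minimal sublinear f below p.
    Minimality forces f <= slope f y, whence f (- y) <= - f y, for every y, and a
    sublinear function with this property is linear. *)
Lemma sublinear_linear_minorant p : sublinear p -> exists f : V -> R,
  [/\ forall x y, f (x + y) = f x + f y,
      forall r x, f (real_scalar k r *: x) = r * f x & forall x, f x <= p x].
Proof.
move=> ps; pose T := {q | sublinear q /\ forall x, q x <= p x}.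
pose le_op (q1 q2 : T) := `[< forall x, sval q2 x <= sval q1 x >].
have [||A Atot|[f [fs fp]] fmin] := @ZL_preorder T (exist _ p (conj ps (fun x => lexx (p x)))) le_op.
- by move=> q; apply/asboolP.
- move=> q1 q2 q3 /asboolP q12 /asboolP q23; apply/asboolP => x.
  exact: le_trans (q23 x) (q12 x).
- have [[q0 Aq0]|A0] := pselect (exists q, A q); last first.
    exists (exist _ p (conj ps (fun x => lexx (p x)))) => q Aq.
    by exfalso; apply: A0; exists q.
  pose m x := inf [set sval q x | q in A].
  have mlb x : has_lbound [set sval q x | q in A].
    exists (- p (- x)) => _ [[q [qs qp]] _ <-] /=.
    by apply: le_trans (sublinear_ge _ qs); rewrite lerN2.
  have m_le q x : A q -> m x <= sval q x by move=> Aq; apply: ge_inf; [exact: mlb|exists q].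
  have m_ge x c : (forall q : T, A q -> c <= sval q x) -> c <= m x.
    move=> H; apply: lb_le_inf => [|_ [q Aq <-]]; last exact: H.
    by exists (sval q0 x), q0.
  have ms : sublinear m.
    split=> [x y|r x r0].
      rewrite -lerBlDl; apply: (m_ge) => q Aq.
      rewrite lerBlDl -lerBlDr; apply: (m_ge) => q' Aq'; rewrite lerBlDr.
      have [/asboolP qq|/asboolP qq] := Atot _ _ Aq Aq'.
        apply: le_trans (m_le _ _ Aq') _; apply: le_trans ((svalP q').1.1 _ _) _.
        by rewrite lerD2l.
      apply: le_trans (m_le _ _ Aq) _; apply: le_trans ((svalP q).1.1 _ _) _.
      by rewrite lerD2r.
    rewrite mulrC -ler_pdivrMr//; apply: (m_ge) => q Aq; rewrite ler_pdivrMr//.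
    by rewrite mulrC; apply: le_trans (m_le _ _ Aq) _; exact: (svalP q).1.2.
  have mp x : m x <= p x by apply: le_trans (m_le q0 x Aq0) _; exact: (svalP q0).2.
  by exists (exist _ m (conj ms mp)) => q Aq; apply/asboolP => x; exact: m_le.
have fN y : f (- y) = - f y.
  have sp x : slope f y x <= p x by apply: le_trans (slope_minorant y x fs) _.
  have /asboolP/(_ (- y))/= := fmin (exist _ _ (conj (slope_sublinear y fs) sp))
    (asboolT (fun x => slope_minorant y x fs)).
  by have := slope_opp y fs; have := sublinear_ge (- y) fs; rewrite opprK; lra.
have fD x y : f (x + y) = f x + f y.
  apply/le_anti; rewrite fs.1 /=.
  by have := fs.1 (x + y) (- y); rewrite addrK fN; lra.
exists f; split => // r x; have [r0|r0] := leP 0 r; first exact: sublinearZ.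
have := @sublinearZ f (- r) x fs; rewrite oppr_ge0 => /(_ (ltW r0)).
have -> : real_scalar k (- r) = - real_scalar k r :> F.
  by apply/eqP; rewrite -subr_eq0 opprK -real_scalarD addNr real_scalar0.
by rewrite scaleNr fN mulNr => /oppr_inj.
Qed.

(** A linear minorant of slope nrm x0, rather than of the norm itself, satisfies
    f (- x0) <= - nrm x0. *)
Lemma real_norming_functional (x0 : V) : exists f : V -> R,
  [/\ forall x y, f (x + y) = f x + f y,
      forall r x, f (real_scalar k r *: x) = r * f x,
      forall x, `|f x| <= nrm x & nrm x0 <= f x0].
Proof.
have ns : sublinear (@nrm R k V).
  by split=> [x y|r x r0]; [exact: nrmD|rewrite nrmZ modulus_real_scalar// ltW].
have [f [fD fZ fn]] := sublinear_linear_minorant (slope_sublinear x0 ns).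
have f0 : f 0 = 0 by have := fD 0 0; rewrite addr0; lra.
have fN x : f (- x) = - f x by have := fD x (- x); rewrite subrr f0; lra.
have fle x : f x <= nrm x by apply: le_trans (fn x) (slope_minorant _ _ ns).
exists f; split=> // [x|].
  by rewrite ler_norml fle andbT; have := fle (- x); rewrite fN nrmN; lra.
by have := fn (- x0); have := slope_opp x0 ns; rewrite fN; lra.
Qed.

End HahnBanach.

(** In the complex case f x - i f (i x) is the complex linear functional with
    real part f. Dividing by its value at x0, whose modulus is at least nrm x0,
    normalizes it; the factor 2 bounds |f x| + |f (i x)|. *)
Lemma norming_functional (R : realType) (k : scalar_kind)
    (V : normedModType (Defs.scalar R k)) (x0 : V) : 0 < nrm x0 ->
  exists h : V -> Defs.scalar R k,
  [/\ forall a x y, h (a *: x + y) = a * h x + h y,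
      forall x, modulus (h x) <= 2 / nrm x0 * nrm x & h x0 = 1].
Proof.
move=> x00.
suff [h [hl hb hx0]] : exists h : V -> Defs.scalar R k,
  [/\ forall a x y, h (a *: x + y) = a * h x + h y,
      forall x, modulus (h x) <= 2 * nrm x & nrm x0 <= modulus (h x0)].
  have mx0 : 0 < modulus (h x0) by exact: lt_le_trans x00 hx0.
  have hx0' : h x0 != 0 by rewrite -modulus_eq0 gt_eqF.
  exists (fun x => (h x0)^-1 * h x); split=> [a x y|x|]; last by rewrite mulVf.
    by rewrite hl mulrDr mulrCA.
  have mV : modulus (h x0)^-1 * modulus (h x0) = 1 by rewrite -modulusM mulVf// modulus1.
  rewrite modulusM; have -> : modulus (h x0)^-1 = (modulus (h x0))^-1.
    by rewrite -[LHS](mulfK (lt0r_neq0 mx0)) mV mul1r.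
  rewrite ler_pdivrMl//; apply: le_trans (hb x) _.
  rewrite mulrA ler_wpM2r ?nrm_ge0// mulrCA -[leLHS]mulr1 ler_wpM2l// ler_pdivlMr// mul1r//.
have [f [fD fZ fn fx0]] := real_norming_functional x0.
case: k V x0 x00 f fD fZ fn fx0 => V x0 x00 f fD fZ fn fx0.
  exists f; split=> [a x y|x|]; first by rewrite fD (fZ a).
    by apply: le_trans (fn x) _; have := nrm_ge0 x; lra.
  exact: le_trans fx0 (ler_norm _).
pose i : R[i] := Complex 0 1.
exists (fun x => Complex (f x) (- f (i *: x)) : R[i]); split=> [a x y|x|].
- case: a => a b.
  have -> (z : V) : (Complex a b : R[i]) *: z = real_scalar ComplexScalars a *: z
      + real_scalar ComplexScalars b *: (i *: z).
    rewrite scalerA -scalerDl; congr (_ *: _); apply/eqP.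
    by rewrite eq_complex /=; apply/andP; split; apply/eqP; ring.
  rewrite !scalerDr !fD [i *: (_ *: x)]scalerA [i * _]mulrC -scalerA.
  rewrite [i *: (_ *: (i *: x))]scalerA [i * _]mulrC -scalerA [i *: (i *: x)]scalerA.
  have -> : i * i = real_scalar ComplexScalars (-1).
    by apply/eqP; rewrite eq_complex /=; apply/andP; split; apply/eqP; ring.
  rewrite !fZ; apply/eqP.
  by rewrite eq_complex /=; apply/andP; split; apply/eqP; ring.
- have ni : nrm (i *: x : V) = nrm x.
    by rewrite nrmZ /= expr0n expr1n add0r sqrtr1 mul1r.
  have := fn x; have := fn (i *: x); rewrite ni => f1 f2.
  have n0 := nrm_ge0 x.
  rewrite [modulus _]/= -[leRHS]ger0_norm ?mulr_ge0// -sqrtr_sqr ler_wsqrtr//.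
  rewrite sqrrN -(real_normK (num_real (f x))) -(real_normK (num_real (f (i *: x)))).
  have := normr_ge0 (f x); have := normr_ge0 (f (i *: x)); nra.
- apply: le_trans fx0 _; apply: le_trans (ler_norm _) _.
  by rewrite /= -sqrtr_sqr ler_wsqrtr// lerDl sqr_ge0.
Qed.

(** * Automorphisms near the identity *)

Section Perturbation.
Variables (R : realType) (k : scalar_kind).
Local Notation F := (Defs.scalar R k).
Variable V : normedModType F.
Hypothesis Vcomplete : complete_nrm V.

Lemma linear_of (f : V -> V) : (forall a u v, f (a *: u + v) = a *: f u + f v) ->
  exists g : {linear V -> V}, g =1 f.
Proof.
move=> fl; pose m := GRing.isLinear.Build F V V *:%R f fl.
pose g : {linear V -> V} := HB.pack f m.
by exists g.
Qed.

(** Neumann: the equation u = z - K u is solved by iteration, since consecutive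
    iterates approach each other by a factor 2. So 1 + K is bijective, and it
    changes norms by a factor of at most 2. *)
Lemma small_perturbation_automorphism (K : V -> V) :
  (forall a u v, K (a *: u + v) = a *: K u + K v) ->
  (forall v, nrm (K v) <= nrm v / 2) ->
  exists S S' : {linear V -> V},
    [/\ cancel S S', cancel S' S, continuous S, continuous S' & forall v, S' v = v + K v].
Proof.
move=> Kl Kb.
have K0 : K 0 = 0 by apply/eqP; rewrite -nrm_eq0 eq_le nrm_ge0 andbT; have := Kb 0; rewrite nrm0 mul0r.
have KN v : K (- v) = - K v by have := Kl (-1) v 0; rewrite addr0 K0 addr0 !scaleN1r.
have KB u v : K (u - v) = K u - K v.
  by have := Kl 1 u (- v); rewrite !scale1r KN.
have [S' S'E] : exists S' : {linear V -> V}, S' =1 fun v => v + K v.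
  by apply: linear_of => a u v; rewrite Kl scalerDr addrACA.
have S'ge v : nrm v / 2 <= nrm (S' v).
  by rewrite S'E; have := nrm_le_dist v (v + K v); rewrite opprD addNKr nrmN; have := Kb v; lra.
have S'inj : injective S'.
  move=> u v uv; apply/eqP; rewrite -subr_eq0 -nrm_eq0 eq_le nrm_ge0 andbT.
  by have := S'ge (u - v); rewrite linearB uv subrr nrm0; lra.
have /choice[S0 S0E] z : exists u, S' u = z.
  pose u := fix u n := if n is n'.+1 then z - K (u n') else z.
  have ustep n : nrm (u n.+1 - u n) <= nrm (u 1%N - u 0%N) * (1/2) ^+ n.
    elim: n => [|n IH]; first by rewrite expr0 mulr1.
    have -> : u n.+2 - u n.+1 = - K (u n.+1 - u n).
      by rewrite KB /= [z - _]addrC addrKA opprB opprK addrC.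
    by rewrite nrmN; apply: le_trans (Kb _) _; rewrite exprS; move: IH; lra.
  have [l Hl] := Vcomplete ustep; have ul := geometric_cvg Hl.
  exists l; rewrite S'E.
  suff e : l = z - K l by rewrite [X in X + _]e subrK.
  apply: (nrm_cvg_unique ul); apply/cvg_nrmP => e e0.
  have [N HN] := geometric_small (2 * nrm (u 1%N - u 0%N)) e0.
  exists N.+1 => -[//|n] Nn /=.
  have -> : z - K (u n) - (z - K l) = - K (u n - l).
    by rewrite KB [z - _]addrC addrKA opprB opprK addrC.
  rewrite nrmN; apply: le_lt_trans (Kb _) _; have := Hl n; have := HN n Nn.
  have := nrm_ge0 (u n - l); lra.
have S0l a u v : S0 (a *: u + v) = a *: S0 u + S0 v.
  by apply: S'inj; rewrite linearP !S0E.
have [S SE] := linear_of S0l.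
exists S, S'; split=> //.
- by move=> v; rewrite SE S0E.
- by move=> v; apply: S'inj; rewrite SE S0E.
- apply: (@linear_bounded_continuous_nrm _ _ _ _ _ 2) => v; rewrite SE.
  by have := S'ge (S0 v); rewrite S0E; lra.
- apply: (@linear_bounded_continuous_nrm _ _ _ _ _ 2) => v; rewrite S'E.
  by apply: le_trans (nrmD _ _) _; have := Kb v; have := nrm_ge0 v; lra.
Qed.

(** Principle of small perturbations: K v, the sum of the h n v (x n - y n), has
    norm at most nrm v / 2, and 1 + K sends y n to x n. *)
Lemma congruent_perturbation (x y : nat -> V) (h : nat -> V -> F) :
  (forall n a u v, h n (a *: u + v) = a * h n u + h n v) ->
  (forall n v, modulus (h n v) * nrm (x n - y n) <= nrm v / 4 * (1/2) ^+ n) ->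
  (forall n m, h n (y m) = (n == m)%:R) ->
  congruent_sequences x y.
Proof.
move=> hl hb hy.
pose P v n := \sum_(0 <= i < n) h i v *: (x i - y i).
have Pstep v n : nrm (P v n.+1 - P v n) <= nrm v / 4 * (1/2) ^+ n.
  by rewrite /P big_nat_recr//= [X in X - _]addrC addrK nrmZ.
have /choice[K HK] v : exists l, forall n, nrm (P v n - l) <= 2 * (nrm v / 4) * (1/2) ^+ n.
  exact: Vcomplete.
have PK v : P v @ \oo --> K v by apply: geometric_cvg (HK v).
have Kl a u v : K (a *: u + v) = a *: K u + K v.
  apply: nrm_cvg_unique (PK _) _.
  have -> : P (a *: u + v) = a *: P u + P v.
    apply/funext => n; transitivity (a *: P u n + P v n) => //.
    rewrite /P scaler_sumr -big_split/=; apply: eq_bigr => i _.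
    by rewrite hl scalerDl scalerA.
  by apply: cvgD (PK v); apply: cvgZr; exact: PK.
have Kb v : nrm (K v) <= nrm v / 2.
  by have := HK v 0%N; rewrite /P big_geq// sub0r nrmN expr0; lra.
have [S [S' [SS' S'S Sc S'c S'E]]] := small_perturbation_automorphism Kl Kb.
exists S, S'; split=> // n.
suff -> : x n = S' (y n) by rewrite S'S.
rewrite S'E; suff -> : K (y n) = x n - y n by rewrite addrC subrK.
apply: nrm_cvg_unique (PK _) _; apply/cvg_nrmP => e e0; exists n.+1 => m nm.
rewrite /P (bigD1_seq n) ?iota_uniq ?mem_index_iota//= hy eqxx scale1r.
rewrite big1 ?addr0 ?subrr ?nrm0// => i ni.
by rewrite hy (negbTE ni) scale0r.
Qed.

End Perturbation.

(** * Scalar-valued measurable functions *)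

Section ScalarFunctions.
Variables (R : realType) (k : scalar_kind).
Local Notation F := (Defs.scalar R k).

Lemma nrm_scalar (x : F^o) : nrm x = modulus (x : F).
Proof. by apply: (@real_scalar_inj R k); rewrite nrmE real_scalar_modulus. Qed.

Lemma modulusN (x : F) : modulus (- x) = modulus x.
Proof. by rewrite -!nrm_scalar; exact: (nrmN (x : F^o)). Qed.

Lemma modulus_distC (x y : F) : modulus (x - y) = modulus (y - x).
Proof. by rewrite -modulusN opprB. Qed.

Lemma modulus_le_dist (x y : F) : modulus x <= modulus y + modulus (x - y).
Proof. by have := modulusD y (x - y); rewrite addrC subrK. Qed.

Lemma complete_nrm_scalar : complete_nrm (F^o : normedModType F).
Proof.
move=> c z zc; have [n|l Hl] := @scalar_geometric_complete R k c z.
  by rewrite -nrm_scalar; exact: zc.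
exists l; apply: geometric_limit => //.
by apply: (@geometric_cvg _ _ _ (4 * c)) => n; rewrite nrm_scalar; exact: Hl.
Qed.

Lemma scalar_summable (z : nat -> F) :
  (\sum_(0 <= i <oo) (modulus (z i.+1 - z i))%:E < +oo)%E ->
  exists2 l : F^o, (z : nat -> F^o) @ \oo --> l &
  forall n, ((modulus (z n - l))%:E <= \sum_(n <= i <oo) (modulus (z i.+1 - z i))%:E)%E.
Proof.
move=> zs; pose g i := (modulus (z i.+1 - z i))%:E.
have g0 i : (0 <= g i)%E by rewrite lee_fin modulus_ge0.
have zn n m : (n <= m)%N -> ((modulus (z m - z n))%:E <= \sum_(n <= i <oo) g i)%E.
  move=> nm; apply: le_trans (@nneseries_lim_ge R g xpredT n m (fun i _ _ => g0 i)).
  rewrite -(subnKC nm); elim: (m - n)%N => [|j IH].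
    by rewrite addn0 subrr modulus0 big_geq.
  rewrite addnS big_nat_recr ?leq_addr//=; apply: le_trans (leeD2r _ IH).
  rewrite /g -EFinD lee_fin [leRHS]addrC.
  by have := modulusD (z (n + j).+1 - z (n + j)%N) (z (n + j)%N - z n); rewrite subrKA.
have [e e0|l zl] := @complete_nrm_cauchy R k (F^o : normedModType F) z complete_nrm_scalar.
  have e20 : (0 < (e / 2)%:E :> \bar R)%E by rewrite lte_fin divr_gt0.
  have := @nneseries_tail_cvg R g xpredT zs (fun i _ => g0 i).
  move=> /fine_cvgP[[N1 _ HN1]] /cvgrPdist_lt /(_ (e / 2)); rewrite divr_gt0//.
  move=> /(_ isT)[N2 _ HN2]; pose N := maxn N1 N2.
  have Nsmall : (\sum_(N <= i <oo) g i < (e / 2)%:E)%E.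
    have := HN2 N (leq_maxr _ _); have := HN1 N (leq_maxl _ _) => /= /fineK <-.
    by rewrite sub0r normrN lte_fin; apply: le_lt_trans; exact: ler_norm.
  exists N => m n Nm Nn; rewrite nrm_scalar.
  have := le_lt_trans (zn _ _ Nm) Nsmall; have := le_lt_trans (zn _ _ Nn) Nsmall.
  rewrite !lte_fin => h1 h2.
  have := modulusD (z m - z N) (z N - z n); rewrite subrKA (modulus_distC (z N)); lra.
exists l => // n; have [s|soo] := ltP (\sum_(n <= i <oo) g i)%E +oo%E; last first.
  by apply: le_trans soo; rewrite leey.
have sfin : (\sum_(n <= i <oo) g i)%E \is a fin_num.
  by rewrite ge0_fin_numE// nneseries_ge0.
rewrite -(fineK sfin) lee_fin modulus_distC -nrm_scalar.
apply: (nrm_cvg_le (N := n) zl) => m nm.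
by rewrite nrm_scalar -lee_fin fineK//; exact: zn.
Qed.

Lemma real_rounding (e : R) : 0 < e -> exists q : R -> R,
  [/\ forall x, `|q x - x| <= e / 2,
      forall M, finite_set (q @` [set x | `|x| <= M]) & measurable_fun setT q].
Proof.
move=> e0.
pose a := e / 2; have a0 : 0 < a by rewrite divr_gt0.
exists (fun x => a * (Num.floor (x / a))%:~R); split.
- move=> x; have /andP[] := floor_itv (x / a).
  rewrite ler_pdivlMr// ltr_pdivrMr// intrD mulrDl mul1r (mulrC _ a) => h1 h2.
  by rewrite ler_norml -/a; apply/andP; split; lra.
- move=> M; pose N := (Num.truncn (M / a + 1)).+1.
  have MN : M / a + 1 < N%:R by exact: truncnS_gt.
  apply: (@sub_finite_set _ _ ((fun i : nat => a * (i%:R - N%:R)) @` `I_(N + N)%N)).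
    move=> _ [x /= xM <-].
    have xa : `|x / a| <= M / a by rewrite normrM normfV (gtr0_norm a0) ler_wpM2r// invr_ge0 ltW.
    have /andP[f1 f2] := floor_itv (x / a); move: xa; rewrite ler_norml => /andP[g1 g2].
    rewrite intrD in f2.
    have f3 : - (N%:R) <= (Num.floor (x / a))%:~R :> R by lra.
    have f4 : (Num.floor (x / a))%:~R < N%:R :> R by lra.
    have f3' : (- (N%:Z) <= Num.floor (x / a))%R.
      by rewrite -(ler_int R) intrN.
    have f4' : (Num.floor (x / a) < N%:Z)%R by rewrite -(ltr_int R).
    have [i iE] : exists i : nat, Num.floor (x / a) + N%:Z = i%:Z.
      exists (absz (Num.floor (x / a) + N%:Z)); rewrite gez0_abs//.
      by move: f3'; rewrite lerNl; lia.
    exists i => /=.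
      by have : (i%:Z < (N + N)%N%:Z)%R by rewrite -iE; lia.
    congr (a * _); have := congr1 (fun z : int => z%:~R : R) iE.
    by rewrite intrD -!pmulrn => <-; rewrite addrK.
  by apply: finite_image; exact: finite_II.
- apply: measurable_funM => //; apply: nondecreasing_measurable => // x y xy.
  by rewrite ler_int; apply: le_floor; rewrite ler_wpM2r// invr_ge0 ltW.
Qed.

(** Each real coordinate is rounded down to a grid of mesh e / 2. *)
Lemma scalar_rounding (e : R) : 0 < e -> exists r : F -> F,
  [/\ forall x, modulus (r x - x) <= e,
      forall M, finite_set (r @` [set x | modulus x <= M]) &
      forall d (T : measurableType d) (f : T -> F),
        scalar_measurable f -> scalar_measurable (r \o f)].
Proof.
move=> e0.
have [q [qx qfin qm]] := real_rounding e0.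
case: (k) => /=.
  exists q; split => [x|M|d T f mf]; last exact: measurableT_comp.
    by apply: le_trans (qx x) _; lra.
  exact: qfin.
exists (fun z : R[i] => Complex (q (complex.Re z)) (q (complex.Im z))); split.
- move=> [a b] /=; have h1 := qx a; have h2 := qx b.
  rewrite -[leRHS]ger0_norm ?(ltW e0)// -[leRHS]sqrtr_sqr ler_wsqrtr//.
  rewrite -(real_normK (num_real (q a - a))) -(real_normK (num_real (q b - b))).
  have := normr_ge0 (q a - a); have := normr_ge0 (q b - b); nra.
- move=> M; apply: (@sub_finite_set _ _ ((fun p : R * R => Complex p.1 p.2) @`
    ((q @` [set x | `|x| <= M]) `*` (q @` [set x | `|x| <= M])))).
    move=> _ [[a b] /= abM <-]; exists (q a, q b) => //; split; [exists a|exists b] => //=.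
      by apply: le_trans abM; rewrite -sqrtr_sqr ler_wsqrtr// lerDl sqr_ge0.
    by apply: le_trans abM; rewrite -sqrtr_sqr ler_wsqrtr// lerDr sqr_ge0.
  by apply: finite_image; apply: finite_setX; exact: qfin.
- by move=> d T f [mf mf']; split; exact: measurableT_comp.
Qed.

Section Measurability.
Context d (T : measurableType d).
Implicit Types f g : T -> F.

Lemma scalar_measurable_if (A : set T) f : measurable A -> scalar_measurable f ->
  scalar_measurable (fun w => if w \in A then f w else 0 : F).
Proof.
move=> mA; have mA' : measurable_fun setT (fun w => w \in A).
  apply: (measurable_fun_bool true); rewrite setTI (_ : _ @^-1` _ = A)//.
  by apply/seteqP; split => w /=; [move=> /set_mem|move=> /mem_set].
case: (k) f => /= f; first by move=> mf; exact: measurable_fun_ifT.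
move=> [mf mf']; split.
  rewrite (_ : (fun w => _) = fun w => if w \in A then complex.Re (f w) else 0).
    exact: measurable_fun_ifT.
  by apply/funext => w; case: ifP.
rewrite (_ : (fun w => _) = fun w => if w \in A then complex.Im (f w) else 0).
  exact: measurable_fun_ifT.
by apply/funext => w; case: ifP.
Qed.

Lemma scalar_measurableM f g : scalar_measurable f -> scalar_measurable g ->
  scalar_measurable (fun w => f w * g w).
Proof.
case: (k) f g => /= f g; first by move=> mf mg; exact: measurable_funM.
move=> [mf mf'] [mg mg']; split.
  rewrite (_ : (fun w => _) = fun w => complex.Re (f w) * complex.Re (g w) -
     complex.Im (f w) * complex.Im (g w)).
    by apply: measurable_funB; exact: measurable_funM.
  by apply/funext => w; case: (f w) (g w) => [? ?] [? ?].
rewrite (_ : (fun w => _) = fun w => complex.Re (f w) * complex.Im (g w) +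
     complex.Im (f w) * complex.Re (g w)).
  by apply: measurable_funD; exact: measurable_funM.
by apply/funext => w; case: (f w) (g w) => [? ?] [? ?].
Qed.

Lemma scalar_measurable_real (g : T -> R) : measurable_fun setT g ->
  scalar_measurable (fun w => real_scalar k (g w)).
Proof. by case: (k) => //= mg; split. Qed.

Lemma scalar_measurableB f g : scalar_measurable f -> scalar_measurable g ->
  scalar_measurable (fun w => f w - g w).
Proof.
move=> mf mg; have := scalar_measurable_lin (-1) mg mf.
by rewrite (_ : (fun w => _) = fun w => f w - g w)//; apply/funext => w; rewrite mulN1r addrC.
Qed.

Lemma scalar_measurable_cvg (v : nat -> T -> F) (l : T -> F) :
  (forall n, scalar_measurable (v n)) ->
  (forall w, ((fun n => v n w) : nat -> F^o) @ \oo --> (l w : F^o)) ->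
  scalar_measurable l.
Proof.
move=> mv vl.
have {}vl w e : 0 < e -> exists N, forall n, (N <= n)%N -> modulus (v n w - l w) < e.
  move=> e0; have /cvg_nrmP /(_ e e0)[N HN] := vl w.
  by exists N => n /HN; rewrite nrm_scalar.
case: (k) v l mv vl => /= v l mv vl.
  apply: (@measurable_fun_cvg _ _ _ _ v) => // w _; apply/cvgrPdist_lt => e e0.
  have [N HN] := vl w e e0; exists N => // n /= /HN.
  by rewrite distrC.
split.
  apply: (@measurable_fun_cvg _ _ _ _ (fun n w => complex.Re (v n w))) => [n|w _]; first exact: (mv n).1.
  apply/cvgrPdist_lt => e e0; have [N HN] := vl w e e0; exists N => // n /= /HN.
  apply: le_lt_trans; case: (v n w) (l w) => a b [a' b'] /=.
  by rewrite distrC -sqrtr_sqr ler_wsqrtr// lerDl sqr_ge0.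
apply: (@measurable_fun_cvg _ _ _ _ (fun n w => complex.Im (v n w))) => [n|w _]; first exact: (mv n).2.
apply/cvgrPdist_lt => e e0; have [N HN] := vl w e e0; exists N => // n /= /HN.
apply: le_lt_trans; case: (v n w) (l w) => a b [a' b'] /=.
by rewrite distrC -sqrtr_sqr ler_wsqrtr// lerDr sqr_ge0.
Qed.

End Measurability.

End ScalarFunctions.

(** * Rademacher type 2 *)

Section TypeTwo.
Variables (R : realType) (k : scalar_kind).
Local Notation F := (Defs.scalar R k).

Lemma real_scalar_nat n : real_scalar k (n%:R : R) = n%:R :> F.
Proof.
elim: n => [|n IH]; first by rewrite real_scalar0.
by rewrite -addn1 !natrD real_scalarD IH real_scalar1.
Qed.

Lemma real_scalar_sum (I : Type) (r : seq I) (f : I -> R) :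
  real_scalar k (\sum_(i <- r) f i) = \sum_(i <- r) real_scalar k (f i) :> F.
Proof.
elim: r => [|i r IH]; first by rewrite !big_nil real_scalar0.
by rewrite !big_cons real_scalarD IH.
Qed.

Lemma modulus_sign (b : bool) : modulus ((-1) ^+ b : F) = 1.
Proof.
by case: b; rewrite ?expr1 ?expr0 ?modulus1// -(modulus1 R k) -!nrm_scalar; exact: (nrmN (1 : F^o)).
Qed.

(** An average dominates one of its terms. *)
Lemma type2_signs (V : normedModType F) : rademacher_type2 V -> exists2 C : R, 0 <= C &
  forall n (x : nat -> V), exists e : nat -> bool,
    nrm (\sum_(0 <= i < n) (-1) ^+ e i *: x i) ^+ 2 <= C * \sum_(0 <= i < n) nrm (x i) ^+ 2.
Proof.
move=> [C0 C00 type2].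
have C0E : C0 = real_scalar k (modulus C0) by rewrite real_scalar_modulus ger0_norm.
exists (modulus C0 ^+ 2) => [|n x]; first exact: sqr_ge0.
pose B := modulus C0 ^+ 2 * \sum_(i < n) nrm (x i) ^+ 2.
pose S (e : {ffun 'I_n -> bool}) := nrm (\sum_(i < n) (-1) ^+ e i *: x i) ^+ 2.
have [e He] : exists e, S e <= B.
  apply: contrapT => H.
  have {}H e : B < S e by rewrite ltNge; apply/negP => Se; apply: H; exists e.
  have := type2 n (fun i => x i).
  have -> : C0 ^+ 2 * \sum_(i < n) `|x i| ^+ 2 = real_scalar k B.
    rewrite {1}C0E /B !real_scalarM real_scalar_sum; congr (_ * _ * _).
    by apply: eq_bigr => i _; rewrite -nrmE !expr2 real_scalarM.
  have -> : \sum_(e : {ffun 'I_n -> bool}) `|\sum_(i < n) (-1) ^+ e i *: x i| ^+ 2 =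
      real_scalar k (\sum_(e : {ffun 'I_n -> bool}) S e).
    by rewrite real_scalar_sum; apply: eq_bigr => e _; rewrite -nrmE /S !expr2 real_scalarM.
  have -> : (2 ^+ n)^-1 = real_scalar k ((2 ^+ n)^-1) :> F.
    have n0 : (2 ^+ n : R) != 0 by rewrite expf_neq0.
    have := real_scalarVK k n0; have -> : real_scalar k (2 ^+ n : R) = 2 ^+ n :> F.
      by rewrite -!natrX real_scalar_nat.
    have F0 : (2 ^+ n : F) != 0 by rewrite expf_neq0// pnatr_eq0.
    by move=> h; apply: (mulIf F0); rewrite h mulVf.
  rewrite -real_scalarM ler_real_scalar ler_pdivrMl ?exprn_gt0//; apply/negP; rewrite -ltNge.
  have -> : 2 ^+ n * B = \sum_(e : {ffun 'I_n -> bool}) B.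
    by rewrite sumr_const card_ffun card_bool card_ord -[RHS]mulr_natl natrX.
  apply: ltr_sum => //; apply/hasP; by exists [ffun=> true].
exists (fun i => if insub i is Some j then e j else false).
rewrite !big_mkord; apply: le_trans He; rewrite le_eqVlt; apply/orP; left; apply/eqP.
rewrite /S; congr (nrm _ ^+ 2); apply: eq_bigr => i _; congr (_ *: _); congr (_ ^+ _).
by rewrite valK.
Qed.

End TypeTwo.

(** * Functions and norms in L_rho *)

Section LrhoBasics.
Context d (T : measurableType d) (R : realType) (k : scalar_kind).
Variables (mu : {measure set T -> \bar R}) (rho : function_norm mu).
Local Notation F := (Defs.scalar R k).
Local Notation L := (Lrho k rho).

(** The representative picked by the quotient: identities between such functions
    hold almost everywhere only. *)
Definition lf (f : L) : T -> F := L0_fun (Lrho_val f).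

Implicit Types f g : L.

Lemma lf_measurable f : scalar_measurable (lf f).
Proof. exact: smf_measurable. Qed.

Lemma L0plus_modulus (f : T -> F) : scalar_measurable f ->
  L0plus (fun w => (modulus (f w))%:E).
Proof.
move=> mf; split=> [|w]; last by rewrite lee_fin modulus_ge0.
by apply/measurable_EFinP; exact: measurable_modulus.
Qed.

Lemma nrm_rho f : (nrm f)%:E = rho (fun w => (modulus (lf f w))%:E).
Proof.
have -> : nrm f = fine (rho_norm rho (Lrho_val f)).
  apply: (@real_scalar_inj R k); rewrite nrmE; exact: Lrho_normE.
by rewrite fineK//; exact: (@fns_fin_num R k _ (rho_extended_norm k rho) f).
Qed.

Lemma nrm_le_rho f (u : T -> \bar R) : L0plus u ->
  {ae mu, forall w, ((modulus (lf f w))%:E <= u w)%E} -> ((nrm f)%:E <= rho u)%E.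
Proof.
by move=> pu fu; rewrite nrm_rho; apply: fn_le => //; apply: L0plus_modulus; exact: lf_measurable.
Qed.

Lemma rho_le_nrm (u : T -> \bar R) f : L0plus u ->
  {ae mu, forall w, (u w <= (modulus (lf f w))%:E)%E} -> (rho u <= (nrm f)%:E)%E.
Proof.
by move=> pu fu; rewrite nrm_rho; apply: fn_le => //; apply: L0plus_modulus; exact: lf_measurable.
Qed.

Lemma nrm_le_ae f g : {ae mu, forall w, modulus (lf f w) <= modulus (lf g w)} ->
  nrm f <= nrm g.
Proof.
move=> fg; rewrite -lee_fin (nrm_rho g); apply: nrm_le_rho.
  by apply: L0plus_modulus; exact: lf_measurable.
by apply: filterS fg => w; rewrite lee_fin.
Qed.

Lemma lfD f g : {ae mu, forall w, lf (f + g) w = lf f w + lf g w}.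
Proof. exact: L0_funD. Qed.

Lemma lfZ (a : F) f : {ae mu, forall w, lf (a *: f) w = a * lf f w}.
Proof. exact: L0_funZ. Qed.

Lemma lfB f g : {ae mu, forall w, lf (f - g) w = lf f w - lf g w}.
Proof.
rewrite -scaleN1r; apply: filterS2 (lfD f (-1 *: g)) (lfZ (-1) g) => w -> ->.
by rewrite mulN1r.
Qed.

Lemma lf0 : {ae mu, forall w, lf 0 w = 0}.
Proof.
by have := lfZ 0 0; rewrite scale0r; apply: filterS => w ->; rewrite mul0r.
Qed.

Lemma lf_sum (I : Type) (r : seq I) (f : I -> L) :
  {ae mu, forall w, lf (\sum_(i <- r) f i) w = \sum_(i <- r) lf (f i) w}.
Proof.
elim: r => [|i r IH].
  by rewrite big_nil; apply: filterS lf0 => w ->; rewrite big_nil.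
rewrite big_cons; apply: filterS2 (lfD (f i) (\sum_(j <- r) f j)) IH => w -> ->.
by rewrite big_cons.
Qed.

Lemma lf_inj f g : {ae mu, forall w, lf f w = lf g w} -> f = g.
Proof.
move=> fg; apply: val_inj => /=; rewrite -[fns_val f]L0_mfunK -[fns_val g]L0_mfunK.
exact/L0_classP.
Qed.

Lemma Lrho_exists (u : T -> F) : scalar_measurable u ->
  (rho (fun w => (modulus (u w))%:E) < +oo)%E ->
  exists f : L, {ae mu, forall w, lf f w = u w}.
Proof.
move=> mu_ ufin; have uM : (u : T -> F^o) \in @scalar_mfun_pred d T R k by exact: asboolT.
pose h := L0_class mu (ScalarMfun uM).
have hE : {ae mu, forall w, L0_fun h w = u w} by exact: L0_mfun_class.
have hfin : h \in enorm_finite (rho_extended_norm k rho).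
  rewrite inE /=; apply: le_lt_trans ufin; apply: fn_le; first exact: L0_abs_plus.
    exact: L0plus_modulus.
  by apply: filterS hE => w; rewrite /L0_abs => ->.
by exists (FiniteNorm hfin).
Qed.

Lemma Lrho_simple_class f (s : T -> F) : scalar_measurable s -> finite_set (range s) ->
  {ae mu, forall w, lf f w = s w} -> simple_class (Lrho_val f).
Proof.
move=> ms sfin fs; have sM : (s : T -> F^o) \in @scalar_mfun_pred d T R k by exact: asboolT.
exists (ScalarMfun sM) => //; rewrite -[Lrho_val f]L0_mfunK; exact/L0_classP.
Qed.

Lemma multiplier_exists (u : T -> F) f : scalar_measurable u ->
  (forall w, modulus (u w) <= 1) ->
  exists g, {ae mu, forall w, lf g w = u w * lf f w}.
Proof.
move=> mu_ u1; apply: Lrho_exists; first exact: scalar_measurableM (lf_measurable f).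
apply: le_lt_trans (rho_le_nrm (f := f) _ _) (ltry _).
  by apply: L0plus_modulus; exact: scalar_measurableM (lf_measurable f).
by apply: aeW => w; rewrite lee_fin modulusM ler_piMl ?modulus_ge0.
Qed.

Lemma restr_exists : exists r : set T -> L -> L, forall A f, measurable A ->
  {ae mu, forall w, lf (r A f) w = if w \in A then lf f w else 0}.
Proof.
suff /choice[r Hr] : forall Af : set T * L, exists g, measurable Af.1 ->
    {ae mu, forall w, lf g w = if w \in Af.1 then lf Af.2 w else 0}.
  by exists (fun A f => r (A, f)) => A f; exact: (Hr (A, f)).
move=> [A f] /=; have [mA|nA] := pselect (measurable A); last by exists 0.
have [||g Hg] := @multiplier_exists (fun w => if w \in A then 1 else 0) f.
- have := @scalar_measurable_if R k d T A (fun=> 1) mA; apply.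
  by rewrite -(real_scalar1 R k); apply: scalar_measurable_real; exact: measurable_cst.
- by move=> w; case: ifP => _; rewrite ?modulus0 ?modulus1.
exists g => _; apply: filterS Hg => w ->.
by case: ifP => _; rewrite ?mul1r ?mul0r.
Qed.

(** Multiplication by the indicator function of A, as an operator on classes. *)
Definition restr := sval (cid restr_exists).

Lemma restrE A f : measurable A ->
  {ae mu, forall w, lf (restr A f) w = if w \in A then lf f w else 0}.
Proof. exact: (svalP (cid restr_exists)). Qed.

Lemma restr_linear A a f g : measurable A ->
  restr A (a *: f + g) = a *: restr A f + restr A g.
Proof.
move=> mA; apply: lf_inj.
have h1 := restrE (a *: f + g) mA; have h2 := restrE f mA; have h3 := restrE g mA.
have h4 := lfD (a *: f) g; have h5 := lfD (a *: restr A f) (restr A g).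
have h6 := lfZ a f; have h7 := lfZ a (restr A f).
near=> w.
rewrite (near h5 w)// (near h7 w)// (near h1 w)// (near h2 w)// (near h3 w)//.
by case: ifP => _; rewrite ?mulr0 ?addr0// (near h4 w)// (near h6 w).
Unshelve. all: by end_near. Qed.

(** * Completeness of L_rho *)

Hypothesis mu_fin : (mu setT < +oo)%E.

Lemma L0plus_sum (u : nat -> T -> \bar R) m n : (forall i, L0plus (u i)) ->
  L0plus (fun w => \sum_(m <= i < n) u i w)%E.
Proof.
move=> pu; split=> [|w]; last by apply: sume_ge0 => i _; exact: (pu i).2.
by apply: emeasurable_sum => i; exact: (pu i).1.
Qed.

Lemma L0plus_series (u : nat -> T -> \bar R) m : (forall i, L0plus (u i)) ->
  L0plus (fun w => \sum_(m <= i <oo) u i w)%E.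
Proof.
move=> pu; split=> [|w]; last by apply: nneseries_ge0 => i _ _; exact: (pu i).2.
rewrite (_ : (fun w => _) = fun w => (\sum_(i <oo | i \in [pred i | (m <= i)%N]) u i w)%E).
  by apply: ge0_emeasurable_sum => [i w _ _|i _]; [exact: (pu i).2|exact: (pu i).1].
by apply/funext => w; rewrite eseries_cond.
Qed.

Lemma rho0 : rho (fun=> 0%E) = 0%E.
Proof.
apply/fn_eq0; first by split=> //; exact: measurable_cst.
exact: aeW.
Qed.

Lemma rho_sum (u : nat -> T -> \bar R) m n : (forall i, L0plus (u i)) ->
  (rho (fun w => \sum_(m <= i < n) u i w) <= \sum_(m <= i < n) rho (u i))%E.
Proof.
move=> pu; have [nm|/ltnW mn] := leqP n m.
  rewrite big_geq// (_ : (fun w => _) = (fun=> 0%E)) ?rho0//.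
  by apply/funext => w; rewrite big_geq.
rewrite -(subnKC mn); elim: (n - m)%N => [|j IH].
  rewrite addn0 big_geq// (_ : (fun w => _) = (fun=> 0%E)) ?rho0//.
  by apply/funext => w; rewrite big_geq.
rewrite addnS big_nat_recr ?leq_addr//=; apply: le_trans (leeD2r _ IH).
rewrite (_ : (fun w => _) = (fun w => \sum_(m <= i < m + j) u i w)%E \+ u (m + j)%N)%E.
  by apply: fn_add => //; exact: L0plus_sum.
by apply/funext => w; rewrite big_nat_recr ?leq_addr.
Qed.

(** Monotone convergence for rho turns subadditivity into countable
    subadditivity. *)
Lemma rho_series (u : nat -> T -> \bar R) m (M : \bar R) : (forall i, L0plus (u i)) ->
  (forall n, \sum_(m <= i < n) rho (u i) <= M)%E ->
  (rho (fun w => \sum_(m <= i <oo) u i w) <= M)%E.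
Proof.
move=> pu uM.
have cv : (fun n => rho (fun w => \sum_(m <= i < n) u i w)%E) @ \oo -->
    rho (fun w => \sum_(m <= i <oo) u i w)%E.
  apply: fn_monotone => [n||n|].
  - exact: L0plus_sum.
  - exact: L0plus_series.
  - apply: aeW => w; have [nm|mn] := ltnP n m; first by rewrite !big_geq// ltnW.
    by rewrite big_nat_recr//= leeDl// (pu _).2.
  - by apply: aeW => w; apply: is_cvg_nneseries => i _ _; exact: (pu i).2.
rewrite -(cvg_lim _ cv)//; apply: lime_le; first by apply/cvg_ex; eexists; exact: cv.
by apply: nearW => n; apply: le_trans (rho_sum _ _ pu) (uM n).
Qed.

(** By [fn_integral] on the whole space, u is integrable. *)
Lemma rho_fin_ae (u : T -> \bar R) : L0plus u -> (rho u < +oo)%E ->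
  {ae mu, forall w, (u w < +oo)%E}.
Proof.
move=> pu ufin; have [C HC] := fn_integral rho measurableT mu_fin.
have u_int : mu.-integrable setT u.
  apply/integrableP; split; first exact: pu.1.
  under eq_integral do rewrite gee0_abs ?pu.2//.
  apply: le_lt_trans (HC u pu) _.
  have : rho u \is a fin_num by rewrite ge0_fin_numE// fn_ge0.
  by move=> /fineK <-; rewrite -EFinM ltry.
apply: filterS (integrable_ae measurableT u_int) => w /(_ I).
by rewrite ge0_fin_numE// pu.2.
Qed.

Lemma sum_half_le (c : R) m n : 0 <= c ->
  (\sum_(m <= i < n) (c * (1/2) ^+ i)%:E <= (2 * c * (1/2) ^+ m)%:E :> \bar R)%E.
Proof.
move=> c0; have h0 i : 0 <= c * (1/2) ^+ i :> R by rewrite mulr_ge0// exprn_ge0//; lra.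
have [nm|/ltnW mn] := leqP n m; first by rewrite big_geq// lee_fin; have := h0 m; lra.
rewrite sumEFin lee_fin -(subnKC mn).
suff -> : \sum_(m <= i < m + (n - m)) c * (1/2) ^+ i =
   2 * c * (1/2) ^+ m - 2 * c * (1/2) ^+ (m + (n - m)) :> R.
  by have := h0 (m + (n - m))%N; lra.
elim: (n - m)%N => [|j IH]; first by rewrite addn0 big_geq// subrr.
rewrite addnS big_nat_recr ?leq_addr//= IH exprS; lra.
Qed.

(** Riesz--Fischer. The series G 0 of the moduli of the increments has finite
    rho, so it is finite almost everywhere. There u n converges pointwise, and the
    tail G n dominates the distance from u n to the limit. *)
Lemma Lrho_complete : complete_nrm L.
Proof.
move=> c u uc.
have c0 : 0 <= c by have := uc 0%N; rewrite expr0 mulr1; exact: le_trans (nrm_ge0 _).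
pose g i w := (modulus (lf (u i.+1) w - lf (u i) w))%:E.
have pg i : L0plus (g i).
  apply: L0plus_modulus; apply: scalar_measurableB; exact: lf_measurable.
have rg i : (rho (g i) <= (c * (1/2) ^+ i)%:E)%E.
  apply: (@le_trans _ _ (nrm (u i.+1 - u i))%:E); last by rewrite lee_fin.
  apply: rho_le_nrm; first exact: pg.
  by apply: filterS (lfB (u i.+1) (u i)) => w ->.
pose G m w := (\sum_(m <= i <oo) g i w)%E.
have pG m : L0plus (G m) by exact: L0plus_series.
have rG m : (rho (G m) <= (2 * c * (1/2) ^+ m)%:E)%E.
  apply: rho_series => // n; apply: le_trans (sum_half_le m n c0).
  by apply: lee_sum => i _; exact: rg.
pose E := [set w | (G 0%N w < +oo)%E].
have mE : measurable E.
  by rewrite -[E]setTI; apply: emeasurable_fun_infty_o => //; exact: (pG 0%N).1.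
have aeE : {ae mu, forall w, E w} by apply: rho_fin_ae (le_lt_trans (rG 0%N) (ltry _)).
have /choice[l Hl] w : exists l : F, E w -> ((fun n => lf (u n) w) : nat -> F^o) @ \oo --> (l : F^o) /\
    forall n, ((modulus (lf (u n) w - l))%:E <= G n w)%E.
  have [Ew|nE] := pselect (E w); last by exists 0.
  by have [l l1 l2] := scalar_summable Ew; exists l.
pose v w := if w \in E then l w else 0 : F.
have mv : scalar_measurable v.
  apply: (@scalar_measurable_cvg R k _ _ (fun n w => if w \in E then lf (u n) w else 0)) => [n|w].
    by apply: scalar_measurable_if => //; exact: lf_measurable.
  rewrite /v; case: ifPn => [/set_mem/Hl[]//|_]; exact: cvg_cst.
have vu n : {ae mu, forall w, ((modulus (v w - lf (u n) w))%:E <= G n w)%E}.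
  apply: filterS aeE => w Ew; rewrite /v mem_set// modulus_distC.
  by have [_] := Hl w Ew; apply.
have [|f Hf] := Lrho_exists mv.
  apply: (@le_lt_trans _ _ (rho (G 0%N \+ fun w => (modulus (lf (u 0%N) w))%:E))%E).
    apply: fn_le; first exact: L0plus_modulus.
      have [m1 p1] := pG 0%N; have [m2 p2] := L0plus_modulus (lf_measurable (u 0%N)).
      by split=> [|w]; [exact: emeasurable_funD|exact: adde_ge0].
    apply: filterS (vu 0%N) => w vw; apply: le_trans (leeD2r _ vw).
    by rewrite -EFinD lee_fin addrC; exact: modulus_le_dist.
  apply: le_lt_trans (fn_add rho (pG 0%N) (L0plus_modulus (lf_measurable (u 0%N)))) _.
  by rewrite -nrm_rho; apply: lte_add_pinfty (ltry _); exact: le_lt_trans (rG 0%N) (ltry _).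
exists f => n; rewrite -lee_fin; apply: le_trans (rG n); apply: nrm_le_rho; first exact: pG.
apply: filterS3 (lfB (u n) f) Hf (vu n) => w -> ->.
by rewrite modulus_distC.
Qed.

(** * The embedding in L_2 *)

Definition sqint f : \bar R := (\int[mu]_w (modulus (lf f w) ^+ 2)%:E)%E.

Let msq f : measurable_fun setT (fun w => (modulus (lf f w) ^+ 2)%:E).
Proof.
apply/measurable_EFinP; apply: measurable_funX; apply: measurable_modulus; exact: lf_measurable.
Qed.

Let sq0 f w : (0 <= (modulus (lf f w) ^+ 2)%:E)%E.
Proof. by rewrite lee_fin sqr_ge0. Qed.

Lemma L2_norm_sqint f : (L2_norm (Lrho_val f) `^ 2)%E = sqint f.
Proof.
rewrite /L2_norm powR_Lnorm; last by rewrite pnatr_eq0.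
apply: eq_integral => w _; rewrite /L0_abs gee0_abs ?lee_fin ?modulus_ge0//.
by rewrite poweR_EFin powR_mulrn ?modulus_ge0.
Qed.

Lemma sqint_ge0 f : (0 <= sqint f)%E.
Proof. by apply: integral_ge0. Qed.

Lemma sqint_le_ae f g : {ae mu, forall w, modulus (lf f w) <= modulus (lf g w)} ->
  (sqint f <= sqint g)%E.
Proof.
move=> fg; apply: ae_ge0_le_integral => //.
apply: filterS fg => w fgw _.
by rewrite lee_fin ler_sqr ?nnegrE ?modulus_ge0.
Qed.

Lemma sqintZ a f : sqint (a *: f) = ((modulus a ^+ 2)%:E * sqint f)%E.
Proof.
rewrite /sqint -ge0_integralZl ?lee_fin ?sqr_ge0//.
apply: ge0_ae_eq_integral => //.
- by apply: measurable_funeM.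
- by move=> w _; rewrite mule_ge0// lee_fin sqr_ge0.
- by apply: filterS (lfZ a f) => w -> _; rewrite modulusM exprMn EFinM.
Qed.

Lemma modulus_parallelogram (x y : F) :
  modulus (x + y) ^+ 2 + modulus (x - y) ^+ 2 = 2 * modulus x ^+ 2 + 2 * modulus y ^+ 2.
Proof.
case: (k) x y => /= [x y|[a b] [a' b'] /=].
  by rewrite !real_normK ?num_real//; ring.
by rewrite !sqr_sqrtr ?addr_ge0 ?sqr_ge0//; ring.
Qed.

Lemma sqint_parallelogram f g :
  (sqint (f + g)%R + sqint (f - g)%R = 2%:E * sqint f + 2%:E * sqint g)%E.
Proof.
rewrite /sqint -!ge0_integralZl// -!ge0_integralD//.
- apply: ge0_ae_eq_integral => //.
  + by apply: emeasurable_funD.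
  + by apply: emeasurable_funD => //; apply: measurable_funeM.
  + by move=> w _; rewrite adde_ge0.
  + by move=> w _; rewrite adde_ge0// mule_ge0// lee_fin.
  apply: filterS2 (lfD f g) (lfB f g) => w -> -> _.
  by rewrite -EFinD modulus_parallelogram EFinD !EFinM.
- by move=> w _; rewrite mule_ge0// lee_fin.
- exact: measurable_funeM.
- by move=> w _; rewrite mule_ge0// lee_fin.
- exact: measurable_funeM.
Qed.

Definition superlevel f (s : R) : set T := [set w | s < modulus (lf f w)].

Lemma measurable_superlevel f s : measurable (superlevel f s).
Proof.
rewrite (_ : superlevel f s = [set: T] `&` (fun w => modulus (lf f w)) @^-1` `]s, +oo[%classic).
  by apply: measurable_modulus => //; exact: lf_measurable.
by rewrite setTI; apply/seteqP; split => w /=; rewrite in_itv/= andbT.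
Qed.

(** Chebyshev's inequality. *)
Lemma sqint_chebyshev f s : 0 <= s -> ((s ^+ 2)%:E * mu (superlevel f s) <= sqint f)%E.
Proof.
move=> s0; have mA := measurable_superlevel f s.
rewrite -(setIT (superlevel f s)) -integral_indic// -ge0_integralZl ?lee_fin ?sqr_ge0//; last first.
  by apply/measurable_EFinP.
apply: ge0_le_integral => //.
- by move=> w _; rewrite mule_ge0// lee_fin ?sqr_ge0.
- by apply: measurable_funeM; apply/measurable_EFinP.
move=> w _; rewrite -EFinM lee_fin indicE; case: (boolP (w \in _)) => [/set_mem /= sw|_].
  by rewrite mulr1 ler_sqr ?nnegrE ?modulus_ge0// ltW.
by rewrite mulr0 sqr_ge0.
Qed.

Section L2Embedding.
Hypothesis L2fin : forall f, (L2_norm (Lrho_val f) < +oo)%E.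

Lemma sqint_fin f : (sqint f < +oo)%E.
Proof. by rewrite -L2_norm_sqint; exact: poweR_lty. Qed.

(** The inclusion of L_rho in L_2 is continuous. Otherwise there would be g n of
    norm 2^-n with squared L_2 norm at least n, and the sum of their moduli would
    be an element of L_rho that dominates every g n, hence not in L_2. *)
Lemma sqint_bounded : exists2 D, 0 <= D & forall f, (sqint f <= (D * nrm f ^+ 2)%:E)%E.
Proof.
apply: contrapT => noD.
have /choice[f Hf] (n : nat) : exists f, ((n%:R * 4 ^+ n * nrm f ^+ 2)%:E < sqint f)%E.
  apply: contrapT => H; apply: noD; exists (n%:R * 4 ^+ n) => [|f].
    by rewrite mulr_ge0 ?exprn_ge0.
  by rewrite leNgt; apply/negP => Hf; apply: H; exists f.
have f0 n : 0 < nrm (f n).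
  rewrite lt_neqAle nrm_ge0 andbT eq_sym; apply/negP => /eqP z; have := Hf n.
  have /eqP : nrm (f n) == 0 by rewrite z.
  move=> /eqP; rewrite nrm_eq0 => /eqP ->; rewrite nrm0 expr0n mulr0.
  by rewrite -(scale0r (0 : L)) sqintZ modulus0 expr0n mul0e ltxx.
pose a n := (nrm (f n))^-1 * (1/2) ^+ n.
have a0 n : 0 <= a n by rewrite mulr_ge0 ?invr_ge0 ?nrm_ge0// exprn_ge0//; lra.
pose g n : L := real_scalar k (a n) *: f n.
have gn n : nrm (g n) = (1/2) ^+ n.
  by rewrite nrmZ modulus_real_scalar// /a mulrAC mulVf ?mul1r// gt_eqF.
have gI n : (n%:R%:E <= sqint (g n))%E.
  rewrite sqintZ modulus_real_scalar//.
  have -> : n%:R = a n ^+ 2 * (n%:R * 4 ^+ n * nrm (f n) ^+ 2).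
    have -> : (4 : R) ^+ n = (2 ^+ n) ^+ 2 by rewrite -exprM mulnC exprM; congr (_ ^+ _); rewrite expr2; lra.
    rewrite /a; have -> : (1/2 : R) ^+ n = (2 ^+ n)^-1 by rewrite div1r exprVn.
    by field; rewrite gt_eqF ?exprn_gt0// gt_eqF.
  by rewrite EFinM lee_wpmul2l ?lee_fin ?sqr_ge0// ltW.
pose u n w := (modulus (lf (g n) w))%:E.
have pu n : L0plus (u n) by apply: L0plus_modulus; exact: lf_measurable.
pose U w := (\sum_(0 <= i <oo) u i w)%E.
have pU : L0plus U by exact: L0plus_series.
have rU : (rho U < +oo)%E.
  apply: (@le_lt_trans _ _ (2 * 1 * (1/2) ^+ 0)%:E); last exact: ltry.
  apply: rho_series => // n; apply: le_trans (sum_half_le 0 n ler01).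
  by apply: lee_sum => i _; rewrite /u -nrm_rho gn [1 * _ ^+ i]mul1r.
pose v w : F := real_scalar k (fine (U w)).
have vU w : modulus (v w) = fine (U w) by rewrite modulus_real_scalar// fine_ge0// pU.2.
have mv : scalar_measurable v.
  by apply: scalar_measurable_real; apply: measurableT_comp pU.1; exact: fine_measurable.
have [|h hv] := Lrho_exists mv.
  apply: le_lt_trans rU; apply: fn_le => //; first exact: L0plus_modulus.
  by apply: aeW => w; rewrite vU; case: (U w) (pU.2 w) => [r||]//= _; rewrite ?leey.
have hg n : (sqint (g n) <= sqint h)%E.
  apply: sqint_le_ae; apply: filterS2 hv (rho_fin_ae pU rU) => w -> Uw.
  rewrite vU -lee_fin fineK; last by rewrite ge0_fin_numE// pU.2.
  rewrite /U (nneseriesD1 (n := n))//; last by move=> i _; exact: (pu i).2.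
  by rewrite leeDl// nneseries_ge0// => i _ _; exact: (pu i).2.
have hfin : sqint h \is a fin_num by rewrite ge0_fin_numE ?sqint_fin ?sqint_ge0.
have := le_trans (gI (Num.truncn (fine (sqint h))).+1) (hg _).
by rewrite -(fineK hfin) lee_fin leNgt truncnS_gt.
Qed.

Definition sqnorm f := fine (sqint f).

Lemma sqnormE f : (sqnorm f)%:E = sqint f.
Proof. by rewrite fineK// ge0_fin_numE ?sqint_fin ?sqint_ge0. Qed.

Lemma sqnorm_ge0 f : 0 <= sqnorm f.
Proof. by rewrite -lee_fin sqnormE sqint_ge0. Qed.

Lemma sqnormZ a f : sqnorm (a *: f) = modulus a ^+ 2 * sqnorm f.
Proof. by apply: EFin_inj; rewrite sqnormE sqintZ -sqnormE -EFinM. Qed.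

Lemma sqnorm_L2_norm f : sqnorm f = fine (L2_norm (Lrho_val f)) ^+ 2.
Proof.
apply: EFin_inj; rewrite sqnormE -L2_norm_sqint.
have l0 : (0 <= L2_norm (Lrho_val f))%E by exact: Lnorm_ge0.
have /fineK {1}<- : L2_norm (Lrho_val f) \is a fin_num by rewrite ge0_fin_numE.
by rewrite poweR_EFin powR_mulrn ?fine_ge0.
Qed.

Lemma sqnorm_gt0 f : 0 < nrm f -> 0 < sqnorm f.
Proof.
move=> f0; rewrite lt_neqAle sqnorm_ge0 andbT eq_sym sqnorm_L2_norm sqrf_eq0.
apply/negP => /eqP z.
have l0 : (0 <= L2_norm (Lrho_val f))%E by exact: Lnorm_ge0.
have Lz : L2_norm (Lrho_val f) = 0%E by rewrite -[LHS]fineK ?z// ge0_fin_numE.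
have := Lnorm_eq0_eq0 (L0_abs_plus (Lrho_val f)).1 _ Lz; rewrite lte_fin => /(_ (ltr0n _ 2)) abs0.
suff fz : f = 0 by move: f0; rewrite fz nrm0 ltxx.
apply: lf_inj; apply: filterS2 abs0 lf0 => w /(_ I) h ->.
by move: h => /= [/eqP]; rewrite modulus_eq0 => /eqP.
Qed.

Lemma sqnorm_parallelogram f g :
  sqnorm (f + g) + sqnorm (f - g) = 2 * sqnorm f + 2 * sqnorm g.
Proof.
by apply: EFin_inj; rewrite !EFinD !EFinM !sqnormE; exact: sqint_parallelogram.
Qed.

(** By the parallelogram identity, either adding or subtracting the next vector
    increases the squared norm by at least that of the vector. *)
Lemma sqnorm_signs (x : nat -> L) n : exists e : nat -> bool,
  \sum_(0 <= i < n) sqnorm (x i) <= sqnorm (\sum_(0 <= i < n) (-1) ^+ e i *: x i).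
Proof.
elim: n => [|n [e IH]]; first by exists xpredT; rewrite !big_geq// sqnorm_ge0.
pose y := \sum_(0 <= i < n) (-1) ^+ e i *: x i.
have [b Hb] : exists b : bool, sqnorm y + sqnorm (x n) <= sqnorm (y + (-1) ^+ b *: x n).
  have [h|h] := leP (sqnorm y + sqnorm (x n)) (sqnorm (y + x n)).
    by exists false; rewrite expr0 scale1r.
  exists true; rewrite expr1 scaleN1r.
  have aux (A B C D : R) : A + B = 2 * C + 2 * D -> A < C + D -> C + D <= B by lra.
  exact: aux (sqnorm_parallelogram y (x n)) h.
exists (fun i => if i == n then b else e i).
have -> : \sum_(0 <= i < n.+1) (-1) ^+ (if i == n then b else e i) *: x i = y + (-1) ^+ b *: x n.
  rewrite big_nat_recr//= eqxx; congr (_ + _).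
  by apply: eq_big_nat => i /andP[_ ni]; rewrite ltn_eqF.
by rewrite big_nat_recr//=; apply: le_trans Hb; rewrite lerD2r.
Qed.

End L2Embedding.

(** * Absolute continuity of the norm *)

Section OrderContinuity.
Hypothesis Ltype2 : rademacher_type2 L.

Lemma lf_lincomb (I : finType) (a : I -> F) (f : I -> L) :
  {ae mu, forall w, lf (\sum_i a i *: f i) w = \sum_i a i * lf (f i) w}.
Proof.
have h : {ae mu, forall w, forall i, lf (a i *: f i) w = a i * lf (f i) w}.
  by apply: filter_forall => i; exact: lfZ.
apply: filterS2 (lf_sum (index_enum I) (fun i => a i *: f i)) h => w -> h.
by apply: eq_bigr => i _; exact: h.
Qed.

(** Index 2^N pieces by the sign patterns s of length N, and let rad i be
    (-1)^(s i) f on piece s. Each rad i is dominated by f, but every signed sum of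
    them has modulus N |f| on the piece given by its own signs. Type 2 would yield
    (N e)^2 <= K N (nrm f)^2 for all N. *)
Lemma no_large_disjoint_pieces (C : nat -> set T) f (e : R) :
  (forall j, measurable (C j)) -> (forall i j w, C i w -> C j w -> i = j) -> 0 < e ->
  ~ forall j, e <= nrm (restr (C j) f).
Proof.
move=> mC dC e0 fe; have [K K0 HK] := type2_signs Ltype2.
have [N HN] : exists N : nat, K * nrm f ^+ 2 / e ^+ 2 < N%:R.
  by exists (Num.truncn (K * nrm f ^+ 2 / e ^+ 2)).+1; exact: truncnS_gt.
have N0 : 0 < N%:R :> R.
  by apply: le_lt_trans HN; rewrite divr_ge0 ?sqr_ge0// mulr_ge0 ?sqr_ge0.
pose pattern := {ffun 'I_N -> bool}.
pose Cp (s : pattern) := C (enum_rank s).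
have dCp s s' w : Cp s w -> Cp s' w -> s = s'.
  by move=> h h'; apply/enum_rank_inj/val_inj; exact: dC h h'.
have mCp s : measurable (Cp s) by exact: mC.
pose rad (i : 'I_N) := \sum_(s : pattern) (-1) ^+ (s i) *: restr (Cp s) f.
have hC : {ae mu, forall w, forall s : pattern, lf (restr (Cp s) f) w = if w \in Cp s then lf f w else 0}.
  by apply: filter_forall => s; exact: restrE.
have hrad : {ae mu, forall w, forall i : 'I_N, lf (rad i) w =
    \sum_(s : pattern) (-1) ^+ (s i) * if w \in Cp s then lf f w else 0}.
  have h : {ae mu, forall w, forall i : 'I_N, lf (rad i) w =
      \sum_(s : pattern) (-1) ^+ (s i) * lf (restr (Cp s) f) w}.
    by apply: filter_forall => i; exact: lf_lincomb.
  apply: filterS2 h hC => w h h' i; rewrite h; apply: eq_bigr => s _.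
  by rewrite h'.
have inC w (i : 'I_N) s0 : Cp s0 w ->
    \sum_(s : pattern) (-1) ^+ (s i) * (if w \in Cp s then lf f w else 0) = (-1) ^+ (s0 i) * lf f w.
  move=> ws0; rewrite (bigD1 s0)//= mem_set// big1 ?addr0// => s ss0.
  by rewrite memNset ?mulr0// => ws; move/eqP : ss0; apply; exact: dCp ws ws0.
have rad_le i : nrm (rad i) <= nrm f.
  apply: nrm_le_ae; apply: filterS hrad => w ->.
  have [[s0 ws0]|H] := pselect (exists s, Cp s w).
    by rewrite (inC w i s0 ws0) modulusM modulus_sign mul1r.
  rewrite big1 ?modulus0 ?modulus_ge0// => s _.
  by rewrite memNset ?mulr0// => ws; apply: H; exists s.
have [t Ht] := HK N (fun i => if insub i is Some j then rad j else 0).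
pose y := \sum_(i < N) (-1) ^+ t i *: rad i.
have yE : \sum_(0 <= i < N) (-1) ^+ t i *: (if insub i is Some j then rad j else 0) = y.
  by rewrite big_mkord; apply: eq_bigr => i _; rewrite valK.
have xE : \sum_(0 <= i < N) nrm (if insub i is Some j then rad j else 0) ^+ 2 =
    \sum_(i < N) nrm (rad i) ^+ 2.
  by rewrite big_mkord; apply: eq_bigr => i _; rewrite valK.
rewrite yE xE in Ht.
(* On the piece s0 all terms of y have the same sign. *)
pose s0 : pattern := [ffun i => t (val i)].
have ylarge : N%:R * e <= nrm y.
  apply: (@le_trans _ _ (nrm ((N%:R : F) *: restr (Cp s0) f))).
    rewrite nrmZ -real_scalar_nat modulus_real_scalar// ler_wpM2l//; exact: fe.
  apply: nrm_le_ae.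
  have hy := lf_lincomb (fun i : 'I_N => (-1) ^+ t i : F) rad.
  near=> w.
  rewrite (near (lfZ N%:R (restr (Cp s0) f)) w)// (near hC w)//.
  case: (boolP (w \in Cp s0)) => [/set_mem ws0|_]; last first.
    by rewrite mulr0 modulus0 modulus_ge0.
  rewrite /y (near hy w)//.
  rewrite (eq_bigr (fun=> lf f w)) ?sumr_const ?card_ord ?mulr_natl// => i _.
  rewrite (near hrad w)// (inC w i s0 ws0) ffunE mulrA.
  by rewrite -expr2 -exprM mulnC exprM sqrrN expr1n expr1n mul1r.
have : (N%:R * e) ^+ 2 <= K * (N%:R * nrm f ^+ 2).
  apply: le_trans (le_trans _ Ht) _.
    by rewrite ler_sqr// nnegrE ?nrm_ge0// mulr_ge0// ltW.
  rewrite ler_wpM2l//; apply: le_trans (ler_sum _ (G := fun=> nrm f ^+ 2) _) _.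
    by move=> i _; rewrite ler_sqr ?nnegrE ?nrm_ge0.
  by rewrite sumr_const card_ord -[leLHS]mulr_natl.
apply/negP; rewrite -ltNge.
move: HN; rewrite ltr_pdivrMr ?exprn_gt0// => HN.
rewrite mulrCA exprMn [X in _ < X * _]expr2 -mulrA ltr_pM2l//.
Unshelve. all: by end_near. Qed.

Lemma nrm_restr_le A B f : measurable A -> measurable B -> A `<=` B ->
  nrm (restr A f) <= nrm (restr B f).
Proof.
move=> mA mB AB; apply: nrm_le_ae.
apply: filterS2 (restrE f mA) (restrE f mB) => w -> ->.
case: (boolP (w \in A)) => [/set_mem/AB/mem_set ->//|_].
by rewrite modulus0 modulus_ge0.
Qed.

(** Otherwise f keeps norm e on sets A n of measure below 2^-n. The unions B n of
    the A m with m >= n decrease to a null set, so by monotone convergence f keeps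
    norm e / 2 on some B n \ B m. Iteration produces disjoint large pieces, which
    type 2 excludes. *)
Lemma absolutely_continuous_nrm f (e : R) : 0 < e -> exists2 del : R, 0 < del &
  forall A, measurable A -> (mu A < del%:E)%E -> nrm (restr A f) < e.
Proof.
move=> e0; apply: contrapT => H.
have /choice[A HA] (n : nat) : exists A, [/\ measurable A, (mu A < ((1/2) ^+ n)%:E)%E & e <= nrm (restr A f)].
  apply: contrapT => H'; apply: H; exists ((1/2) ^+ n) => [|A mA An].
    by rewrite exprn_gt0//; lra.
  by rewrite ltNge; apply/negP => eA; apply: H'; exists A.
have mA n : measurable (A n) by have [] := HA n.
pose B n := \bigcup_(m in [set m | (n <= m)%N]) A m.
have mB n : measurable (B n) by apply: bigcup_measurable.
have BS m n : (m <= n)%N -> B n `<=` B m.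
  by move=> mn w [i /= ni Aw]; exists i => //=; exact: leq_trans mn ni.
have Be n : e <= nrm (restr (B n) f).
  have [_ _ /le_trans] := HA n; apply; apply: nrm_restr_le => //.
  by move=> w Aw; exists n => /=.
have B0 : {ae mu, forall w, exists n, ~ B n w}.
  exists (\bigcap_n B n); split.
  - exact: bigcapT_measurable.
  - apply/eqP; rewrite eq_le measure_ge0 andbT; apply/lee_addgt0Pr => c c0.
    have [N HN] := geometric_small 2 c0; rewrite add0e.
    apply: (@le_trans _ _ (mu (B N))); first by apply: le_measure; rewrite ?inE//; [exact: bigcapT_measurable|move=> w; exact].
    apply: (@le_trans _ _ (2 * 1 * (1/2) ^+ N)%:E); last by rewrite mulr1 lee_fin ltW// HN.
    apply: (@le_trans _ _ (\sum_(N <= i <oo) mu (A i))%E).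
      have -> : (\sum_(N <= i <oo) mu (A i) = \sum_(0 <= i <oo) mu (if (N <= i)%N then A i else set0))%E.
        rewrite [LHS]eseries_cond [LHS]eseries_mkcond; apply: eq_eseriesr => i _.
        by rewrite andTb; case: ifP => //; rewrite measure0.
      apply: measure_sigma_subadditive => //; first by move=> n; case: ifP.
      by move=> w [i /= Ni Aw]; exists i => //=; rewrite Ni.
    apply: lime_le; first by apply: is_cvg_nneseries.
    apply: nearW => n; apply: le_trans (sum_half_le N n ler01).
    by apply: lee_sum => i _; rewrite [1 * _ ^+ i]mul1r; apply/ltW; have [] := HA i.
  - by move=> w /= H' n _; apply: contrapT => nB; apply: H'; exists n.
have /choice[next Hnext] n : exists m, (n < m)%N /\ e / 2 < nrm (restr (B n `\` B m) f).
  apply: contrapT => H'.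
  have cv : (fun m => rho (fun w => (modulus (lf (restr (B n `\` B m) f) w))%:E)) @ \oo -->
      rho (fun w => (modulus (lf (restr (B n) f) w))%:E).
    have hn m := restrE f (measurableD (mB n) (mB m)).
    apply: fn_monotone => [m||m|].
    - by apply: L0plus_modulus; exact: lf_measurable.
    - by apply: L0plus_modulus; exact: lf_measurable.
    - apply: filterS2 (hn m) (hn m.+1) => w -> ->; rewrite lee_fin.
      case: ifPn => [/set_mem[Bn Bm]|_]; last by rewrite modulus0 modulus_ge0.
      by rewrite mem_set//; split => // Bm1; apply: Bm; exact: BS Bm1.
    - apply: filterS3 (ae_foralln hn) (restrE f (mB n)) B0 => w h1 h2 [M HM].
      apply: cvg_near_cst; exists M => // m /= Mm; rewrite h1 h2.
      case: (boolP (w \in B n)) => [/set_mem Bn|Bn].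
        by rewrite mem_set//; split => // Bm; apply: HM; exact: BS Bm.
      by rewrite memNset// => -[/mem_set]; rewrite (negbTE Bn).
  have : (rho (fun w => (modulus (lf (restr (B n) f) w))%:E) <= (e / 2)%:E)%E.
    rewrite -(cvg_lim _ cv)//; apply: lime_le; first by apply/cvg_ex; eexists; exact: cv.
    exists n.+1 => // m /= nm; rewrite -nrm_rho lee_fin leNgt; apply/negP => h.
    by apply: H'; exists m.
  by rewrite -nrm_rho lee_fin; have := Be n; lra.
pose s := fix s j := if j is j'.+1 then next (s j') else 0%N.
have s_mono i j : (i <= j)%N -> (s i <= s j)%N.
  move=> /subnKC <-; elim: (_ - _)%N => [|n IH]; rewrite ?addn0// addnS.
  by apply: leq_trans IH _; apply/ltnW; have [] := Hnext (s (i + n)%N).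
have e20 : 0 < e / 2 by rewrite divr_gt0.
apply: (@no_large_disjoint_pieces (fun j => B (s j) `\` B (s j.+1)) f _ _ _ e20).
- by move=> j; exact: measurableD.
- move=> i j w [Bi nBi] [Bj nBj]; case: (ltngtP i j) => // ij; exfalso.
    by apply: nBi; exact: BS (s_mono _ _ ij) _ Bj.
  by apply: nBj; exact: BS (s_mono _ _ ij) _ Bi.
- by move=> j; apply/ltW; have [] := Hnext (s j).
Qed.

End OrderContinuity.

(** * Peaks and disjoint simple functions *)

Lemma nrm_restr A f : measurable A -> nrm (restr A f) <= nrm f.
Proof.
move=> mA; apply: nrm_le_ae; apply: filterS (restrE f mA) => w ->.
by case: ifP => // _; rewrite modulus0 modulus_ge0.
Qed.

Lemma sub_restr_setD A U f : measurable A -> measurable U ->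
  f - restr (A `\` U) f = (f - restr A f) + restr (A `&` U) f.
Proof.
move=> mA mU; apply: lf_inj.
have h1 := restrE f (measurableD mA mU); have h2 := restrE f mA.
have h3 := restrE f (measurableI _ _ mA mU).
have h4 := lfB f (restr (A `\` U) f); have h5 := lfB f (restr A f).
have h6 := lfD (f - restr A f) (restr (A `&` U) f).
near=> w.
rewrite (near h4 w)// (near h6 w)// (near h5 w)// (near h1 w)// (near h2 w)// (near h3 w)//.
rewrite in_setD in_setI; case: (w \in A); case: (w \in U) => /=;
by rewrite ?subr0 ?addr0 ?subrr ?add0r.
Unshelve. all: by end_near. Qed.

Lemma unit_exists : exists f, {ae mu, forall w, lf f w = 1}.
Proof.
have m1 : scalar_measurable (fun _ : T => 1 : F).
  by rewrite -(real_scalar1 R k); apply: scalar_measurable_real; exact: measurable_cst.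
apply: Lrho_exists => //.
have := fn_indic rho measurableT mu_fin.
rewrite (_ : EFin \o \1_setT = fun w : T => (modulus (1 : F))%:E)//.
by apply/funext => w; rewrite /= indicE in_setT modulus1.
Qed.

Lemma superlevel_small f (c s : R) : 0 < s -> (sqint f < (c * s ^+ 2)%:E)%E ->
  (mu (superlevel f s) < c%:E)%E.
Proof.
move=> s0 fc; have := le_lt_trans (sqint_chebyshev f (ltW s0)) fc.
have mfin : mu (superlevel f s) \is a fin_num.
  rewrite ge0_fin_numE//; apply: le_lt_trans mu_fin.
  by apply: le_measure; rewrite ?inE//; exact: measurable_superlevel.
rewrite -(fineK mfin) -EFinM !lte_fin mulrC ltr_pM2r// exprn_gt0//.
Qed.

Section KadecPelczynski.
Hypothesis Ltype2 : rademacher_type2 L.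
Hypothesis L2fin : forall f, (L2_norm (Lrho_val f) < +oo)%E.

(** Where |f| <= t, either |f| <= s, which contributes at most s times the norm
    of the constant 1, or s < |f| <= t. The latter happens on a set of small
    measure, by Chebyshev, where the constant t has small norm by absolute
    continuity. *)
Lemma peak_decomposition (t e : R) : 0 < t -> 0 < e -> exists2 eta : R, 0 < eta &
  forall f, (sqint f < eta%:E)%E ->
    nrm (f - restr (superlevel f t) f) < e /\ (mu (superlevel f t) < e%:E)%E.
Proof.
move=> t0 e0; have [one Hone] := unit_exists.
pose kap := nrm one; have kap0 : 0 <= kap by exact: nrm_ge0.
have [|del del0 Hdel] := @absolutely_continuous_nrm Ltype2 one (e / (2 * t)).
  by rewrite divr_gt0// mulr_gt0.
pose s := e / (2 * (kap + 1)).
have s0 : 0 < s by rewrite divr_gt0// mulr_gt0// ltr_pwDr.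
exists (Num.min (del * s ^+ 2) (e * t ^+ 2)).
  by rewrite lt_min; apply/andP; split; apply: mulr_gt0 => //; exact: exprn_gt0.
move=> f fs.
have fs1 : (mu (superlevel f s) < del%:E)%E.
  by apply: superlevel_small s0 (lt_le_trans fs _); rewrite lee_fin ge_min lexx.
split; last first.
  by apply: superlevel_small t0 (lt_le_trans fs _); rewrite lee_fin ge_min lexx orbT.
have mt := measurable_superlevel f t; have ms := measurable_superlevel f s.
pose g : L := real_scalar k s *: one + real_scalar k t *: restr (superlevel f s) one.
apply: (@le_lt_trans _ _ (nrm g)).
  apply: nrm_le_ae.
  have h1 := restrE f mt; have h2 := restrE one ms.
  have h3 := lfB f (restr (superlevel f t) f).
  have h4 := lfD (real_scalar k s *: one) (real_scalar k t *: restr (superlevel f s) one).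
  have h5 := lfZ (real_scalar k s) one.
  have h6 := lfZ (real_scalar k t) (restr (superlevel f s) one).
  near=> w.
  rewrite /g (near h3 w)// (near h4 w)// (near h5 w)// (near h6 w)// (near h1 w)// (near h2 w)//.
  rewrite (near Hone w)// mulr1.
  have -> : real_scalar k s + real_scalar k t * (if w \in superlevel f s then 1 else 0) =
     real_scalar k (s + (if w \in superlevel f s then t else 0)) :> F.
    by rewrite real_scalarD; case: ifP => _; rewrite ?mulr1// mulr0 real_scalar0.
  have ift : 0 <= (if w \in superlevel f s then t else 0) by case: ifP => // _; exact: ltW.
  rewrite modulus_real_scalar; last by rewrite addr_ge0// ltW.
  case: (boolP (w \in superlevel f t)) => [_|].
    by rewrite subrr modulus0 addr_ge0// ltW.
  move=> /negP wt; rewrite subr0.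
  have wt' : modulus (lf f w) <= t by rewrite leNgt; apply/negP => h; apply: wt; exact/mem_set.
  case: (boolP (w \in superlevel f s)) => [_|/negP ws]; first by apply: le_trans wt' _; rewrite lerDr ltW.
  by rewrite addr0 leNgt; apply/negP => h; apply: ws; exact/mem_set.
apply: le_lt_trans (nrmD _ _) _.
rewrite !nrmZ !modulus_real_scalar ?(ltW s0) ?(ltW t0)//.
have h := Hdel _ ms fs1.
have h1 : t * nrm (restr (superlevel f s) one) < e / 2.
  have -> : e / 2 = t * (e / (2 * t)) by field; rewrite gt_eqF.
  by rewrite ltr_pM2l.
have h2 : s * nrm one <= e / 2.
  rewrite -/kap /s mulrAC ler_pdivrMr; last by rewrite mulr_gt0// ltr_pwDr.
  by have := mulr_ge0 (ltW e0) kap0; lra.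
lra.
Unshelve. all: by end_near. Qed.

(** Discard the part of f above a large M, at a small cost by absolute
    continuity, and round the values that remain. Rounding moves them by at most
    1, so a lower bound t of |f| on B becomes t - 1. *)
Lemma simple_approximation f B (t e : R) : measurable B -> 0 < e ->
  (forall w, B w -> t <= modulus (lf f w)) ->
  exists g s, [/\ scalar_measurable s, finite_set (range s), {ae mu, forall w, lf g w = s w},
    (forall w, s w <> 0 -> B w /\ t - 1 <= modulus (s w)) & nrm (restr B f - g) <= e].
Proof.
move=> mB e0 Bt; have [one Hone] := unit_exists.
pose kap := nrm one; have kap0 : 0 <= kap by exact: nrm_ge0.
have e20 : 0 < e / 2 by rewrite divr_gt0.
have [del del0 Hdel] := @absolutely_continuous_nrm Ltype2 f (e / 2) e20.
have [M M0 HM] : exists2 M : R, 0 < M & (mu (superlevel f M) < del%:E)%E.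
  have I0 := sqnorm_ge0 L2fin f.
  (* Chebyshev at this height gives a measure below del. *)
  pose M := Num.sqrt ((sqnorm f + 1) / del).
  have M2 : M ^+ 2 = (sqnorm f + 1) / del by rewrite sqr_sqrtr// divr_ge0 ?(ltW del0)// addr_ge0.
  have M0 : 0 < M by rewrite sqrtr_gt0 divr_gt0// ltr_pwDr.
  exists M => //; apply: superlevel_small => //; rewrite M2 mulrC divfK ?gt_eqF//.
  by rewrite -sqnormE// lte_fin ltrDl.
pose r0 := Num.min 1 (e / (2 * (kap + 1))).
have r00 : 0 < r0 by rewrite lt_min ltr01 divr_gt0// mulr_gt0// ltr_pwDr.
have [r [rx rfin rm]] := scalar_rounding k r00.
pose A := B `\` superlevel f M.
have mA : measurable A by apply: measurableD => //; exact: measurable_superlevel.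
pose s w : F := if w \in A then r (lf f w) else 0.
have ms : scalar_measurable s.
  by apply: scalar_measurable_if => //; apply: rm; exact: lf_measurable.
have Aw w : w \in A -> B w /\ modulus (lf f w) <= M.
  by move=> /set_mem[Bw nw]; split => //; rewrite leNgt; apply/negP.
have [g Hg] : exists g, {ae mu, forall w, lf g w = s w}.
  apply: Lrho_exists => //.
  apply: le_lt_trans (rho_le_nrm (f := real_scalar k (M + r0) *: one) _ _) (ltry _).
    exact: L0plus_modulus.
  apply: filterS2 (lfZ (real_scalar k (M + r0)) one) Hone => w -> ->.
  rewrite mulr1 modulus_real_scalar ?addr_ge0 ?(ltW M0) ?(ltW r00)// lee_fin /s.
  case: ifP => [/Aw[_ fM]|_]; last by rewrite modulus0 addr_ge0 ?ltW.
  by apply: le_trans (modulus_le_dist _ (lf f w)) _; apply: lerD fM (rx _).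
exists g, s; split => //.
- apply: (@sub_finite_set _ _ ((r @` [set x | modulus x <= M]) `|` [set 0])).
    move=> _ [w _ <-]; rewrite /s; case: ifP => [/Aw[_ fM]|_]; last by right.
    by left; exists (lf f w).
  by rewrite finite_setU; split => //; exact: rfin.
- move=> w; rewrite /s; case: ifP => // /Aw[Bw _] _; split => //.
  have := rx (lf f w); have := modulus_le_dist (lf f w) (r (lf f w)).
  rewrite modulus_distC; have := Bt w Bw; have : r0 <= 1 by rewrite ge_min lexx.
  lra.
have mM := measurable_superlevel f M.
apply: (@le_trans _ _ (nrm (restr (B `&` superlevel f M) f) + nrm (real_scalar k r0 *: one))).
  have -> : restr B f - g = restr (B `&` superlevel f M) f + (restr A f - g).
    have H := sub_restr_setD f mB mM; rewrite -/A in H.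
    have -> : restr (B `&` superlevel f M) f = restr B f - restr A f.
      by rewrite -(subrKA f) [RHS]addrC H [X in X + _]addrC -addrA -opprB subrr addr0.
    by rewrite subrKA.
  apply: le_trans (nrmD _ _) _; rewrite lerD2l; apply: nrm_le_ae.
  have h1 := restrE f mA; have h2 := lfB (restr A f) g; have h3 := lfZ (real_scalar k r0) one.
  near=> w.
  rewrite (near h2 w)// (near h3 w)// (near h1 w)// (near Hg w)// (near Hone w)//.
  rewrite mulr1 modulus_real_scalar ?(ltW r00)// /s modulus_distC.
  by case: ifP => _; [exact: rx|rewrite subrr modulus0 ltW].
rewrite nrmZ modulus_real_scalar ?(ltW r00)//.
have h : nrm (restr (B `&` superlevel f M) f) < e / 2.
  apply: Hdel; first exact: measurableI.
  apply: le_lt_trans HM; apply: le_measure; rewrite ?inE//; first exact: measurableI.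
have h2 : r0 * nrm one <= e / 2.
  apply: (@le_trans _ _ (e / (2 * (kap + 1)) * kap)); first by rewrite ler_wpM2r// ge_min lexx orbT.
  rewrite mulrAC ler_pdivrMr; last by rewrite mulr_gt0// ltr_pwDr.
  by have := mulr_ge0 (ltW e0) kap0; lra.
lra.
Unshelve. all: by end_near. Qed.

(** Kadec and Pelczynski. The set A n where the n-th chosen function exceeds
    n + 1 carries it up to e n. Later sets are chosen so small, compared with the
    moduli of absolute continuity of the functions chosen before, that removing
    their union U n from A n costs another e n. *)
Lemma almost_disjoint_subsequence (psi : nat -> L) (e : nat -> R) :
  (forall n, 0 < e n) ->
  (forall N (eta : R), 0 < eta -> exists n, (N <= n)%N /\ (sqint (psi n) < eta%:E)%E) ->
  exists (i : nat -> nat) (B : nat -> set T), [/\ forall m n, (m < n)%N -> (i m < i n)%N,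
    forall n, measurable (B n), forall m n w, B m w -> B n w -> m = n,
    forall n w, B n w -> n.+1%:R <= modulus (lf (psi (i n)) w) &
    forall n, nrm (psi (i n) - restr (B n) (psi (i n))) < 2 * e n].
Proof.
move=> e0 small.
have /choice[del Hdel] (p : nat * nat) : exists del : R, 0 < del /\
    forall A, measurable A -> (mu A < del%:E)%E -> nrm (restr A (psi p.1)) < e p.2.
  by have [del d0 Hd] := @absolutely_continuous_nrm Ltype2 (psi p.1) _ (e0 p.2); exists del.
have /choice[pick Hpick] (p : nat * nat * R) : exists i : nat, 0 < p.2 -> [/\ (p.1.2 <= i)%N,
    nrm (psi i - restr (superlevel (psi i) p.1.1.+1%:R) (psi i)) < e p.1.1 &
    (mu (superlevel (psi i) p.1.1.+1%:R) < (p.2 * (1/2) ^+ p.1.1.+1)%:E)%E].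
  case: p => [[n N] D] /=; have [D0|_] := ltP 0 D; last by exists 0%N.
  have D1 : 0 < D * (1/2) ^+ n.+1 by rewrite mulr_gt0// exprn_gt0//; lra.
  pose e' := Num.min (e n) (D * (1/2) ^+ n.+1).
  have e'0 : 0 < e' by rewrite lt_min e0.
  have [eta eta0 Heta] := @peak_decomposition n.+1%:R e' (ltr0Sn _ _) e'0.
  have [i [Ni psii]] := small N eta eta0; have [h1 h2] := Heta _ psii.
  exists i => _; split=> //; first by apply: lt_le_trans h1 _; rewrite ge_min lexx.
  by apply: lt_le_trans h2 _; rewrite lee_fin ge_min lexx orbT.
(* st n is the n-th index together with a bound for the measure of all later
   sets. *)
pose st := fix st n : nat * R := if n is n'.+1
  then let i := pick (n, (st n').1.+1, (st n').2) in (i, Num.min (st n').2 (del (i, n)))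
  else let i := pick (0%N, 0%N, 1) in (i, del (i, 0%N)).
have D0 n : 0 < (st n).2.
  elim: n => [|n IH] /=; first by have [] := Hdel (pick (0%N, 0%N, 1), 0%N).
  by rewrite lt_min IH; have [] := Hdel (pick (n.+1, (st n).1.+1, (st n).2), n.+1).
have D_mono m n : (m <= n)%N -> (st n).2 <= (st m).2.
  move=> /subnKC <-; elim: (_ - _)%N => [|j IH]; first by rewrite addn0.
  by rewrite addnS; apply: le_trans IH; rewrite /= ge_min lexx.
have D_del n : (st n).2 <= del ((st n).1, n).
  by case: n => [|n] //=; rewrite ge_min lexx orbT.
pose i n := (st n).1; pose A n := superlevel (psi (i n)) n.+1%:R.
have mA n : measurable (A n) by exact: measurable_superlevel.
have iS n : (i n < i n.+1)%N by have [] := Hpick (n.+1, (st n).1.+1, (st n).2) (D0 n).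
have Aflat n : nrm (psi (i n) - restr (A n) (psi (i n))) < e n.
  case: n => [|n]; first by have [] := Hpick (0%N, 0%N, 1) ltr01.
  by have [] := Hpick (n.+1, (st n).1.+1, (st n).2) (D0 n).
have Asmall m n : (n < m)%N -> (mu (A m) <= ((st n).2 / 2 * (1/2) ^+ m)%:E)%E.
  case: m => // m nm; have [_ _ /ltW h] := Hpick (m.+1, (st m).1.+1, (st m).2) (D0 m).
  have p0 : 0 <= (1/2 : R) ^+ m.+1 by apply: exprn_ge0; lra.
  apply: le_trans h _; rewrite lee_fin /= [_ ^+ m.+2]exprS mulrA ler_wpM2r//.
  by have := D_mono n m nm; lra.
pose U n := \bigcup_(m in [set m | (n < m)%N]) A m.
have mU n : measurable (U n) by apply: bigcup_measurable.
have Usmall n : (mu (U n) < (st n).2%:E)%E.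
  apply: (@le_lt_trans _ _ (2 * ((st n).2 / 2) * (1/2) ^+ n.+1)%:E); last first.
    rewrite lte_fin exprS; have p1 : (1/2 : R) ^+ n <= 1 by apply: exprn_ile1; lra.
    have p0 : 0 <= (1/2 : R) ^+ n by apply: exprn_ge0; lra.
    by have := D0 n; nra.
  apply: (@le_trans _ _ (\sum_(n.+1 <= j <oo) mu (A j))%E).
    have -> : (\sum_(n.+1 <= j <oo) mu (A j) =
        \sum_(0 <= j <oo) mu (if (n < j)%N then A j else set0))%E.
      rewrite [LHS]eseries_cond [LHS]eseries_mkcond; apply: eq_eseriesr => j _.
      by rewrite andTb; case: ifP => //; rewrite measure0.
    apply: measure_sigma_subadditive => //; first by move=> j; case: ifP.
    by move=> w [j /= nj Aw]; exists j => //=; rewrite nj.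
  apply: lime_le; first by apply: is_cvg_nneseries.
  apply: nearW => N; have D2 : 0 <= (st n).2 / 2 by rewrite divr_ge0 ?(ltW (D0 n)).
  apply: le_trans (sum_half_le n.+1 N D2).
  by rewrite !big_nat; apply: lee_sum => j /andP[nj _]; exact: Asmall.
exists i, (fun n => A n `\` U n); split.
- move=> m n /subnKC <-; elim: (_ - _)%N => [|j IH]; first by rewrite addn0; exact: iS.
  by rewrite addnS; apply: ltn_trans IH (iS _).
- by move=> n; exact: measurableD.
- move=> m n w [Am nUm] [An nUn]; case: (ltngtP m n) => // mn; exfalso.
    by apply: nUm; exists n.
  by apply: nUn; exists m.
- by move=> n w [/ltW].
- move=> n; rewrite (sub_restr_setD (psi (i n)) (mA n) (mU n)).
  apply: le_lt_trans (nrmD _ _) _.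
  have h1 := Aflat n.
  have h2 : nrm (restr (A n `&` U n) (psi (i n))) < e n.
    apply: le_lt_trans (nrm_restr_le _ (measurableI _ _ (mA n) (mU n)) (mU n) (@subIsetr _ _ _)) _.
    have [_ H] := Hdel (i n, n); apply: H => //.
    by apply: lt_le_trans (Usmall n) _; rewrite lee_fin; exact: D_del.
  lra.
Qed.

(** The norming functionals h n of the approximating simple functions Phi n,
    composed with the restrictions to the disjoint sets B n, are biorthogonal to
    Phi and of norm at most 4 / c. *)
Lemma congruent_disjoint_simple (psi : nat -> L) (c : R) :
  0 < c -> (forall n, c <= nrm (psi n)) ->
  (forall N (eta : R), 0 < eta -> exists n, (N <= n)%N /\ (sqint (psi n) < eta%:E)%E) ->
  exists (phi : nat -> nat) (Phi : nat -> L),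
    [/\ (forall m n, (m < n)%N -> (phi m < phi n)%N),
        congruent_sequences (psi \o phi) Phi,
        pairwise_disjointly_supported (fun n => Lrho_val (Phi n)),
        (forall n, simple_class (Lrho_val (Phi n)))
      & escapes_to_infinity (fun n => Lrho_val (Phi n))].
Proof.
move=> c0 psic small.
(* The errors 2 e n and e n add up to c / 16 * (1/2) ^+ n, and 4 / c times c / 16
   is the factor 1 / 4 in the perturbation principle. *)
pose e n := c / 48 * (1/2) ^+ n.
have e0 n : 0 < e n by rewrite mulr_gt0 ?exprn_gt0//; lra.
have [i [B [i_mono mB dB Bpsi psiB]]] := almost_disjoint_subsequence e0 small.
have /choice[Phi /choice[s Hs]] n : exists g s, [/\ scalar_measurable s, finite_set (range s),
    {ae mu, forall w, lf g w = s w},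
    (forall w, s w <> 0 -> B n w /\ n.+1%:R - 1 <= modulus (s w)) &
    nrm (restr (B n) (psi (i n)) - g) <= e n].
  exact: simple_approximation (mB n) (e0 n) (Bpsi n).
have PhiE n : {ae mu, forall w, lf (Phi n) w = s n w} by have [] := Hs n.
have sB n w : s n w <> 0 -> B n w by have [_ _ _ H _] := Hs n; move=> /H[].
have close n : nrm (psi (i n) - Phi n) <= c / 16 * (1/2) ^+ n.
  have [_ _ _ _ h1] := Hs n; have h2 := psiB n.
  have := nrm_triangle (restr (B n) (psi (i n))) (psi (i n)) (Phi n).
  by rewrite /e in h1 h2 *; lra.
have Phi_ge n : c / 2 <= nrm (Phi n).
  have := nrm_le_dist (psi (i n)) (Phi n); have := psic (i n); have := close n.
  have p1 : (1/2 : R) ^+ n <= 1 by apply: exprn_ile1; lra.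
  by have := ler_wpM2l (_ : 0 <= c / 16) p1; rewrite divr_ge0 ?(ltW c0)// => /(_ isT); lra.
have Phi0 n : 0 < nrm (Phi n) by apply: lt_le_trans (Phi_ge n); rewrite divr_gt0.
have /choice[h Hh] n := norming_functional (Phi0 n).
have restrPhi n m : restr (B n) (Phi m) = if n == m then Phi m else 0.
  apply: lf_inj; have h1 := restrE (Phi m) (mB n); have h2 := PhiE m; have h3 := lf0.
  near=> w; rewrite (near h1 w)//.
  case: eqVneq => [->|nm].
    rewrite (near h2 w)//; case: ifPn => // /negP nB.
    have [//|/eqP/sB Bw] := eqVneq (s m w) 0.
    by exfalso; apply: nB; exact/mem_set.
  rewrite (near h3 w)//; case: ifPn => // /set_mem Bw.
  rewrite (near h2 w)//; have [//|/eqP/sB Bw'] := eqVneq (s m w) 0.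
  by move/eqP : nm; case; exact: dB Bw Bw'.
exists i, Phi; split => //.
- apply: (@congruent_perturbation R k L Lrho_complete _ _ (fun n v => h n (restr (B n) v))).
  + by move=> n a u v; rewrite restr_linear//; have [H _ _] := Hh n; rewrite H.
  + move=> n v; have [_ H _] := Hh n.
    have h1 : modulus (h n (restr (B n) v)) <= 4 / c * nrm v.
      apply: le_trans (H _) _; apply: ler_pM; rewrite ?divr_ge0 ?nrm_ge0 ?nrm_restr//.
      rewrite ler_pdivrMr// mulrAC ler_pdivlMr//.
      by have := Phi_ge n; lra.
    apply: le_trans (ler_pM (modulus_ge0 _) (nrm_ge0 _) h1 (close n)) _.
    rewrite le_eqVlt; apply/orP; left; apply/eqP; field.
    by rewrite gt_eqF.
  + move=> n m; rewrite restrPhi; case: eqVneq => [->|_]; first by have [] := Hh m.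
    have [H _ _] := Hh n; have := H (-1) 0 0.
    by rewrite scaleN1r oppr0 addr0 mulN1r addNr.
- move=> m n mn.
  have disj : {ae mu, forall w, ~ (L0_supp (Lrho_val (Phi m)) `&` L0_supp (Lrho_val (Phi n))) w}.
    apply: filterS2 (PhiE m) (PhiE n) => w h1 h2 [/= s1 s2].
    apply: mn; apply: (dB m n w); apply: sB; first by rewrite -h1.
    by rewrite -h2.
  by apply: negligibleS disj => w ww /=; exact.
- by move=> n; have [ms fs _ _ _] := Hs n; exact: Lrho_simple_class ms fs (PhiE n).
- apply/cvgeyPge => M; exists (Num.truncn M).+1 => // n /= Mn.
  apply: (@le_trans _ _ n%:R%:E).
    by rewrite lee_fin; apply: le_trans (ltW (truncnS_gt M)) _; rewrite ler_nat.
  apply/ess_infP; apply: filterS (PhiE n) => w h1; rewrite /patch.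
  case: ifPn => [/set_mem /= sw|_]; last by rewrite leey.
  have sw' : s n w <> 0 by rewrite -h1.
  have [_ _ _ /(_ w sw')[_ +] _] := Hs n.
  by rewrite /L0_abs -/(lf (Phi n)) h1 lee_fin -addn1 natrD addrK.
Unshelve. all: by end_near. Qed.

End KadecPelczynski.

End LrhoBasics.

(** * The dichotomy *)

Theorem theorem4p2 (R : realType) (k : scalar_kind)
    (d : measure_display) (Omega : measurableType d)
    (mu : {finite_measure set Omega -> \bar R}) (rho : function_norm mu)
    (Psi : nat -> Lrho k rho) :
  (forall f : Lrho k rho, (L2_norm (Lrho_val f) < +oo)%E) ->
  rademacher_type2 (Lrho k rho) ->
  unconditional_basic_sequence Psi ->
  semi_normalized Psi ->
  ((0 < ereal_inf (range (fun n => L2_norm (Lrho_val (Psi n)))))%E ->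
     equivalent_sequences Psi (@ell2_unit R k)) /\
  (ereal_inf (range (fun n => L2_norm (Lrho_val (Psi n)))) = 0%E ->
     exists (phi : nat -> nat) (Phi : nat -> Lrho k rho),
       [/\ (forall m n, (m < n)%N -> (phi m < phi n)%N),
           congruent_sequences (Psi \o phi) Phi,
           pairwise_disjointly_supported (fun n => Lrho_val (Phi n)),
           (forall n, simple_class (Lrho_val (Phi n)))
         & escapes_to_infinity (fun n => Lrho_val (Phi n))]).
Proof.
move=> L2fin type2 unc [c0 [M0 [c00 seminorm]]].
have mu_fin : (mu setT < +oo)%E by rewrite -ge0_fin_numE ?fin_num_measure.
have [c c_gt0 cE] := lt0_real_scalar c00.
have PsiM n : c <= nrm (Psi n) <= modulus M0.
  have /andP[h1 h2] := seminorm n.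
  rewrite -!(ler_real_scalar k) nrmE -cE h1/=; apply: le_trans (h2) _.
  rewrite real_scalar_modulus ger0_norm//; apply: le_trans (ltW c00) _.
  exact: le_trans h1 h2.
pose M := modulus M0.
have Vc : complete_nrm (Lrho k rho) by exact: Lrho_complete.
split=> [inf_gt0|inf0].
  have [dl dl0 Hdl] : exists2 dl : R, 0 < dl & forall n, dl <= sqnorm (Psi n).
    have /fineK rE : ereal_inf (range (fun n => L2_norm (Lrho_val (Psi n)))) \is a fin_num.
      rewrite ge0_fin_numE; last exact: ltW.
      by apply: le_lt_trans (L2fin (Psi 0%N)); apply: ereal_inf_lbound; exists 0%N.
    rewrite -rE lte_fin in inf_gt0.
    exists (fine (ereal_inf (range (fun n => L2_norm (Lrho_val (Psi n))))) ^+ 2) => [|n].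
      by rewrite exprn_gt0.
    rewrite sqnorm_L2_norm// ler_sqr ?nnegrE ?(ltW inf_gt0) ?fine_ge0 ?Lnorm_ge0//.
    rewrite -lee_fin rE fineK; last by rewrite ge0_fin_numE ?Lnorm_ge0.
    by apply: ereal_inf_lbound; exists n.
  have [K K0 HK] := unconditional_sign_constant Vc unc.
  have [C C0 HC] := type2_signs type2.
  have [D D0 HD] := sqint_bounded mu_fin L2fin.
  have sqD (f : Lrho k rho) : sqnorm f <= D * nrm f ^+ 2 by have := HD f; rewrite -(sqnormE L2fin) lee_fin.
  have sq_le (x y : R) : 0 <= x -> x <= y -> x ^+ 2 <= y ^+ 2.
    by move=> x0 xy; rewrite ler_sqr// nnegrE// (le_trans x0).
  have lower a n : dl * l2sum a n <= D * K ^+ 2 * nrm (\sum_(0 <= i < n) a i *: Psi i) ^+ 2.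
    have [e He] := sqnorm_signs L2fin (fun i => a i *: Psi i) n.
    apply: (@le_trans _ _ (\sum_(0 <= i < n) sqnorm (a i *: Psi i))).
      rewrite /l2sum mulr_sumr; apply: ler_sum => i _.
      by rewrite sqnormZ// mulrC ler_wpM2l ?sqr_ge0.
    apply: le_trans He _; apply: le_trans (sqD _) _.
    rewrite -mulrA ler_wpM2l// -exprMn; apply: sq_le (nrm_ge0 _) _; exact: HK.
  have upper a n : nrm (\sum_(0 <= i < n) a i *: Psi i) ^+ 2 <= K ^+ 2 * (C * M ^+ 2) * l2sum a n.
    have [e He] := HC n (fun i => a i *: Psi i).
    apply: (@le_trans _ _ (K ^+ 2 * nrm (\sum_(0 <= i < n) (-1) ^+ e i *: (a i *: Psi i)) ^+ 2)).
      have := HK (fun i => (-1) ^+ e i * a i) e n.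
      have -> : \sum_(0 <= i < n) (-1) ^+ e i *: (((-1) ^+ e i * a i) *: Psi i) =
          \sum_(0 <= i < n) a i *: Psi i.
        apply: eq_bigr => i _; rewrite scalerA mulrA -expr2 -exprM mulnC exprM sqrrN.
        by rewrite !expr1n mul1r.
      under [X in _ <= K * nrm X]eq_bigr do rewrite -scalerA.
      by rewrite -exprMn; exact: sq_le (nrm_ge0 _).
    rewrite -mulrA ler_wpM2l ?sqr_ge0//; apply: le_trans He _.
    rewrite -mulrA ler_wpM2l// /l2sum mulr_sumr; apply: ler_sum => i _.
    rewrite nrmZ exprMn mulrC ler_wpM2r ?sqr_ge0//.
    by have /andP[_ h] := PsiM i; exact: sq_le (nrm_ge0 _) h.
  have E0 : 0 < D * K ^+ 2 + 1 by rewrite ltr_pwDr// mulr_ge0 ?sqr_ge0.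
  have G0 : 0 < K ^+ 2 * (C * M ^+ 2) + 1.
    by rewrite ltr_pwDr// mulr_ge0 ?sqr_ge0// mulr_ge0 ?sqr_ge0.
  apply: (@equivalent_ell2_unit R k _ Psi (Num.sqrt (dl / (D * K ^+ 2 + 1)))
      (Num.sqrt (K ^+ 2 * (C * M ^+ 2) + 1)) Vc).
  - by apply: (unc id); exists id.
  - by rewrite sqrtr_gt0 divr_gt0.
  - by rewrite sqrtr_gt0.
  - move=> a n; rewrite sqr_sqrtr; last by rewrite divr_ge0 ?ltW.
    rewrite mulrAC ler_pdivrMr// [leRHS]mulrC; apply: le_trans (lower a n) _.
    by rewrite ler_wpM2r ?sqr_ge0// lerDl.
  - move=> a n; rewrite sqr_sqrtr ?(ltW G0)//; apply: le_trans (upper a n) _.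
    by rewrite ler_wpM2r ?l2sum_ge0// lerDl.
apply: (@congruent_disjoint_simple _ _ _ _ _ _ mu_fin type2 L2fin Psi c c_gt0).
  by move=> n; have /andP[] := PsiM n.
(* An infimum equal to 0 is approached beyond every N, because each of the first
   N functions has positive L_2 norm. *)
move=> N; elim: N => [|N IH] eta eta0.
  have inf_lt : (ereal_inf (range (fun n => L2_norm (Lrho_val (Psi n)))) < (Num.sqrt eta)%:E)%E.
    by rewrite inf0 lte_fin sqrtr_gt0.
  have [_ [n _ <-] Hn] := ereal_inf_lt inf_lt.
  exists n; split => //; rewrite -sqnormE// lte_fin sqnorm_L2_norm//.
  rewrite -(sqr_sqrtr (ltW eta0)) ltr_sqr ?nnegrE ?sqrtr_ge0 ?fine_ge0 ?Lnorm_ge0//.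
  by rewrite -lte_fin fineK// ge0_fin_numE ?Lnorm_ge0.
have sN : 0 < sqnorm (Psi N).
  by apply: sqnorm_gt0 => //; have /andP[h _] := PsiM N; exact: lt_le_trans h.
have [|n [Nn Hn]] := IH (Num.min eta (sqnorm (Psi N))); first by rewrite lt_min eta0.
exists n; split; last by apply: lt_le_trans Hn _; rewrite lee_fin ge_min lexx.
rewrite ltn_neqAle Nn andbT; apply/eqP => NE.
by move: Hn; rewrite NE -sqnormE// lte_fin lt_min ltxx andbF.
Qed.
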